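(* Let $p$ be an odd prime, $F/\mathbb{Q}_p$ a finite extension with ramification index $e$ and inertia degree $f$, and let $\sigma=\det^w\otimes\bigotimes_{j=0}^{f-1}\mathrm{Sym}^{r_j}\overline{\mathbb{F}}_p^2$ be a Serre weight with $2<r_j<p-3$ for all $0\le j\le f-1$. For $m\ge 1$ define the sets $$\mathcal{S}_m^l=\{s_n^{p^l(r_l+1)}\}_{n\ge m}\cup\{\beta s_n^{p^l(r_l+1)}\}_{n\ge m},\qquad \mathcal{S}_m=\bigcup_{l=0}^{f-1}\mathcal{S}_m^l,$$ $$\mathcal{T}_m^k=\{t_n^k\}_{n\ge m}\cup\{\beta t_n^k\}_{n\ge m},\qquad \mathcal{T}_m=\bigcup_{k=0}^{f-1}\mathcal{T}_m^k.$$ Then the images in $\mathrm{ind}_{KZ}^G\sigma/T(\mathrm{ind}_{KZ}^G\sigma)$ of the following sets form a basis, consisting of eigenvectors for the action of $I$, of the $\overline{\mathbb{F}}_p$-vector space $\big(\mathrm{ind}_{KZ}^G\sigma/T(\mathrm{ind}_{KZ}^G\sigma)\big)^{I(1)}$: (1) if $e=1,f=1$ (so $\sigma=\det^w\otimes\mathrm{Sym}^{r}\overline{\mathbb{F}}_p^2$, $r=r_0$): $\{\mathrm{Id}\otimes x^r,\ \alpha\otimes y^r\}$; (2) if $e>1,f=1$: $\mathcal{S}_2\cup\{\mathrm{Id}\otimes x^r,\ \alpha\otimes y^r\}\cup\mathcal{T}_1$; (3) if $e=1,f>1$: $\mathcal{S}_1\cup\{\mathrm{Id}\otimes\bigotimes_{j=0}^{f-1}x_j^{r_j},\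 \alpha\otimes\bigotimes_{j=0}^{f-1}y_j^{r_j}\}$; (4) if $e>1,f>1$: $\mathcal{S}_1\cup\{\mathrm{Id}\otimes\bigotimes_{j=0}^{f-1}x_j^{r_j},\ \alpha\otimes\bigotimes_{j=0}^{f-1}y_j^{r_j}\}\cup\mathcal{T}_1$.
   Context: Let $\mathcal{O}_F$ be the ring of integers of $F$, $\pi$ a uniformizer, $\mathbb{F}_q=\mathcal{O}_F/(\pi)$ the residue field ($q=p^f$), and $[\mu]\in\mathcal{O}_F$ the Teichmüller lift of $\mu\in\mathbb{F}_q$. Let $G=\mathrm{GL}_2(F)$, $K=\mathrm{GL}_2(\mathcal{O}_F)$, $Z$ the center of $G$, $I\subset K$ the Iwahori subgroup (matrices upper triangular mod $\pi$) and $I(1)\subset I$ the pro-$p$ Iwahori subgroup (matrices upper unipotent mod $\pi$). All representations are over $\overline{\mathbb{F}}_p$. A Serre weight $\sigma=\det^w\otimes\bigotimes_{j=0}^{f-1}\mathrm{Sym}^{r_j}\overline{\mathbb{F}}_p^2$ ($0\le r_j\le p-1$, $0\le w\le q-2$) has basis $\bigotimes_j x_j^{r_j-i_j}y_j^{i_j}$, and $g=\begin{pmatrix}a&b\\c&d\end{pmatrix}\in K$ acts through its reduction mod $\pi$ by $\bigotimes_j x_j^{r_j-i_j}y_j^{i_j}\mapsto \overline{\det g}^{\,w}\bigotimes_j(\bar a^{p^j}x_j+\bar c^{p^j}y_j)^{r_j-i_j}(\bar b^{p^j}x_j+\bar d^{p^j}y_j)^{i_j}$; $Z$ acts trivially.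 $\mathrm{ind}_{KZ}^G\sigma$ is the space of functions $\phi:G\to\sigma$ with $\phi(hg)=\sigma(h)\phi(g)$ for $h\in KZ$, compactly supported modulo $KZ$, with $G$ acting by right translation. For $g\in G$, $v\in\sigma$, $g\otimes v$ is the element supported on $KZg^{-1}$ with value $v$ at $g^{-1}$; then $g'\cdot(g\otimes v)=(g'g)\otimes v$ and $gh\otimes v=g\otimes\sigma(h)v$ for $h\in KZ$. Set $\alpha=\begin{pmatrix}1&0\\0&\pi\end{pmatrix}$, $\beta=\begin{pmatrix}0&1\\ \pi&0\end{pmatrix}$, $I_n=\{\sum_{i=0}^{n-1}\pi^i[\mu_i]:\mu_i\in\mathbb{F}_q\}$, and for $\mu\in I_n$ let $\mu_{n-1}\in\mathbb{F}_q$ be its last digit; $g^0_{n,\mu}=\begin{pmatrix}\pi^n&\mu\\0&1\end{pmatrix}$. $T$ is the Hecke operator generating $\mathrm{End}_G(\mathrm{ind}_{KZ}^G\sigma)\cong\overline{\mathbb{F}}_p[T]$, namely the unique $G$-equivariant endomorphism with $T(\mathrm{Id}\otimes v)=\sum_{\lambda\in\mathbb{F}_q}g^0_{1,[\lambda]}\otimes\big(\sum_{\vec i}c_{\vec i}(-\lambda)^{i}\big)\bigotimes_j x_j^{r_j}+\alpha\otimes c_{\vec r}\bigotimes_j y_j^{r_j}$ for $v=\sum_{\vec i}c_{\vec i}\bigotimes_j x_j^{r_j-i_j}y_j^{i_j}$, where $i=\sum_j i_jp^j$ and $\vec r=(r_0,\dots,r_{f-1})$. For $n\ge1$: $s_n^k=\sum_{\mu\in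 I_n}g^0_{n,\mu}\otimes\mu_{n-1}^k\bigotimes_{j=0}^{f-1}x_j^{r_j}$ ($0\le k\le q-1$) and $t_n^k=\sum_{\mu\in I_n}g^0_{n,\mu}\otimes\bigotimes_{j\ne k}x_j^{r_j}\otimes x_k^{r_k-1}y_k$ ($0\le k\le f-1$). *)

(* Defs.v *)
From HB Require Import structures.
From mathcomp Require Import all_boot all_order all_algebra all_field.
From mathcomp Require Import generic_quotient ring_quotient.
From mathcomp Require Import boolp classical_sets functions.
From mathcomp Require Import ring zify.

Set Implicit Arguments.
Unset Strict Implicit.
Unset Printing Implicit Defensive.

Import Order.TTheory GRing.Theory Num.Theory.


Local Open Scope quotient_scope.
Local Open Scope classical_set_scope.
Local Open Scope ring_scope.

(* Valuations are integer valued and their value at 0 is junk: every use is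
   guarded by a test to 0, as in [val_ge v N], the ball of the x with
   v(x) >= N, where v(0) = +oo. *)
Definition val_ge (F : fieldType) (v : F -> int) (N : int) : {pred F} :=
  fun x => (x == 0) || (N <= v x).

Record is_normalized_valuation (F : fieldType) (v : F -> int) : Prop := {
  nval_mul : forall x y, x != 0 -> y != 0 -> v (x * y) = v x + v y;
  nval_min : forall x y, x != 0 -> y != 0 -> x + y != 0 ->
    Order.min (v x) (v y) <= v (x + y);
  nval_onto : exists2 x, x != 0 & v x = 1
}.

(* (K, v) is the completion of the rationals for the p-adic valuation. *)
Record is_padic_numbers (p : nat) (K : fieldType) (v : K -> int) : Prop := {
  Qp_val : is_normalized_valuation v;
  Qp_nat : forall n, (0 < n)%N -> n%:R != 0 :> K /\ v n%:R = logn p n;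
  Qp_dense : forall x N, exists a : rat, x - ratr a \in val_ge v N;
  Qp_complete : forall u : nat -> K,
    (forall N, exists n0, forall m n,
       (n0 <= m)%N -> (n0 <= n)%N -> u m - u n \in val_ge v N) ->
    exists l, forall N, exists n0, forall n,
       (n0 <= n)%N -> u n - l \in val_ge v N
}.

(* [red] identifies [k] with the quotient of the valuation ring by its maximal
   ideal; it is junk outside the valuation ring. *)
Record is_residue_map (F : fieldType) (v : F -> int) (k : fieldType)
    (red : F -> k) : Prop := {
  redD : {in val_ge v 0 &, {morph red : x y / x + y}};
  redM : {in val_ge v 0 &, {morph red : x y / x * y}};
  red1 : red 1 = 1;
  red_eq0 : {in val_ge v 0, forall x, (red x == 0) = (x \in val_ge v 1)};
  red_onto : forall a, exists2 x, x \in val_ge v 0 & red x = a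
}.

(* A finite extension of Q_p of ramification index e and inertia degree f, with
   its normalized valuation (the one extending that of Q_p, up to the factor e),
   its residue field, a uniformizer and the Teichmueller lift (the
   multiplicative section of the reduction). *)
Record padicField (p e f : nat) := PadicField {
  pf_prime : prime p;
  pf_Qp : fieldType;
  pf_Qp_val : pf_Qp -> int;
  pf_QpP : is_padic_numbers p pf_Qp_val;
  pf_field :> fieldExtType pf_Qp;
  pf_val : pf_field -> int;
  pf_valP : is_normalized_valuation pf_val;
  pf_ramification : forall a, a != 0 -> pf_val a%:A = e%:Z * pf_Qp_val a;
  pf_residue : finFieldType;
  pf_red : pf_field -> pf_residue;
  pf_redP : is_residue_map pf_val pf_red;
  pf_inertia : #|pf_residue| = (p ^ f)%N;
  pf_unif : pf_field;
  pf_unif_neq0 : pf_unif != 0;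
  pf_unif_val : pf_val pf_unif = 1;
  pf_teich : pf_residue -> pf_field;
  pf_teichM : {morph pf_teich : a b / a * b};
  pf_teich_int : forall a, pf_teich a \in val_ge pf_val 0;
  pf_teichK : cancel pf_teich pf_red
}.

Section GL2.
Variable F : fieldType.

Record GL2 := MkGL2 { gl2_mx :> 'M[F]_2; _ : gl2_mx \in unitmx }.

HB.instance Definition _ := [isSub for gl2_mx].
HB.instance Definition _ := [Choice of GL2 by <:].

Lemma gl2_unit (g : GL2) : (g : 'M_2) \in unitmx. Proof. by case: g. Qed.

Definition gl2_mul (g h : GL2) : GL2 :=
  MkGL2 (eq_ind_r is_true (introT andP (conj (gl2_unit g) (gl2_unit h)))
           (unitmx_mul g h)).
Definition gl2_one : GL2 := MkGL2 (unitmx1 F 2).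
Fact gl2_inv_subproof (g : GL2) : invmx (g : 'M_2) \in unitmx.
Proof. by rewrite unitmx_inv gl2_unit. Qed.
Definition gl2_inv (g : GL2) : GL2 := MkGL2 (gl2_inv_subproof g).

Fact gl2_mulA : associative gl2_mul.
Proof. by move=> g h k; apply: val_inj; rewrite /= mulmxA. Qed.
Fact gl2_mul1g : left_id gl2_one gl2_mul.
Proof. by move=> g; apply: val_inj; rewrite /= mul1mx. Qed.
Fact gl2_mulg1 : right_id gl2_one gl2_mul.
Proof. by move=> g; apply: val_inj; rewrite /= mulmx1. Qed.
Fact gl2_mulVg : left_inverse gl2_one gl2_inv gl2_mul.
Proof. by move=> g; apply: val_inj; rewrite /= mulVmx ?gl2_unit. Qed.
Fact gl2_mulgV : right_inverse gl2_one gl2_inv gl2_mul.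
Proof. by move=> g; apply: val_inj; rewrite /= mulmxV ?gl2_unit. Qed.

HB.instance Definition _ := isGroup.Build GL2 gl2_mulA gl2_mul1g gl2_mulg1
  gl2_mulVg gl2_mulgV.

Lemma gl2_mulE (g h : GL2) : (g * h)%g = g *m h :> 'M_2. Proof. by []. Qed.
Lemma gl2_1E : (1%g : GL2) = 1%:M :> 'M_2. Proof. by []. Qed.

Definition mx22 (a b c d : F) : 'M_2 :=
  \matrix_(i, j) nth 0 (nth [::] [:: [:: a; b]; [:: c; d]] i) j.

Lemma det22 (A : 'M[F]_2) : \det A = A 0 0 * A 1 1 - A 0 1 * A 1 0.
Proof.
rewrite (expand_det_row _ 0) !big_ord_recl big_ord0 /cofactor !det_mx11 !mxE.
rewrite /= addr0 !expr0 mul1r expr1 mulN1r mulrN.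
by congr (A _ _ * A _ _ - A _ _ * A _ _); apply: val_inj.
Qed.

Fact mx22_unit a b c d : a * d - b * c != 0 -> mx22 a b c d \in unitmx.
Proof. by rewrite unitmxE det22 !mxE /= unitfE. Qed.

Definition gl22 a b c d (h : a * d - b * c != 0) : GL2 :=
  MkGL2 (mx22_unit h).

End GL2.

Section Cokernel.
Variables (R : nzRingType) (V : lmodType R) (T : {linear V -> V}).

Definition image_pred : {pred V} := fun v => `[< exists u, v = T u >].

Fact image_submod_closed : submod_closed image_pred.
Proof.
split=> [|a u v /asboolP[u' ->] /asboolP[v' ->]]; apply/asboolP.
  by exists 0; rewrite linear0.
by exists (a *: u' + v'); rewrite linearP.
Qed.

HB.instance Definition _ := GRing.isSubmodClosed.Build R V image_pred
  (GRing.submod_closed_semi image_submod_closed).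

Definition coker := Quotient.quot image_pred.
HB.instance Definition _ := GRing.Zmodule.on coker.

Definition coker_pi (v : V) : coker := \pi v.
Definition coker_repr (q : coker) : V := repr q.

Lemma coker_reprK : cancel coker_repr coker_pi.
Proof. exact: reprK. Qed.
Lemma coker_piE v w : (coker_pi v == coker_pi w) = (v - w \in image_pred).
Proof. by rewrite Quotient.idealrBE. Qed.
Lemma coker_piD : {morph coker_pi : v w / v + w}.
Proof. exact: Quotient.pi_add. Qed.

Definition coker_scale (a : R) (q : coker) : coker :=
  coker_pi (a *: coker_repr q).

Lemma coker_piZ a v : coker_pi (a *: v) = coker_scale a (coker_pi v).
Proof.
apply/eqP; rewrite coker_piE -scalerBr rpredZ // -coker_piE.
by rewrite coker_reprK.
Qed.

Fact coker_scaleA a b q :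
  coker_scale a (coker_scale b q) = coker_scale (a * b) q.
Proof. by rewrite -[q]coker_reprK -!coker_piZ scalerA. Qed.
Fact coker_scale1 : left_id 1 coker_scale.
Proof. by move=> q; rewrite -[q]coker_reprK -!coker_piZ scale1r. Qed.
Fact coker_scaleDr : right_distributive coker_scale +%R.
Proof.
move=> a q q'; rewrite -[q]coker_reprK -[q']coker_reprK.
by rewrite -coker_piD -!coker_piZ scalerDr coker_piD.
Qed.
Fact coker_scaleDl q : {morph coker_scale^~ q : a b / a + b}.
Proof.
move=> a b; rewrite -[q]coker_reprK -!coker_piZ.
by rewrite scalerDl coker_piD.
Qed.

HB.instance Definition _ := GRing.Zmodule_isLmodule.Build R coker
  coker_scaleA coker_scale1 coker_scaleDr coker_scaleDl.

End Cokernel.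

(* Linear combinations over a possibly infinite set are those of its finite
   subsets, enumerated without repetition by [s]. *)
Definition is_basis (R : nzRingType) (V : lmodType R) (U B : set V) : Prop :=
  [/\ B `<=` U,
      forall (s : seq V) (c : V -> R), uniq s -> [set` s] `<=` B ->
        \sum_(b <- s) c b *: b = 0 -> {in s, forall b, c b = 0} &
      forall u, U u -> exists (s : seq V) (c : V -> R),
        [/\ uniq s, [set` s] `<=` B & u = \sum_(b <- s) c b *: b]].

Section SymmetricPower.
Variable C : fieldType.

(* Bivariate polynomials are represented in {poly {poly C}}, x being the inner
   variable and y the outer one. *)
Definition sym_x : {poly {poly C}} := 'X%:P.
Definition sym_y : {poly {poly C}} := 'X.

(* The coefficient of x^(n-k) y^k in (a x + c y)^(n-i) (b x + d y)^i. *)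
Definition sym_coef (n : nat) (a b c d : C) (i k : nat) : C :=
  ((a%:P%:P * sym_x + c%:P%:P * sym_y) ^+ (n - i)
   * (b%:P%:P * sym_x + d%:P%:P * sym_y) ^+ i)`_k`_(n - k).

Local Notation emb x := (x%:P%:P).

Let homog n (F : {poly {poly C}} -> {poly {poly C}} -> {poly {poly C}}) :=
  exists cf : nat -> C, forall u v,
    F u v = \sum_(m < n.+1) emb (cf m) * u ^+ (n - m) * v ^+ m.

Let emb0 : emb (0 : C) = 0. Proof. by rewrite !rmorph0. Qed.
Let embD (a b : C) : emb (a + b) = emb a + emb b.
Proof. by rewrite !rmorphD. Qed.
Let embM (a b : C) : emb (a * b) = emb a * emb b.
Proof. by rewrite !rmorphM. Qed.

Let homog_lin n a c F : homog n F ->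
  homog n.+1 (fun u v => (emb a * u + emb c * v) * F u v).
Proof.
case=> cf Fcf.
exists (fun m => (if m is m'.+1 then c * cf m' else 0)
                 + (if (m <= n)%N then a * cf m else 0)) => u v.
rewrite Fcf mulrDl.
under [RHS]eq_bigr do rewrite embD 2!mulrDl.
rewrite big_split /= addrC; congr (_ + _).
  rewrite [RHS]big_ord_recr /= ltnn emb0 !mul0r addr0 big_distrr /=.
  apply: eq_bigr => m _; have le_mn : (m <= n)%N by rewrite -ltnS.
  by rewrite le_mn embM subSn // exprS; ring.
rewrite [RHS]big_ord_recl /= emb0 !mul0r add0r big_distrr /=.
by apply: eq_bigr => m _; rewrite /bump /= add1n subSS embM exprS; ring.
Qed.

Let homog_prod n a b c d i : (i <= n)%N ->
  homog n (fun u v => (emb a * u + emb c * v) ^+ (n - i)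
                      * (emb b * u + emb d * v) ^+ i).
Proof.
move=> le_in; rewrite -[n in homog n](subnK le_in).
elim: (n - i)%N => [|m [cf IH]].
  rewrite add0n; elim: i {le_in} => [|i [cf IH]].
    exists (fun=> 1) => u v; rewrite big_ord_recl big_ord0 /=.
    by rewrite !expr0 !rmorph1 !mulr1 addr0.
  have [|cf' E] := @homog_lin i b d
    (fun u v => (emb a * u + emb c * v) ^+ 0 * (emb b * u + emb d * v) ^+ i).
    by exists cf.
  by exists cf' => u v; rewrite -E exprS; ring.
have [|cf' E] := @homog_lin (m + i)%N a c
  (fun u v => (emb a * u + emb c * v) ^+ m * (emb b * u + emb d * v) ^+ i).
  by exists cf.
by exists cf' => u v; rewrite -E exprS mulrA.
Qed.

Lemma sym_coefE n a b c d i : (i <= n)%N -> forall u v : {poly {poly C}},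
  (a%:P%:P * u + c%:P%:P * v) ^+ (n - i) * (b%:P%:P * u + d%:P%:P * v) ^+ i
  = \sum_(m < n.+1) (sym_coef n a b c d i m)%:P%:P * u ^+ (n - m) * v ^+ m.
Proof.
move=> le_in u v; have [cf E] := @homog_prod n a b c d i le_in.
rewrite E; apply: eq_bigr => -[m /= lt_mn] _; congr (_%:P%:P * _ * _).
rewrite /sym_coef E coef_sum (bigD1 (Ordinal lt_mn)) //= big1 ?addr0 => [|k neq].
  rewrite coefMXn ltnn subnn -rmorphXn -rmorphM coefC /= coefCM coefXn.
  by rewrite eqxx mulr1.
rewrite coefMXn; case: ifP => // /negbT; rewrite -leqNgt => le_km.
rewrite -rmorphXn -rmorphM coefC subn_eq0 leqNgt ltn_neqAle le_km andbT.
by rewrite (_ : val k != m) //=; apply: contraNN neq => /eqP e; apply/eqP/val_inj.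
Qed.

Lemma sym_coef_uniq n cf cf' :
  \sum_(m < n.+1) (cf m)%:P%:P * sym_x ^+ (n - m) * sym_y ^+ m
  = \sum_(m < n.+1) (cf' m)%:P%:P * sym_x ^+ (n - m) * sym_y ^+ m ->
  forall k : 'I_n.+1, cf k = cf' k.
Proof.
have E (g : 'I_n.+1 -> C) (k : 'I_n.+1) :
  (\sum_(m < n.+1) (g m)%:P%:P * sym_x ^+ (n - m) * sym_y ^+ m)`_k`_(n - k)
  = g k.
  rewrite !coef_sum (bigD1 k) //= big1 ?addr0 => [|m neq].
    rewrite coefMXn ltnn subnn -rmorphXn -rmorphM coefC /= coefCM coefXn.
    by rewrite eqxx mulr1.
  rewrite coefMXn; case: ifP => [_|/negbT]; first by rewrite coef0.
  rewrite -leqNgt => le_mk.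
  rewrite -rmorphXn -rmorphM coefC subn_eq0 leqNgt ltn_neqAle le_mk andbT.
  by rewrite (_ : val m != val k) /= ?coef0.
by move=> H k; rewrite -(E cf k) H E.
Qed.

Lemma sym_coefM n a b c d a' b' c' d' (l k : 'I_n.+1) :
  sym_coef n (a * a' + b * c') (a * b' + b * d') (c * a' + d * c')
    (c * b' + d * d') l k
  = \sum_(i < n.+1) sym_coef n a' b' c' d' l i * sym_coef n a b c d i k.
Proof.
have le_n (m : 'I_n.+1) : (m <= n)%N by rewrite -ltnS.
pose rhs (k : 'I_n.+1) :=
  \sum_(i < n.+1) sym_coef n a' b' c' d' l i * sym_coef n a b c d i k.
rewrite -[RHS]/(rhs k); apply: (sym_coef_uniq (cf := fun k => _)).
rewrite -sym_coefE //.
under [RHS]eq_bigr do rewrite /rhs !rmorph_sum !big_distrl /=.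
rewrite exchange_big /=.
transitivity (\sum_(i < n.+1) (sym_coef n a' b' c' d' l i)%:P%:P
   * (a%:P%:P * sym_x + c%:P%:P * sym_y) ^+ (n - i)
   * (b%:P%:P * sym_x + d%:P%:P * sym_y) ^+ i); last first.
  apply: eq_bigr => i _; rewrite -mulrA sym_coefE // big_distrr /=.
  by apply: eq_bigr => m _; rewrite !rmorphM /= !mulrA.
rewrite -sym_coefE //; congr (_ ^+ _ * _ ^+ _); rewrite !rmorphD !rmorphM /=;
  ring.
Qed.

Lemma sym_coef1 n i k : (i <= n)%N -> (k <= n)%N ->
  sym_coef n 1 0 0 1 i k = (i == k)%:R.
Proof.
move=> le_in le_kn; rewrite /sym_coef !rmorph1 !rmorph0 !mul1r !mul0r addr0 add0r.
rewrite coefMXn -rmorphXn coefC; case: ltngtP => [_|lt_ik|->].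
- by rewrite coef0.
- by rewrite subn_eq0 leqNgt lt_ik /= coef0.
- by rewrite subnn /= coefXn eqxx.
Qed.

End SymmetricPower.

Section Weights.
Variables (p e f : nat) (F : padicField p e f).
Variables (C : closedFieldType) (iota : {rmorphism pf_residue F -> C}).

Local Notation v := (@pf_val p e f F).
Local Notation O := (val_ge v 0).
Local Notation red := (@pf_red p e f F).
Local Notation varpi := (pf_unif F).
Local Notation G := (GL2 F).

Lemma pf_val1 : v 1 = 0.
Proof.
have /(congr1 (fun x => x - v 1)) := nval_mul (pf_valP F) (oner_neq0 _) (oner_neq0 _).
by rewrite mulr1 subrr addrK.
Qed.

Lemma pf_valV x : x != 0 -> v x^-1 = - v x.
Proof.
move=> x0; apply/eqP; rewrite -addr_eq0 -(nval_mul (pf_valP F)) ?invr_eq0 //.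
by rewrite mulVf // pf_val1.
Qed.

Lemma pf_valXz n : v (varpi ^ n) = n.
Proof.
have vn (m : nat) : v (varpi ^+ m) = m%:Z.
  elim: m => [|m IH]; first by rewrite expr0 pf_val1.
  by rewrite exprS (nval_mul (pf_valP F)) ?expf_neq0 ?pf_unif_neq0 // IH
    pf_unif_val -intS.
case: n => m; first exact: vn.
by rewrite NegzE -exprnN pf_valV ?vn // expf_neq0 // pf_unif_neq0.
Qed.

Fact pf_int_subring_closed : subring_closed O.
Proof.
have O1 : 1 \in O by rewrite unfold_in pf_val1 lexx orbT.
have OM x y : x \in O -> y \in O -> x * y \in O.
  rewrite !unfold_in mulf_eq0.
  case: eqVneq => //= x0; case: eqVneq => //= y0 vx vy.
  by rewrite (nval_mul (pf_valP F)) // addr_ge0.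
have OD x y : x \in O -> y \in O -> x + y \in O.
  have [->|x0] := eqVneq x 0; first by rewrite add0r.
  have [->|y0] := eqVneq y 0; first by rewrite addr0.
  rewrite !unfold_in (negPf x0) (negPf y0) /=; case: eqVneq => //= xy0 vx vy.
  by apply: le_trans (nval_min (pf_valP F) x0 y0 xy0); rewrite le_min vx.
have ON : -1 \in O.
  rewrite unfold_in oppr_eq0 oner_eq0 /=.
  have m10 : -1 != 0 :> F by rewrite oppr_eq0 oner_eq0.
  have := nval_mul (pf_valP F) m10 m10.
  by rewrite mulrNN mulr1 pf_val1; move: (v (-1)) => z; lia.
split=> // x y Ox Oy; apply: OD => //.
by rewrite -mulN1r; apply: OM.
Qed.

HB.instance Definition _ := GRing.isSubringClosed.Build F O
  pf_int_subring_closed.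

Definition GL2_int : {pred G} := fun g =>
  [forall i, forall j, (g : 'M_2) i j \in O] && (v (\det (g : 'M_2)) == 0).
Definition iwahori : {pred G} := fun g =>
  (g \in GL2_int) && ((g : 'M_2) 1 0 \in val_ge v 1).
Definition pro_p_iwahori : {pred G} := fun g =>
  [&& g \in iwahori, (g : 'M_2) 0 0 - 1 \in val_ge v 1
    & (g : 'M_2) 1 1 - 1 \in val_ge v 1].

Lemma GL2_intP (g : G) : reflect
  ((forall i j, (g : 'M_2) i j \in O) /\ v (\det (g : 'M_2)) = 0)
  (g \in GL2_int).
Proof.
apply: (iffP andP) => [[/forallP gO /eqP ->]|[gO ->]]; split=> //.
  by move=> i j; move/forallP: (gO i).
by apply/forallP=> i; apply/forallP.
Qed.

Lemma GL2_det_neq0 (g : G) : \det (g : 'M_2) != 0.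
Proof. by rewrite -unitfE -unitmxE gl2_unit. Qed.

Lemma GL2_detM (g h : G) : \det ((g * h)%g : 'M_2)
  = \det (g : 'M_2) * \det (h : 'M_2).
Proof. exact: det_mulmx. Qed.

Lemma GL2_int1 : 1%g \in GL2_int.
Proof.
apply/GL2_intP; split=> [i j|]; last by rewrite det1 pf_val1.
by rewrite mxE; case: (_ == _); rewrite ?rpred1 ?rpred0.
Qed.

Lemma GL2_intM g h : g \in GL2_int -> h \in GL2_int -> (g * h)%g \in GL2_int.
Proof.
move=> /GL2_intP[gO dg] /GL2_intP[hO dh]; apply/GL2_intP; split=> [i j|].
  by rewrite mxE rpred_sum // => k _; rewrite rpredM.
by rewrite GL2_detM (nval_mul (pf_valP F)) ?GL2_det_neq0 // dg dh.
Qed.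

Lemma GL2_intV g : g \in GL2_int -> (g^-1)%g \in GL2_int.
Proof.
move=> /GL2_intP[gO dg]; apply/GL2_intP.
have dV : v (\det (g : 'M_2))^-1 = 0 by rewrite pf_valV ?GL2_det_neq0 // dg.
split=> [i j|]; last by rewrite -[((g^-1)%g : 'M_2)]/(invmx _) det_inv.
rewrite -[((g^-1)%g : 'M_2)]/(invmx _) /invmx gl2_unit !mxE.
rewrite rpredM //; first by rewrite unfold_in dV lexx orbT.
by rewrite /cofactor det_mx11 !mxE rpredM // rpredX // rpredN rpred1.
Qed.

Fact pf_scalar_subproof n : varpi ^ n * varpi ^ n - 0 * 0 != 0.
Proof. by rewrite mulr0 subr0 mulf_neq0 // expfz_neq0 // pf_unif_neq0. Qed.
Definition pf_scalar (n : int) : G := gl22 (pf_scalar_subproof n).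

(* Every h in KZ is uniquely pi^n k with k in K, and det h then has valuation
   2 n; [KZ_part h] is this k. See KZP and KZ_part_id. *)
Definition KZ_part (h : G) : G :=
  (pf_scalar (- (v (\det (h : 'M_2)) %/ 2)%Z) * h)%g.
Definition KZ : {pred G} := fun h => KZ_part h \in GL2_int.

Lemma KZE h : (h \in KZ) = (KZ_part h \in GL2_int). Proof. by []. Qed.

Lemma pf_scalarE n : pf_scalar n = (varpi ^ n)%:M :> 'M_2.
Proof.
apply/matrixP => i j; rewrite !mxE.
by case: i => [[|[|//]] ?]; case: j => [[|[|//]] ?].
Qed.

Lemma pf_scalarC n g : (pf_scalar n * g = g * pf_scalar n)%g.
Proof.
apply: val_inj; rewrite -[LHS]/(pf_scalar n *m g) -[RHS]/(g *m pf_scalar n).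
by rewrite !pf_scalarE scalar_mxC.
Qed.

Lemma pf_scalarD m n : pf_scalar (m + n) = (pf_scalar m * pf_scalar n)%g.
Proof.
apply: val_inj; rewrite -[RHS]/(pf_scalar m *m pf_scalar n).
rewrite -[LHS]/(gl2_mx _) !pf_scalarE -scalar_mxM expfzDr //.
exact: pf_unif_neq0.
Qed.

Lemma pf_scalar0 : pf_scalar 0 = 1%g.
Proof. by apply: val_inj; rewrite -[LHS]/(gl2_mx _) pf_scalarE expr0z. Qed.

Lemma pf_scalar_det n g :
  v (\det ((pf_scalar n * g)%g : 'M_2)) = 2 * n + v (\det (g : 'M_2)).
Proof.
have u0 m : varpi ^ m != 0 by rewrite expfz_neq0 // pf_unif_neq0.
rewrite GL2_detM pf_scalarE det_scalar expr2 !(nval_mul (pf_valP F)) ?mulf_neq0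
  ?GL2_det_neq0 // pf_valXz; ring.
Qed.

Lemma KZ_partZ n k h : k \in GL2_int ->
  KZ_part (pf_scalar n * k * h)%g = (k * KZ_part h)%g.
Proof.
case/GL2_intP=> _ dk; rewrite /KZ_part -mulgA pf_scalar_det GL2_detM.
rewrite (nval_mul (pf_valP F)) ?GL2_det_neq0 // dk add0r.
rewrite mulrC divzMDl // !mulgA -pf_scalarD opprD addrAC addNr add0r.
by rewrite pf_scalarC.
Qed.

Lemma KZP h : reflect (exists n k, k \in GL2_int /\ h = (pf_scalar n * k)%g)
                      (h \in KZ).
Proof.
apply: (iffP idP) => [Kh|[n [k [Kk ->]]]].
  exists (v (\det (h : 'M_2)) %/ 2)%Z, (KZ_part h); split=> //.
  by rewrite /KZ_part mulgA -pf_scalarD subrr pf_scalar0 mul1g.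
rewrite KZE -[(_ * k)%g]mulg1 KZ_partZ // GL2_intM //.
by rewrite /KZ_part gl2_1E det1 pf_val1 div0z oppr0 pf_scalar0 mul1g GL2_int1.
Qed.

Lemma KZ_part_id n k : k \in GL2_int -> KZ_part (pf_scalar n * k)%g = k.
Proof.
move=> Kk; rewrite -[(_ * k)%g]mulg1 KZ_partZ //.
by rewrite /KZ_part gl2_1E det1 pf_val1 div0z oppr0 pf_scalar0 !mulg1.
Qed.

Lemma KZ_partM g h : g \in KZ -> KZ_part (g * h)%g = (KZ_part g * KZ_part h)%g.
Proof. by case/KZP=> n [k [Kk ->]]; rewrite KZ_partZ // KZ_part_id. Qed.

Lemma KZ_mull g h : g \in KZ -> ((g * h)%g \in KZ) = (h \in KZ).
Proof.
move=> Kg; have := Kg; rewrite !KZE KZ_partM // => Kg'; apply/idP/idP => [Kgh|Kh].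
  by rewrite -[KZ_part h](mulKg (KZ_part g)) GL2_intM ?GL2_intV.
exact: GL2_intM.
Qed.

Lemma KZV g : g \in KZ -> (g^-1)%g \in KZ.
Proof.
case/KZP=> n [x [Kx ->]]; apply/KZP; exists (- n), (x^-1)%g.
split; first exact: GL2_intV.
rewrite invgM pf_scalarC; congr (_ * _)%g.
by apply: (@mulgI _ (pf_scalar n)); rewrite mulgV -pf_scalarD subrr pf_scalar0.
Qed.

Lemma KZ1 : 1%g \in KZ.
Proof.
by apply/KZP; exists 0, 1%g; rewrite GL2_int1 pf_scalar0 mulg1.
Qed.

(* Weights are given by their coordinates in the monomial basis, indexed by the
   families i with i_j <= r_j: [monomial i] is the tensor product over j of the
   x_j^(r_j - i_j) y_j^(i_j). *)
Variables (r : 'I_f -> nat) (w : nat).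

Definition multi_index := {dffun forall j : 'I_f, 'I_(r j).+1}.
Definition weight := {ffun multi_index -> C^o}.
HB.instance Definition _ := GRing.Lmodule.on weight.

Definition monomial (i : multi_index) : weight := [ffun k => (k == i)%:R].
Definition index_x : multi_index := [ffun j => ord0].
Definition index_y : multi_index := [ffun j => ord_max].
Definition index_xy (k : 'I_f) : multi_index := [ffun j => inord (j == k)].

Definition red_frob (j : nat) (x : F) : C := iota (red x) ^+ (p ^ j).

Definition sigma (g : G) (u : weight) : weight :=
  [ffun k : multi_index => iota (red (\det (g : 'M_2))) ^+ w *
    \sum_(i : multi_index) u i *
      \prod_(j < f) sym_coef (r j)
        (red_frob j ((g : 'M_2) 0 0)) (red_frob j ((g : 'M_2) 0 1))
        (red_frob j ((g : 'M_2) 1 0)) (red_frob j ((g : 'M_2) 1 1))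
        (i j) (k j)].

Lemma multi_index_distr (P : forall j : 'I_f, 'I_(r j).+1 -> C) :
  \sum_(i : multi_index) \prod_(j < f) P j (i j)
  = \prod_(j < f) \sum_(m : 'I_(r j).+1) P j m.
Proof.
rewrite (reindex (@dffun_of_fprod _ (fun j => 'I_(r j).+1))) /=; last first.
  exact/onW_bij/dffun_of_fprod_bij.
pose P' j : {ffun 'I_(r j).+1 -> C} := [ffun m => P j m].
transitivity (\sum_(t : fprod (fun j : 'I_f => 'I_(r j).+1 : finType))
   \prod_(j in 'I_f) P' j (t j)).
  by apply: eq_bigr => t _; apply: eq_bigr => j _; rewrite !ffunE.
rewrite big_fprod.
transitivity (\prod_(j < f) \sum_(m : 'I_(r j).+1) P' j m); last first.
  by apply: eq_bigr => j _; apply: eq_bigr => m _; rewrite ffunE.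
under [RHS]eq_bigr do rewrite (big_tag (fun j => P' j)).
by rewrite bigA_distr_big_dep.
Qed.

Lemma pchar_C : p \in [pchar C].
Proof.
by rewrite (fmorph_pchar iota) (card_finPcharP (pf_inertia F) (pf_prime F)).
Qed.

Lemma red_frobD j : {in O &, {morph red_frob j : x y / x + y}}.
Proof.
move=> x y Ox Oy; rewrite /red_frob (redD (pf_redP F)) // rmorphD exprDn_pchar //.
rewrite pnatX (pnatE _ (pf_prime F)) pchar_C; by case: j.
Qed.

Lemma red_frobM j : {in O &, {morph red_frob j : x y / x * y}}.
Proof.
by move=> x y Ox Oy; rewrite /red_frob (redM (pf_redP F)) // rmorphM exprMn.
Qed.

Lemma red_frob1 j : red_frob j 1 = 1.
Proof. by rewrite /red_frob (red1 (pf_redP F)) rmorph1 expr1n. Qed.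

Lemma red_frob0 j : red_frob j 0 = 0.
Proof.
rewrite /red_frob; have /eqP -> : red 0 == 0.
  by rewrite (red_eq0 (pf_redP F)) ?rpred0 // unfold_in eqxx.
by rewrite rmorph0 expr0n expn_eq0 -[p == 0]negbK -lt0n (prime_gt0 (pf_prime F)).
Qed.

Lemma GL2_int_det g : g \in GL2_int -> \det (g : 'M_2) \in O.
Proof. by case/GL2_intP=> _ dg; rewrite unfold_in dg lexx orbT. Qed.

Lemma GL2_mulE (g h : G) i j : ((g * h)%g : 'M[F]_2) i j
  = (g : 'M_2) i 0 * (h : 'M_2) 0 j + (g : 'M_2) i 1 * (h : 'M_2) 1 j.
Proof.
rewrite gl2_mulE mxE !big_ord_recl big_ord0 addr0.
by rewrite (_ : lift ord0 ord0 = 1) //; apply: val_inj.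
Qed.

Lemma sigmaM g h u : g \in GL2_int -> h \in GL2_int ->
  sigma (g * h)%g u = sigma g (sigma h u).
Proof.
move=> Kg Kh; have [/= gO _] := GL2_intP _ Kg; have [/= hO _] := GL2_intP _ Kh.
apply/ffunP => k.
rewrite [LHS]ffunE [RHS]ffunE.
rewrite (GL2_detM g h).
rewrite (redM (pf_redP F) (GL2_int_det Kg) (GL2_int_det Kh)).
rewrite rmorphM exprMn -mulrA.
congr (_ * _).
under [RHS]eq_bigr do rewrite ffunE -mulrA.
rewrite -big_distrr /=.
apply: (congr1 ( *%R _)).
under [RHS]eq_bigr do rewrite big_distrl /=.
rewrite exchange_big /=; apply: eq_bigr => l _.
under [RHS]eq_bigr do rewrite -mulrA -big_split /=.
rewrite -big_distrr /=; congr (_ * _).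
rewrite (multi_index_distr (fun j m =>
  sym_coef (r j) (red_frob j ((h : 'M_2) 0 0)) (red_frob j ((h : 'M_2) 0 1))
    (red_frob j ((h : 'M_2) 1 0)) (red_frob j ((h : 'M_2) 1 1)) (l j) m
  * sym_coef (r j) (red_frob j ((g : 'M_2) 0 0)) (red_frob j ((g : 'M_2) 0 1))
    (red_frob j ((g : 'M_2) 1 0)) (red_frob j ((g : 'M_2) 1 1)) m (k j))).
apply: eq_bigr => j _; rewrite -sym_coefM !GL2_mulE.
have E i m : red_frob j ((g : 'M_2) i 0 * (h : 'M_2) 0 m
      + (g : 'M_2) i 1 * (h : 'M_2) 1 m)
    = red_frob j ((g : 'M_2) i 0) * red_frob j ((h : 'M_2) 0 m)
      + red_frob j ((g : 'M_2) i 1) * red_frob j ((h : 'M_2) 1 m).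
  have ghO n q : (g : 'M_2) i n * (h : 'M_2) q m \in O by apply: rpredM.
  rewrite (red_frobD _ (ghO 0 0) (ghO 1 1)).
  by rewrite (red_frobM _ (gO i 0) (hO 0 m)) (red_frobM _ (gO i 1) (hO 1 m)).
by rewrite !E.
Qed.

Lemma sigma1 u : sigma 1%g u = u.
Proof.
have E (i k : multi_index) j : sym_coef (r j)
    (red_frob j (((1%g : G) : 'M_2) 0 0)) (red_frob j (((1%g : G) : 'M_2) 0 1))
    (red_frob j (((1%g : G) : 'M_2) 1 0)) (red_frob j (((1%g : G) : 'M_2) 1 1))
    (i j) (k j) = (i j == k j)%:R.
  by rewrite gl2_1E !mxE /= red_frob1 red_frob0 sym_coef1 // -ltnS.
apply/ffunP => k; rewrite ffunE; under eq_bigr do under eq_bigr do rewrite E.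
rewrite gl2_1E det1 (red1 (pf_redP F)) rmorph1 expr1n mul1r.
rewrite (bigD1 k) //= [X in _ + X]big1 ?addr0.
  by rewrite big1 ?mulr1 // => j _; rewrite eqxx.
move=> i neq_ik.
have /existsP[j neq] : [exists j, i j != k j].
  apply: contraR neq_ik => /existsPn eq; apply/eqP/ffunP => j.
  by have /negPn/eqP := eq j.
by rewrite (bigD1 j) //= (negPf neq) mul0r mulr0.
Qed.

Lemma sigma_linear g : linear (sigma g).
Proof.
move=> a u u'; apply/ffunP => k; rewrite !ffunE.
under eq_bigr do rewrite !ffunE mulrDl -scalerAl.
rewrite big_split /= mulrDr -scaler_sumr; congr (_ + _); exact: mulrCA.
Qed.

(* The scalar matrix of the uniformizer acts trivially. The units of O_F cannot
   in general: in K they act by the central character of sigma. *)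
Definition sigma_KZ (h : G) : weight -> weight := sigma (KZ_part h).


Lemma sigma_KZM g h u : g \in KZ -> h \in KZ ->
  sigma_KZ (g * h)%g u = sigma_KZ g (sigma_KZ h u).
Proof.
move=> Kg Kh; rewrite /sigma_KZ (KZ_partM _ Kg); move: Kg Kh; rewrite !KZE.
exact: sigmaM.
Qed.

Lemma sigma_KZ1 u : sigma_KZ 1%g u = u.
Proof.
rewrite /sigma_KZ /KZ_part gl2_1E det1 pf_val1 div0z oppr0 pf_scalar0 mul1g.
exact: sigma1.
Qed.

Lemma sigma_KZ0 h : sigma_KZ h 0 = 0.
Proof.
have := sigma_linear (KZ_part h) (-1) 0 0.
by rewrite scaler0 addr0 scaleN1r addNr.
Qed.

(* As KZ is open, a function is compactly supported modulo KZ when its support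
   is covered by finitely many cosets KZ g. *)
Definition is_ind (phi : G -> weight) : Prop :=
  (forall h g, h \in KZ -> phi (h * g)%g = sigma_KZ h (phi g)) /\
  (exists s : seq G, forall g, phi g != 0 ->
     exists2 g0, g0 \in s & (g * g0^-1)%g \in KZ).

Definition ind_pred : {pred (G -> weight)} := fun phi => `[< is_ind phi >].

Fact ind_submod_closed : submod_closed ind_pred.
Proof.
have linK h : linear (sigma_KZ h) := sigma_linear (KZ_part h).
split=> [|a phi psi /asboolP[phiK [s phis]] /asboolP[psiK [t psit]]].
  apply/asboolP; split=> [h g _|]; last by exists [::] => g; rewrite eqxx.
  by rewrite -[RHS]/(sigma_KZ h 0) sigma_KZ0.
apply/asboolP; split=> [h g Kh|].
  rewrite -[LHS]/(a *: phi (h * g)%g + psi (h * g)%g) phiK // psiK //.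
  by rewrite -linK.
exists (s ++ t) => g; rewrite -[(_ + _) g]/(a *: phi g + psi g).
have [phi0|/phis[g0 sg0 Kg0] _] := eqVneq (phi g) 0; last first.
  by exists g0; rewrite // mem_cat sg0.
have [psi0|/psit[g0 tg0 Kg0] _] := eqVneq (psi g) 0; last first.
  by exists g0; rewrite // mem_cat tg0 orbT.
by rewrite phi0 psi0 scaler0 addr0 eqxx.
Qed.

HB.instance Definition _ := GRing.isSubmodClosed.Build C (G -> weight) ind_pred
  (GRing.submod_closed_semi ind_submod_closed).

Record ind := Ind { ind_fun :> G -> weight; _ : ind_fun \in ind_pred }.

HB.instance Definition _ := [isSub for ind_fun].
HB.instance Definition _ := [Choice of ind by <:].
HB.instance Definition _ := [SubChoice_isSubLmodule of ind by <:].

Lemma indP (phi : ind) : is_ind phi.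
Proof. by apply/asboolP; exact: (valP phi). Qed.

Fact act_subproof (g : G) (phi : ind) : (fun h => phi (h * g)%g) \in ind_pred.
Proof.
have [phiK [s phis]] := indP phi; apply/asboolP; split=> [h h' Kh|].
  by rewrite -mulgA (phiK _ _ Kh).
exists [seq (g0 * g^-1)%g | g0 <- s] => h /= /phis[g0 sg0 Kg0].
exists (g0 * g^-1)%g; first by apply/mapP; exists g0.
by rewrite invgM invgK mulgA.
Qed.
Definition act (g : G) (phi : ind) : ind := Ind (act_subproof g phi).

Fact tens_subproof (g : G) (u : weight) :
  (fun h => if (h * g)%g \in KZ then sigma_KZ (h * g)%g u else 0) \in ind_pred.
Proof.
apply/asboolP; split=> [h h' Kh|].
  rewrite -(mulgA h h' g) (KZ_mull _ Kh) /=.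
  case: (boolP ((h' * g)%g \in KZ)) => Khg; last by rewrite sigma_KZ0.
  exact: sigma_KZM.
exists [:: (g^-1)%g] => h; case: (boolP ((h * g)%g \in KZ)) => [Khg _|_ /eqP//].
by exists (g^-1)%g; [exact: mem_head | rewrite invgK].
Qed.

(* g (x) u, supported on KZ g^-1, with value u at g^-1 *)
Definition tens (g : G) (u : weight) : ind := Ind (tens_subproof g u).

Lemma tensV g u : tens g u (g^-1)%g = u.
Proof. by rewrite /= mulVg KZ1 sigma_KZ1. Qed.

Lemma act_tens g' g u : act g' (tens g u) = tens (g' * g)%g u.
Proof. by apply: val_inj; apply/funext => h; rewrite /= mulgA. Qed.

Lemma tens_KZ g h u : h \in KZ -> tens (g * h)%g u = tens g (sigma_KZ h u).
Proof.
move=> Kh; apply: val_inj; apply/funext => k; rewrite /= mulgA.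
have -> : ((k * g * h)%g \in KZ) = ((k * g)%g \in KZ).
  apply/idP/idP => [Kkgh|Kkg]; last by rewrite (KZ_mull _ Kkg).
  rewrite -[(k * g)%g](mulgK h); rewrite (KZ_mull _ Kkgh); exact: KZV.
case: (boolP ((k * g)%g \in KZ)) => [Kkg|//]; exact: sigma_KZM.
Qed.

Lemma act_linear g : linear (act g).
Proof. by move=> a phi psi; apply: val_inj. Qed.

Fact gl2_g0_subproof (n : nat) (mu : F) : varpi ^+ n * 1 - mu * 0 != 0.
Proof. by rewrite mulr1 mulr0 subr0 expf_neq0 // pf_unif_neq0. Qed.
Definition gl2_g0 (n : nat) (mu : F) : G := gl22 (gl2_g0_subproof n mu).

Fact gl2_alpha_subproof : 1 * varpi - 0 * 0 != 0.
Proof. by rewrite mul1r mul0r subr0 pf_unif_neq0. Qed.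
Definition gl2_alpha : G := gl22 gl2_alpha_subproof.

Fact gl2_beta_subproof : 0 * 0 - 1 * varpi != 0.
Proof. by rewrite mul1r mul0r sub0r oppr_eq0 pf_unif_neq0. Qed.
Definition gl2_beta : G := gl22 gl2_beta_subproof.

(* I_n is indexed by the digits (mu_0, ..., mu_(n-1)) of its elements. *)
Definition teich_sum (n : nat) (mu : n.-tuple (pf_residue F)) : F :=
  \sum_(i < n) varpi ^+ i * pf_teich (tnth mu i).

(* This determines T, as the tens 1 u generate ind under G. *)
Definition is_hecke (T : ind -> ind) : Prop :=
  (forall g phi, T (act g phi) = act g (T phi)) /\
  (forall u : weight, T (tens 1%g u) =
     \sum_(l : pf_residue F) tens (gl2_g0 1 (pf_teich l))
       ((\sum_(i : multi_index) u i * (- iota l) ^+ (\sum_(j < f) i j * p ^ j))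
        *: monomial index_x)
     + tens gl2_alpha (u index_y *: monomial index_y)).

(* The digit mu_(n-1) is the last one: these are meant for n >= 1. *)
Definition elt_s (n k : nat) : ind :=
  \sum_(mu : n.-tuple (pf_residue F))
    tens (gl2_g0 n (teich_sum mu)) (iota (last 0 mu) ^+ k *: monomial index_x).
Definition elt_t (n : nat) (k : 'I_f) : ind :=
  \sum_(mu : n.-tuple (pf_residue F))
    tens (gl2_g0 n (teich_sum mu)) (monomial (index_xy k)).

Definition set_S (m : nat) : set ind :=
  \bigcup_(l in [set: 'I_f])
    ([set elt_s n (p ^ l * (r l).+1) | n in [set n | (m <= n)%N]] `|`
     [set act gl2_beta (elt_s n (p ^ l * (r l).+1)) | n in [set n | (m <= n)%N]]).
Definition set_T (m : nat) : set ind :=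
  \bigcup_(k in [set: 'I_f])
    ([set elt_t n k | n in [set n | (m <= n)%N]] `|`
     [set act gl2_beta (elt_t n k) | n in [set n | (m <= n)%N]]).
Definition set_base : set ind :=
  [set tens 1%g (monomial index_x); tens gl2_alpha (monomial index_y)].

(* The action of G on ind / T(ind); it is well defined when T is
   G-equivariant. *)
Definition coker_act (T : {linear ind -> ind}) (g : G) (q : coker T)
    : coker T := coker_pi T (act g (coker_repr q)).

Lemma coker_act_pi (T : {linear ind -> ind}) : is_hecke T ->
  forall g phi, coker_act g (coker_pi T phi) = coker_pi T (act g phi).
Proof.
case=> TG _ g phi; apply/eqP; rewrite coker_piE.
have : coker_repr (coker_pi T phi) - phi \in image_pred T.
  by rewrite -coker_piE coker_reprK.
case/asboolP=> psi E; apply/asboolP; exists (act g psi); rewrite TG -E.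
by apply: val_inj.
Qed.

Definition pro_p_invariants (T : {linear ind -> ind}) : set (coker T) :=
  [set q | forall g, g \in pro_p_iwahori -> coker_act g q = q].

Definition is_iwahori_eigenvector (T : {linear ind -> ind}) (q : coker T)
    : Prop :=
  q != 0 /\ forall g, g \in iwahori -> exists a : C, coker_act g q = a *: q.

(* The family of the images is meant, so that they are pairwise distinct. *)
Definition images_form_eigenbasis (T : {linear ind -> ind}) (B : set ind)
    : Prop :=
  [/\ {in B &, injective (coker_pi T)},
      is_basis (@pro_p_invariants T) (coker_pi T @` B) &
      forall phi, B phi -> is_iwahori_eigenvector (coker_pi T phi)].

End Weights.

Arguments set_S {p e f F C iota r w} m.
Arguments set_T {p e f F C iota r w} m.
Arguments set_base {p e f F C iota r w}.

(* Main.v *)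
Require Import Defs.
From HB Require Import structures.
From mathcomp Require Import all_boot all_order all_algebra all_field.
From mathcomp Require Import boolp classical_sets functions.
From mathcomp Require Import ring zify.

Set Implicit Arguments.
Unset Strict Implicit.
Unset Printing Implicit Defensive.

Import Order.TTheory GRing.Theory Num.Theory.
Local Open Scope ring_scope.

(* The cosets of KZ in G are represented by the g^0_(n,x) and the
   beta g^0_(n,x), so that an element phi of the induction is a pair of families
   of vectors of sigma, its coordinates on the two sides of the tree.  In these
   coordinates T sends u at level n to a multiple of x^r at level n+1, plus a
   combination of translates of y^r at level n-1; in particular the top level of
   T psi only has x^r components, and it vanishes only if the top level of psi
   does.  The unipotent element (1 b; 0 1) translates x by b, and a vector u of
   sigma is determined by the function b |-> (x^r-coordinate of (1 b; 0 1) u) on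
   F_q; the functions so obtained are those whose reduced polynomial only has
   exponents sum_j d_j p^j with d_j <= r_j.

   If phi is I(1)-invariant modulo im T then, at its top level n, (g - 1) phi is
   T psi with psi at level n-1.  Hence the components of phi outside x^r and the
   x_l^(r_l - 1) y_l are zero, the latter are constant, and the x^r component is, as
   a function of the last digit b of x, a function coming from sigma plus a
   combination of the b^(p^l (r_l + 1)): up to im T, phi is a combination of the
   t_n^l and of the s_n at the top level.  For e = 1 the t_n^l are excluded by
   the carries in the addition of Teichmueller expansions, which also exclude the
   s_n for f = 1, e = 1, n >= 2; the s_1 for f = 1 are excluded by the other side
   of the tree.  Independence modulo im T follows from the same description of
   the top level of T psi. *)

(** * Functions on the residue field *)

(** A function on level n+1 is absorbed by T under two conditions: along the last digit it must come
    from sigma, and its preimage must have no part going down the tree, which only involves y^r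
    coordinates. The preimages that matter have exponents with a single nonzero base p digit; as
    every r_j is positive, such an exponent can be that of y^r only for f = 1. Hence the special
    role of f = 1.

    The bounds on r come from the elements of I that are not translations. They act by homographies
    whose lower left entry is divisible by pi, so that for e > 1 the digit of rank n+1 of the image
    is a polynomial of degree 2 in the digit of rank n. For t_n^l this produces the exponents 0,
    p^l, 2 p^l, and 2 < r_l keeps them in the box and away from y^r. For s_n and f = 1 the part
    going down consists of power sums over F_p of exponents at most r + 2, which vanish because r +
    2 < p - 1.

    Ramification enters through the carry ([a] + [b] - [a + b]) / pi: modulo pi it is a multiple of
    the reduction of p / pi, which is zero exactly when e > 1. *)

Lemma digits_inj (p : nat) (f : nat) (d d' : nat -> nat) :
  (forall j, d j < p)%N -> (forall j, d' j < p)%N ->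
  (\sum_(j < f) d j * p ^ j = \sum_(j < f) d' j * p ^ j)%N ->
  forall j, (j < f)%N -> d j = d' j.
Proof.
elim: f d d' => [//|f IH] d d' ltd ltd'.
have E (c : nat -> nat) : (\sum_(j < f.+1) c j * p ^ j
    = (\sum_(j < f) c j.+1 * p ^ j) * p + c 0)%N.
  rewrite big_ord_recl /= expn0 muln1 addnC; congr (_ + _)%N.
  by rewrite big_distrl /=; apply: eq_bigr => j _; rewrite expnSr mulnA.
have p0 : (0 < p)%N by apply: leq_ltn_trans (ltd 0).
rewrite !E => eq_dd'.
have d0 : d 0 = d' 0.
  by have := congr1 (modn^~ p) eq_dd'; rewrite !modnMDl !modn_small.
have dS : (\sum_(j < f) d j.+1 * p ^ j = \sum_(j < f) d' j.+1 * p ^ j)%N.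
  by move/eqP: eq_dd'; rewrite d0 eqn_add2r eqn_pmul2r // => /eqP.
case=> [//|j] ltj; exact: (IH (fun j => d j.+1) (fun j => d' j.+1)).
Qed.

Lemma digits_lt (p : nat) (f : nat) (d : nat -> nat) :
  (forall j, (j < f)%N -> (d j < p)%N) -> (\sum_(j < f) d j * p ^ j < p ^ f)%N.
Proof.
elim: f => [|f IH] ltd; first by rewrite big_ord0.
rewrite big_ord_recr /=.
have := IH (fun j ltj => ltd j (ltnW ltj)).
have := ltd f (ltnSn f); move: (\sum_(j < f) _)%N => S; rewrite expnS -!multE; nia.
Qed.

Lemma size_sum_leq (R : nzRingType) (I : finType) (P : I -> {poly R}) n :
  (forall i, (size (P i) <= n)%N) -> (size (\sum_i P i)%R <= n)%N.
Proof. by move=> leP; apply: leq_trans (size_sum _ _ _) _; apply/bigmax_leqP. Qed.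

Section FiniteFieldFunctions.
Variables (p f : nat) (k : finFieldType) (C : fieldType).
Variable iota : {rmorphism k -> C}.
Hypotheses (p_prime : prime p) (card_k : #|k| = (p ^ f)%N) (pC : p \in [pchar C]).
Implicit Types (G : k -> C) (P : {poly C}).

Local Notation q := #|k|.

Lemma card_gt1 : (1 < q)%N.
Proof. exact: finNzRing_gt1. Qed.

Lemma expf_pred_card (x : k) : x ^+ q.-1 = (x != 0)%:R.
Proof.
have q1 := card_gt1; have [->|x0] := eqVneq x 0.
  by rewrite expr0n; case: #|k| q1 => [//|[]].
apply: (mulfI x0); rewrite -exprS prednK ?expf_card ?mulr1 //.
exact: ltnW.
Qed.

(** Lagrange interpolation: by Fermat, [1 - (X - c)^(q-1)] is the indicator of [c] on F_q. *)
Definition interp G : {poly C} :=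
  \sum_c G c *: (1 - ('X - (iota c)%:P) ^+ q.-1).

Lemma interpE G b : (interp G).[iota b] = G b.
Proof.
rewrite /interp horner_sum (bigD1 b) //= big1 ?addr0 => [|c neq_cb].
  rewrite hornerZ hornerD hornerN horner_exp !hornerE subrr -(rmorph0 iota).
  by rewrite -rmorphXn expf_pred_card eqxx rmorph0 subr0 mulr1.
rewrite hornerZ hornerD hornerN horner_exp !hornerE -rmorphB -rmorphXn.
by rewrite expf_pred_card subr_eq0 eq_sym neq_cb rmorph1 subrr mulr0.
Qed.

Lemma size_interp G : (size (interp G) <= q)%N.
Proof.
apply: size_sum_leq => c; apply: leq_trans (size_scale_leq _ _) _.
apply: leq_trans (size_polyD _ _) _; rewrite geq_max size_poly1 ltnW ?card_gt1 //.
rewrite size_polyN -{2}(prednK (ltnW card_gt1)).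
by rewrite size_exp_XsubC leqnn.
Qed.

(** Both sides have degree below q and agree at q points. *)
Lemma interp_horner P : (size P <= q)%N -> interp (fun b => P.[iota b]) = P.
Proof.
move=> leP; apply/eqP; rewrite -subr_eq0; apply/eqP.
apply: (@roots_geq_poly_eq0 _ _ [seq iota b | b <- enum k]).
- by apply/allP=> _ /mapP[b _ ->]; rewrite /root hornerD hornerN interpE subrr.
- by rewrite map_inj_uniq ?enum_uniq //; apply: fmorph_inj.
rewrite size_map -cardE; apply: leq_trans (size_polyD _ _) _.
by rewrite geq_max size_polyN leP size_interp.
Qed.

Lemma interpZD a G G' : interp (fun b => a * G b + G' b) = a *: interp G + interp G'.
Proof.
rewrite /interp scaler_sumr -big_split /=; apply: eq_bigr => c _.
by rewrite scalerDl scalerA.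
Qed.

Lemma interp_sum (I : Type) (s : seq I) (A : pred I) (G : I -> k -> C) :
  interp (fun b => \sum_(i <- s | A i) G i b) = \sum_(i <- s | A i) interp (G i).
Proof.
rewrite /interp exchange_big; apply: eq_bigr => c _; exact: scaler_suml.
Qed.

(** Each [(X - c)^(q-1)] is monic. This turns the vanishing of power sums into a statement on
    degrees. *)
Lemma interp_sumE G : (interp G)`_q.-1 = - \sum_b G b.
Proof.
have q2 : (0 < q.-1)%N by rewrite -ltnS (ltn_predK card_gt1) card_gt1.
rewrite coef_sum -sumrN; apply: eq_bigr => c _.
rewrite coefZ coefB coef1 gtn_eqF // sub0r.
have /monicP : ('X - (iota c)%:P) ^+ q.-1 \is monic by rewrite monic_exp ?monicXsubC.
by rewrite lead_coefE size_exp_XsubC /= => ->; rewrite mulrN1.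
Qed.

Lemma sum_exp_eq0 n : (n < q.-1)%N -> \sum_b iota b ^+ n = 0.
Proof.
move=> ltn; apply/eqP; rewrite -oppr_eq0 -interp_sumE.
have <- : interp (fun b => ('X^n).[iota b]) = interp (fun b => iota b ^+ n).
  by congr interp; apply/funext => b; rewrite hornerXn.
rewrite interp_horner ?coefXn ?gtn_eqF // size_polyXn.
by rewrite (leq_trans ltn) ?leq_pred.
Qed.

Definition digits := {ffun 'I_f -> 'I_p}.
Implicit Types d m : digits.

Definition digit_val d : nat := (\sum_(j < f) d j * p ^ j)%N.
Definition mon d (b : k) : C := iota b ^+ digit_val d.
(* The coefficient at b^(sum_j d_j p^j) of the polynomial of degree < q that
   represents G. *)
Definition coef G d : C := (interp G)`_(digit_val d).

Definition digits0 : digits := [ffun=> Ordinal (prime_gt0 p_prime)].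

Lemma digit_val_lt d : (digit_val d < q)%N.
Proof.
rewrite card_k /digit_val.
pose dn (j : nat) : nat := if insub j is Some j' then d j' else 0%N.
have E (j : 'I_f) : d j = dn j :> nat by rewrite /dn valK.
under eq_bigr do rewrite E; apply: digits_lt => j ltj; rewrite -[j]/(val (Ordinal ltj)) -E.
exact: ltn_ord.
Qed.

Lemma digit_val_inj : injective digit_val.
Proof.
have p0 := prime_gt0 p_prime.
(* Extension by 0 beyond f, so that the digits stay below p at every index, as [digits_inj] asks. *)
pose dn d (j : nat) : nat := if insub j is Some j' then d j' else 0%N.
have E d (j : 'I_f) : d j = dn d j :> nat by rewrite /dn valK.
have lt_dn d j : (dn d j < p)%N by rewrite /dn; case: insub => [j'|].
move=> d d'; rewrite /digit_val; under eq_bigr do rewrite E.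
under [in RHS]eq_bigr do rewrite E.
move/(digits_inj (lt_dn d) (lt_dn d')) => eq_dd'.
by apply/ffunP => j; apply: val_inj; rewrite /= !E eq_dd'.
Qed.

(** Base p expansion is a bijection from [digits] to the exponents below q, being injective between
    sets of cardinality p^f. *)
Lemma coefP G b : G b = \sum_d coef G d * mon d b.
Proof.
rewrite -{1}(interpE G b) (horner_coef_wide _ (size_interp G)).
pose h d := Ordinal (digit_val_lt d).
have hI : injective h by move=> d d' [] /digit_val_inj.
rewrite (reindex h) //; apply/onW_bij/inj_card_bij => //.
by rewrite card_ffun !card_ord card_k.
Qed.

Lemma coef_sum_mon (a : digits -> C) d : coef (fun b => \sum_d a d * mon d b) d = a d.
Proof.
pose P := \sum_d a d *: 'X^(digit_val d).
have -> : (fun b => \sum_d a d * mon d b) = (fun b => P.[iota b]).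
  apply/funext => b; rewrite horner_sum; apply: eq_bigr => d' _.
  by rewrite hornerZ hornerXn.
rewrite /coef interp_horner.
  rewrite coef_sum (bigD1 d) //= big1 ?addr0 => [|d' neq].
    by rewrite coefZ coefXn eqxx mulr1.
  by rewrite coefZ coefXn (inj_eq digit_val_inj) eq_sym (negPf neq) mulr0.
apply: size_sum_leq => d'; apply: leq_trans (size_scale_leq _ _) _.
by rewrite size_polyXn digit_val_lt.
Qed.

Lemma coef_mon d d' : coef (mon d) d' = (d == d')%:R.
Proof.
rewrite -(coef_sum_mon (fun c => (d == c)%:R) d'); congr coef; apply/funext => b.
rewrite (bigD1 d) //= big1 ?addr0 => [|c]; first by rewrite eqxx mul1r.
by rewrite eq_sym => /negPf ->; rewrite mul0r.
Qed.

Lemma coefZD a G G' d : coef (fun b => a * G b + G' b) d = a * coef G d + coef G' d.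
Proof. by rewrite /coef interpZD coefD coefZ. Qed.

Lemma coef_sumf (I : Type) (s : seq I) (A : pred I) (G : I -> k -> C) d :
  coef (fun b => \sum_(i <- s | A i) G i b) d = \sum_(i <- s | A i) coef (G i) d.
Proof. by rewrite /coef interp_sum coef_sum. Qed.

Lemma coef0f d : coef (fun=> 0) d = 0.
Proof.
by rewrite /coef /interp big1 ?coef0 // => c _; rewrite scale0r.
Qed.

Lemma coefZ a G d : coef (fun b => a * G b) d = a * coef G d.
Proof.
rewrite -[RHS]addr0 -(coef0f d) -coefZD; congr coef.
by apply/funext => b; rewrite addr0.
Qed.

Lemma coefD G G' d : coef (fun b => G b + G' b) d = coef G d + coef G' d.
Proof.
rewrite -[coef G d]mul1r -coefZD; congr coef.
by apply/funext => b; rewrite mul1r.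
Qed.

Lemma coefB G G' d : coef (fun b => G b - G' b) d = coef G d - coef G' d.
Proof.
rewrite -mulN1r -coefZ -coefD; congr coef.
by apply/funext => b; rewrite mulN1r.
Qed.

Lemma coef_cst a d : coef (fun=> a) d = a * (d == digits0)%:R.
Proof.
rewrite eq_sym -coef_mon -coefZ; congr coef; apply/funext => b.
rewrite /mon /digit_val big1 ?expr0 ?mulr1 // => j _.
by rewrite ffunE.
Qed.

Lemma monE d b : mon d b = \prod_(j < f) (iota b ^+ (p ^ j)) ^+ d j.
Proof.
rewrite /mon /digit_val expr_sum; apply: eq_bigr => j _.
by rewrite mulnC exprM.
Qed.

Fact dsub_subproof d m j : (d j - m j < p)%N.
Proof. exact: leq_ltn_trans (leq_subr _ _) (ltn_ord _). Qed.
(** The subtraction truncates, but whenever it does the accompanying coefficient [dbin d m] is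
    zero. *)
Definition dsub d m : digits := [ffun j => Ordinal (dsub_subproof d m j)].

Definition dbin d m : C := \prod_(j < f) 'C(d j, m j)%:R.

(** Frobenius is additive, so the binomial theorem applies digit by digit. *)
Lemma mon_add d b c :
  mon d (b + c) = \sum_m dbin d m * mon m b * mon (dsub d m) c.
Proof.
rewrite monE.
have E (j : 'I_f) : (iota (b + c) ^+ (p ^ j)) ^+ d j = \sum_(i < p)
    'C(d j, i)%:R * (iota b ^+ (p ^ j)) ^+ i * (iota c ^+ (p ^ j)) ^+ (d j - i).
  rewrite rmorphD (exprDn_pchar _ _ (n := p ^ j)) ?pnatX ?pnatE ?pC //.
  rewrite addrC exprDn (big_ord_widen p (fun i => (_ ^+ (d j - i) * _ ^+ i) *+ 'C(d j, i))) //.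
  rewrite [RHS](bigID (fun i : 'I_p => (i < (d j).+1)%N)) /=.
  rewrite [X in _ + X]big1 ?addr0 => [|i].
    by apply: eq_bigr => i _; rewrite -mulr_natl -mulrA; congr (_ * _); rewrite mulrC.
  by rewrite -leqNgt => /bin_small ->; rewrite !mul0r.
under eq_bigr do rewrite E.
rewrite bigA_distr_bigA; apply: eq_bigr => m _.
rewrite !monE /dbin -!big_split /=; apply: eq_bigr => j _.
by rewrite ffunE.
Qed.

Lemma coef_transl G c m :
  coef (fun b => G (b + c)) m = \sum_d coef G d * dbin d m * mon (dsub d m) c.
Proof.
rewrite -[RHS](coef_sum_mon (fun m => \sum_d coef G d * dbin d m * mon (dsub d m) c)).
congr coef; apply/funext => b; rewrite (coefP G).
under [RHS]eq_bigr do rewrite big_distrl.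
rewrite exchange_big; apply: eq_bigr => d _; rewrite mon_add big_distrr.
by apply: eq_bigr => m' _ /=; rewrite -!mulrA; congr (_ * (_ * _)); rewrite mulrC.
Qed.

(** A digit is less than p, so p does not divide its factorial, nor a binomial coefficient dividing
    that factorial. *)
Lemma dbin_eq0 d m : dbin d m = 0 <-> exists j, (d j < m j)%N.
Proof.
split=> [/eqP/prodf_eq0[j _ /eqP bin0]|[j ltj]]; last first.
  by rewrite /dbin (bigD1 j) //= bin_small // mul0r.
exists j; rewrite ltnNge; apply/negP => le_md.
have /negP[] : ~~ (p %| 'C(d j, m j))%N; last by rewrite (dvdn_pcharf pC) bin0.
apply/negP => dvd; have : (p %| (d j)`!)%N by rewrite -(bin_fact le_md) dvdn_mulr.
apply/negP; elim: (val _) (ltn_ord (d j)) => [_|n IH ltn].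
  by rewrite dvdn1 neq_ltn prime_gt1 ?orbT.
by rewrite factS Euclid_dvdM // negb_or IH ?(ltnW ltn) // andbT gtnNdvd.
Qed.

Lemma coef_transl_diff G m d : d != digits0 ->
  coef (fun c => coef (fun b => G (b + c)) m - coef G m) d
  = \sum_(d' | dsub d' m == d) coef G d' * dbin d' m.
Proof.
move=> d0; rewrite coefB coef_cst (negPf d0) mulr0 subr0.
rewrite (_ : (fun c => coef (fun b => G (b + c)) m) = (fun c =>
    \sum_d' coef G d' * dbin d' m * mon (dsub d' m) c)); last first.
  by apply/funext => c; rewrite coef_transl.
rewrite coef_sumf [RHS]big_mkcond; apply: eq_bigr => d' _.
by rewrite coefZ coef_mon; case: ifP; rewrite ?mulr1 ?mulr0.
Qed.

(** Among the d' with d' - m = d - m, only d has a nonzero binomial coefficient: where nothing is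
    truncated, d' is recovered from d' - m. *)
Lemma coef_transl_diff_dsub G m d : (forall j, (m j <= d j)%N) -> d != m ->
  coef (fun c => coef (fun b => G (b + c)) m - coef G m) (dsub d m)
  = coef G d * dbin d m.
Proof.
move=> le_md neq_dm; rewrite coef_transl_diff; last first.
  apply: contraNneq neq_dm => /ffunP eq_dm; apply/eqP/ffunP => j; apply: val_inj.
  have := congr1 val (eq_dm j); rewrite !ffunE /= => /eqP; rewrite subn_eq0 => le_dm.
  by apply/eqP; rewrite eqn_leq le_dm le_md.
rewrite (bigD1 d) //= big1 ?addr0 // => d' /andP[/eqP eq_d' neq].
have [->|/eqP/dbin_eq0 dm0] := eqVneq (dbin d' m) 0; first by rewrite mulr0.
case/negP: neq; apply/eqP/ffunP => j; apply: val_inj => /=.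
have le_md' : (m j <= d' j)%N by rewrite leqNgt; apply/negP => lt_d'; apply: dm0; exists j.
have /ffunP/(_ j)/(congr1 val) := eq_d'; rewrite !ffunE /=.
by move/(congr1 (addn^~ (m j))); rewrite !subnK.
Qed.

(** The variation of the coefficient at m under translation by c is a polynomial in c whose
    coefficient at d - m is a nonzero multiple of [coef G d]. This is the tool that kills
    coordinates of invariant elements. *)
Lemma coef_transl_inv G m d : (forall c, coef (fun b => G (b + c)) m = coef G m) ->
  (forall j, (m j <= d j)%N) -> d != m -> coef G d = 0.
Proof.
move=> G_inv le_md neq_dm; have := coef_transl_diff_dsub G le_md neq_dm.
rewrite (_ : (fun c => _) = (fun=> 0)) ?coef0f; last first.
  by apply/funext => c; rewrite G_inv subrr.
move/esym/eqP; rewrite mulf_eq0 => /orP[/eqP //|/eqP/dbin_eq0[j]].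
by rewrite ltnNge le_md.
Qed.

(** No exponent exceeds p - 1 in its digit i, so none can leave a positive digit i once m is
    subtracted. *)
Lemma coef_transl_diff_max G m d i : m i = p.-1 :> nat -> (0 < d i)%N ->
  coef (fun c => coef (fun b => G (b + c)) m - coef G m) d = 0.
Proof.
move=> mi di; rewrite coef_transl_diff; last first.
  by apply: contraTneq di => ->; rewrite ffunE.
rewrite big1 // => d' /eqP eq_d'; move: di; rewrite -eq_d' ffunE /= mi subn_gt0.
by rewrite ltnNge -ltnS prednK ?ltn_ord // prime_gt0.
Qed.

End FiniteFieldFunctions.

(** * Teichmueller expansions *)

Section Integers.
Variables (p e f : nat) (F : padicField p e f).
Local Notation v := (@pf_val p e f F).
Local Notation O := (val_ge v 0).
Local Notation red := (@pf_red p e f F).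
Local Notation teich := (@pf_teich p e f F).
Local Notation varpi := (pf_unif F).
Local Notation k := (pf_residue F).
Implicit Types (x y z b c : F) (m n : nat) (s t : int).

Lemma val_geP s x : reflect (x = 0 \/ s <= v x) (x \in val_ge v s).
Proof.
rewrite unfold_in; apply: (iffP orP) => -[h|h]; [left|right|left|right] => //.
  exact/eqP.
exact/eqP.
Qed.

Lemma val_geW s t x : t <= s -> x \in val_ge v s -> x \in val_ge v t.
Proof.
by move=> le_ts /val_geP[->|le_sx]; apply/val_geP; [left | right; apply: le_trans le_sx].
Qed.

Lemma val_geM s t x y : x \in val_ge v s -> y \in val_ge v t -> x * y \in val_ge v (s + t).
Proof.
have [->|x0] := eqVneq x 0; first by rewrite mul0r => *; apply/val_geP; left.
have [->|y0] := eqVneq y 0; first by rewrite mulr0 => *; apply/val_geP; left.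
rewrite !unfold_in (negPf x0) (negPf y0) mulf_eq0 (negPf x0) (negPf y0) /=.
by rewrite (nval_mul (pf_valP F)) //; apply: lerD.
Qed.

Lemma val_geD s x y : x \in val_ge v s -> y \in val_ge v s -> x + y \in val_ge v s.
Proof.
have [->|x0] := eqVneq x 0; first by rewrite add0r.
have [->|y0] := eqVneq y 0; first by rewrite addr0.
have [->|xy0] := eqVneq (x + y) 0; first by move=> *; apply/val_geP; left.
rewrite !unfold_in (negPf x0) (negPf y0) (negPf xy0) /= => sx sy.
by apply: le_trans (nval_min (pf_valP F) x0 y0 xy0); rewrite le_min sx.
Qed.

Lemma val_geN s x : x \in val_ge v s -> - x \in val_ge v s.
Proof.
by rewrite -mulN1r -{2}(add0r s); apply: val_geM; rewrite rpredN rpred1.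
Qed.

Lemma val_geB s x y : x \in val_ge v s -> y \in val_ge v s -> x - y \in val_ge v s.
Proof. by move=> sx sy; apply: val_geD => //; apply: val_geN. Qed.

Lemma val_ge_unif n : varpi ^+ n \in val_ge v n.
Proof. by apply/val_geP; right; rewrite (pf_valXz F n). Qed.

Lemma unifX_neq0 n : varpi ^+ n != 0.
Proof. by rewrite expf_neq0 // pf_unif_neq0. Qed.

Lemma val_geE n x : reflect (exists2 y, y \in O & x = varpi ^+ n * y) (x \in val_ge v n).
Proof.
apply: (iffP idP) => [nx|[y Oy ->]]; last first.
  by rewrite -[n%:Z]addr0 val_geM // val_ge_unif.
exists (x / varpi ^+ n); last by rewrite mulrC divfK ?unifX_neq0.
rewrite -[0](subrr n%:Z) val_geM //; apply/val_geP; right.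
by rewrite pf_valV ?unifX_neq0 // (pf_valXz F n).
Qed.

Lemma unif_int n : varpi ^+ n \in O.
Proof. exact: val_geW (val_ge_unif n). Qed.

Lemma unifM_int n x : x \in O -> varpi ^+ n * x \in O.
Proof. by move=> Ox; rewrite rpredM ?unif_int. Qed.

Lemma teich_int a : teich a \in O.
Proof. exact: pf_teich_int. Qed.

Lemma redB : {in O &, {morph red : x y / x - y}}.
Proof.
move=> x y Ox Oy; apply/eqP; rewrite eq_sym subr_eq eq_sym.
by rewrite -(redD (pf_redP F)) ?subrK // rpredB.
Qed.

Lemma red0 : red 0 = 0.
Proof. by rewrite -(subrr 1) redB ?rpred1 // subrr. Qed.

Lemma redN : {in O, {morph red : x / - x}}.
Proof. by move=> x Ox; rewrite -[- x]sub0r redB ?rpred0 // red0 sub0r. Qed.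

Lemma redX n : {in O, {morph red : x / x ^+ n}}.
Proof.
move=> x Ox; elim: n => [|n IH]; first by rewrite !expr0 (red1 (pf_redP F)).
by rewrite !exprS (redM (pf_redP F)) ?rpredX // IH.
Qed.

Lemma red_sum (I : Type) (r : seq I) (A : pred I) (X : I -> F) :
  (forall i, A i -> X i \in O) ->
  red (\sum_(i <- r | A i) X i) = \sum_(i <- r | A i) red (X i).
Proof.
move=> OX; suff [] : red (\sum_(i <- r | A i) X i) = \sum_(i <- r | A i) red (X i)
   /\ \sum_(i <- r | A i) X i \in O by [].
elim/big_rec2: _ => [|i y x Ai [<- Ox]]; first by rewrite red0 rpred0.
by rewrite (redD (pf_redP F)) ?rpredD ?OX.
Qed.

Lemma red_nat n : red n%:R = n%:R.
Proof.
elim: n => [|n IH]; first exact: red0.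
by rewrite -!natr1 (redD (pf_redP F)) ?rpred_nat ?rpred1 // IH (red1 (pf_redP F)).
Qed.

Lemma red_val1 x : x \in val_ge v 1 -> red x = 0.
Proof.
by move=> x1; apply/eqP; rewrite (red_eq0 (pf_redP F)) //; apply: val_geW x1.
Qed.

Lemma red_unifM x : x \in O -> red (varpi * x) = 0.
Proof. by move=> Ox; apply: red_val1; apply/(val_geE 1); exists x; rewrite ?expr1. Qed.

Lemma red_neq0_val x : x \in O -> red x != 0 -> x != 0 /\ v x = 0.
Proof.
move=> Ox; rewrite (red_eq0 (pf_redP F)) // => x1.
have x0 : x != 0 by apply: contraNneq x1 => ->; apply/val_geP; left.
split=> //; move: Ox x1; rewrite !unfold_in (negPf x0) /=.
by move: (v x) => s; lia.
Qed.

Lemma intV x : x \in O -> red x != 0 -> x^-1 \in O.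
Proof.
by move=> Ox /(red_neq0_val Ox)[x0 vx]; apply/val_geP; right; rewrite pf_valV // vx.
Qed.

Lemma redV x : x \in O -> red x != 0 -> red x^-1 = (red x)^-1.
Proof.
move=> Ox rx; have [x0 _] := red_neq0_val Ox rx.
apply: (mulfI rx); rewrite divff // -(redM (pf_redP F)) ?intV // divff //.
exact: red1 (pf_redP F).
Qed.

Lemma teich0 : teich 0 = 0.
Proof.
have [//|t0] := eqVneq (teich 0) 0; have /(mulfI t0)/(congr1 red)/eqP :
    teich 0 * teich 0 = teich 0 * teich 1 by rewrite -!pf_teichM mulr1 mulr0.
by rewrite !pf_teichK eq_sym oner_eq0.
Qed.

Lemma teich1 : teich 1 = 1.
Proof.
have t0 : teich 1 != 0.
  by apply: contra_neq (oner_neq0 k) => t1; have := pf_teichK (1 : k); rewrite t1 red0.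
by apply: (mulfI t0); rewrite -pf_teichM !mulr1.
Qed.

Lemma teichX a n : teich (a ^+ n) = teich a ^+ n.
Proof. by elim: n => [|n IH]; rewrite ?(expr0, teich1) // !exprS pf_teichM IH. Qed.

Definition dshift x := (x - teich (red x)) / varpi.
(* The digit of rank n of the Teichmueller expansion of x. *)
Definition dig n x : k := red (iter n dshift x).

Lemma dshift_subproof x : x \in O -> x - teich (red x) \in val_ge v 1.
Proof.
move=> Ox; rewrite -(red_eq0 (pf_redP F)) ?rpredB ?teich_int // redB ?teich_int //.
by rewrite pf_teichK subrr.
Qed.

Lemma dshift_int x : x \in O -> dshift x \in O.
Proof.
move=> /dshift_subproof/(val_geE 1)[y Oy]; rewrite expr1 /dshift => ->.
by rewrite mulrC mulKf ?pf_unif_neq0.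
Qed.

Lemma iter_dshift_int n x : x \in O -> iter n dshift x \in O.
Proof. by move=> Ox; elim: n => //= n; apply: dshift_int. Qed.

Lemma dshiftE x : x = teich (red x) + varpi * dshift x.
Proof. by rewrite mulrC divfK ?pf_unif_neq0 // addrC subrK. Qed.

Lemma dshift_addM n x b : x \in O -> b \in O ->
  dshift (x + varpi ^+ n.+1 * b) = dshift x + varpi ^+ n * b.
Proof.
move=> Ox Ob; rewrite /dshift exprS -mulrA (redD (pf_redP F)) //; last first.
  by rewrite -[varpi]expr1 !unifM_int.
rewrite red_unifM ?unifM_int // addr0 addrAC mulrDl; congr (_ + _).
by rewrite mulrC mulKf ?pf_unif_neq0.
Qed.

Lemma digS n x : dig n.+1 x = dig n (dshift x).
Proof. by rewrite /dig iterSr. Qed.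

Lemma dig_add n x b : x \in O -> b \in O -> dig n (x + varpi ^+ n * b) = dig n x + red b.
Proof.
elim: n x => [|n IH] x Ox Ob; first by rewrite expr0 mul1r /dig /= (redD (pf_redP F)).
by rewrite digS dshift_addM // IH ?dshift_int // -digS.
Qed.

Lemma dig_add_lt m n x b : x \in O -> b \in O -> (m < n)%N ->
  dig m (x + varpi ^+ n * b) = dig m x.
Proof.
elim: m n x => [|m IH] [|n] x Ox Ob //= lt_mn.
  rewrite /dig /= (redD (pf_redP F)) ?unifM_int // exprS -mulrA red_unifM ?addr0 //.
  exact: unifM_int.
by rewrite !digS dshift_addM // IH // dshift_int.
Qed.

(** The first defect of additivity of the Teichmueller lift: up to the factor p / pi, the carry of
    Witt vectors of length 2. *)
Definition carry (a b : k) : k := red ((teich a + teich b - teich (a + b)) / varpi).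

Lemma carry_subproof (a b : k) : (teich a + teich b - teich (a + b)) / varpi \in O.
Proof.
have /dshift_int : teich a + teich b \in O by rewrite rpredD ?teich_int.
by rewrite /dshift (redD (pf_redP F)) ?teich_int // !pf_teichK.
Qed.

Lemma dig1_add x z : x \in O -> z \in O ->
  dig 1 (x + z) = dig 1 x + dig 1 z + carry (red x) (red z).
Proof.
move=> Ox Oz; rewrite !digS /dig /= /carry -!(redD (pf_redP F)) ?carry_subproof //;
  rewrite ?rpredD ?dshift_int //.
by rewrite /dshift (redD (pf_redP F) Ox Oz) -!mulrDl; congr (red (_ / _)); ring.
by rewrite (redD (pf_redP F) Ox Oz) carry_subproof.
Qed.

(** The addition starts at rank n, where nothing is carried in; rank n+1 therefore receives a single
    carry. *)
Lemma dig_addS n x z : x \in O -> z \in O ->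
  dig n.+1 (x + varpi ^+ n * z) = dig n.+1 x + dig 1 z + carry (dig n x) (red z).
Proof.
elim: n x => [|n IH] x Ox Oz; first by rewrite expr0 mul1r dig1_add.
by rewrite digS dshift_addM // IH ?dshift_int // -!digS.
Qed.

Lemma dig_teichM n x a : x \in O -> dig n (x * teich a) = dig n x * a.
Proof.
elim: n x => [|n IH] x Ox.
  by rewrite /dig /= (redM (pf_redP F)) ?teich_int // pf_teichK.
rewrite !digS -IH ?dshift_int // /dshift (redM (pf_redP F)) ?teich_int //.
by rewrite pf_teichK pf_teichM -mulrBl mulrAC.
Qed.

Lemma dig0 n : dig n 0 = 0.
Proof.
elim: n => [|n IH]; first exact: red0.
by rewrite digS /dshift red0 teich0 subrr mul0r.
Qed.

Lemma teich_sum_cons n (a : k) (mu : n.-tuple k) :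
  teich_sum [tuple of a :: mu] = teich a + varpi * teich_sum mu.
Proof.
rewrite /teich_sum big_ord_recl expr0 mul1r; congr (_ + _).
by rewrite big_distrr /=; apply: eq_bigr => i _; rewrite tnthS exprS mulrA.
Qed.

Lemma teich_sum_rcons n (a : k) (mu : n.-tuple k) :
  teich_sum [tuple of rcons mu a] = teich_sum mu + varpi ^+ n * teich a.
Proof.
rewrite /teich_sum big_ord_recr /=; congr (_ + _ * teich _).
  apply: eq_bigr => i _; congr (_ * teich _).
  by rewrite !(tnth_nth 0) /= nth_rcons size_tuple ltn_ord.
by rewrite (tnth_nth 0) /= nth_rcons size_tuple ltnn eqxx.
Qed.

Lemma teich_sum_int n (mu : n.-tuple k) : teich_sum mu \in O.
Proof. by apply: rpred_sum => i _; rewrite unifM_int ?teich_int. Qed.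

Lemma dig_teich_sum n (mu : n.-tuple k) (i : 'I_n) : dig i (teich_sum mu) = tnth mu i.
Proof.
elim: n mu i => [|n IH] mu i; first by case: i.
case/tupleP: mu => a mu; rewrite teich_sum_cons.
have Om := teich_sum_int mu; have Oa := teich_int a.
have ra : red (teich a + varpi * teich_sum mu) = a.
  by rewrite (redD (pf_redP F)) ?red_unifM ?pf_teichK ?addr0 // -[varpi]expr1 unifM_int.
case: (unliftP ord0 i) => [j|] ->; last by rewrite /dig.
rewrite tnthS -IH lift0 digS /dshift ra addrAC subrr add0r mulrC mulKf //.
exact: pf_unif_neq0.
Qed.

Definition digs n x : n.-tuple k := [tuple dig i x | i < n].

Lemma digsK n x : x = teich_sum (digs n x) + varpi ^+ n * iter n dshift x.
Proof.
elim: n => [|n IH]; first by rewrite /teich_sum big_ord0 add0r expr0 mul1r.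
rewrite {1}IH {1}(dshiftE (iter n dshift x)) mulrDr addrA mulrA -exprSr /=.
congr (_ + _); rewrite /teich_sum [RHS]big_ord_recr /=; congr (_ + _ * teich _).
  by apply: eq_bigr => i _; rewrite !tnth_mktuple.
by rewrite tnth_mktuple.
Qed.

Lemma digs_teich_sum n (mu : n.-tuple k) b : b \in O ->
  digs n (teich_sum mu + varpi ^+ n * b) = mu.
Proof.
move=> Ob; apply: eq_from_tnth => i; rewrite tnth_mktuple.
by rewrite dig_add_lt ?teich_sum_int // dig_teich_sum.
Qed.

Lemma digs_teich_sum_eq n (mu : n.-tuple k) x : x - teich_sum mu \in val_ge v n ->
  digs n x = mu.
Proof.
case/val_geE=> b Ob /eqP; rewrite subr_eq addrC => /eqP ->; exact: digs_teich_sum.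
Qed.

Lemma pf_val_prime : v p%:R = e /\ p%:R != 0 :> F.
Proof.
have [p0 vp] := Qp_nat (pf_QpP F) (prime_gt0 (pf_prime F)).
have E : p%:R%:A = p%:R :> F by rewrite -in_algE rmorph_nat.
split; last by rewrite -E scaler_eq0 oner_eq0 orbF.
have -> : e = e * logn p p :> int by rewrite logn_prime ?(pf_prime F) // eqxx mulr1.
by rewrite -E pf_ramification // vp.
Qed.

Lemma prime_val_ge : p%:R \in val_ge v e.
Proof. by apply/val_geP; right; rewrite pf_val_prime.1. Qed.

(** The scalar through which ramification acts on carries: it is nonzero for e = 1 and zero for e >
    1. *)
Definition prime_red : k := red (p%:R / varpi).

Lemma prime_unif_int : (0 < e)%N -> p%:R / varpi \in O.
Proof.
move=> e0; have le1e : 1 <= e%:Z by lia.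
have /(val_geE 1)[y Oy ->] := val_geW le1e prime_val_ge.
by rewrite expr1 mulrC mulKf ?pf_unif_neq0.
Qed.

Lemma prime_red_eq0 : (0 < e)%N -> (prime_red == 0) = (1 < e)%N.
Proof.
move=> e0; have [vp p0] := pf_val_prime.
rewrite (red_eq0 (pf_redP F)) ?prime_unif_int // unfold_in mulf_eq0 (negPf p0) /=.
rewrite invr_eq0 (negPf (pf_unif_neq0 F)) /= (nval_mul (pf_valP F)) ?invr_eq0 ?pf_unif_neq0 //.
by rewrite pf_valV ?pf_unif_neq0 // pf_unif_val vp; lia.
Qed.

Lemma prime_residue : p%:R = 0 :> k.
Proof.
by apply/eqP; rewrite -(dvdn_pcharf (card_finPcharP (pf_inertia F) (pf_prime F))).
Qed.

Lemma exp_prime_pow (a : k) : (0 < f)%N -> (a ^+ (p ^ f.-1)) ^+ p = a.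
Proof.
by move=> f0; rewrite -exprM -expnSr prednK // -(pf_inertia F) expf_card.
Qed.

(* Writing a and b as p-th powers, the p-th powers of the two sides of
   [A] + [B] = [A + B] (mod pi) agree modulo pi^2. *)
Lemma carryE (a b : k) : (0 < e)%N -> (0 < f)%N ->
  carry a b = - prime_red * \sum_(i < p | (0 < i)%N)
    ('C(p, i) %/ p)%:R * (a ^+ (p ^ f.-1)) ^+ (p - i) * (b ^+ (p ^ f.-1)) ^+ i.
Proof.
move=> e0 f0; set A := a ^+ _; set B := b ^+ _.
have p0 := prime_gt0 (pf_prime F).
have OAB : teich A + teich B \in O by rewrite rpredD ?teich_int.
have OT := teich_int.
pose S := \sum_(i < p | (0 < i)%N)
    ('C(p, i) %/ p)%:R * teich A ^+ (p - i) * teich B ^+ i.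
have OS : S \in O by apply: rpred_sum => i _; rewrite !rpredM ?rpredX ?rpred_nat.
have Epow : (teich A + teich B) ^+ p = teich a + teich b + p%:R * S.
  rewrite exprDn big_ord_recr /= subnn expr0 mul1r binn mulr1n -teichX exp_prime_pow //.
  rewrite (bigID (fun i : 'I_p => (0 < i)%N)) /=.
  have -> : \sum_(i < p | ~~ (0 < i)%N) teich A ^+ (p - i) * teich B ^+ i *+ 'C(p, i)
      = teich a.
    rewrite (bigD1 (Ordinal p0)) //= big1 ?addr0.
      by rewrite subn0 expr0 mulr1 bin0 mulr1n -teichX exp_prime_pow.
    by case=> [[|i] lti] //= /andP[].
  suff -> : \sum_(i < p | (0 < i)%N) teich A ^+ (p - i) * teich B ^+ i *+ 'C(p, i)
      = p%:R * S by ring.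
  rewrite big_distrr; apply: eq_bigr => i i0 /=; rewrite -mulr_natl !mulrA -natrM.
  congr (_%:R * _ * _); rewrite mulnC divnK // prime_dvd_bin ?(pf_prime F) //.
  by rewrite i0 ltn_ord.
have [z Oz Ez] : exists2 z, z \in O & teich (a + b) = (teich A + teich B) ^+ p + varpi ^+ 2 * z.
  have EAB : teich (A + B) ^+ p = teich (a + b).
    rewrite -teichX; congr teich; rewrite (_ : _ ^+ p = a + b) //.
    have pk : p \in [pchar k] := card_finPcharP (pf_inertia F) (pf_prime F).
    by rewrite (exprDn_pchar _ _ (n := p)) ?pnatE ?(pf_prime F) // /A /B !exp_prime_pow.
  suff /(val_geE 2)[z Oz E] : teich (A + B) ^+ p - (teich A + teich B) ^+ p \in val_ge v 2.
    by exists z => //; rewrite -EAB -E [RHS]addrC subrK.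
  (* In the factorization of X^p - Y^p both factors lie in (pi): the second is a sum of p terms all
     congruent to [(A + B) ^+ p.-1]. *)
  rewrite subrXX; apply: (@val_geM 1 1).
    rewrite -(red_eq0 (pf_redP F)) ?rpredB // redB // (redD (pf_redP F)) //.
    by rewrite !pf_teichK subrr.
  rewrite -(red_eq0 (pf_redP F)); last first.
    by apply: rpred_sum => i _; rewrite rpredM ?rpredX.
  rewrite red_sum => [|i _]; last by rewrite rpredM ?rpredX.
  rewrite (eq_bigr (fun=> (A + B) ^+ p.-1)) => [|i _]; last first.
    rewrite (redM (pf_redP F)) ?rpredX // !redX // (redD (pf_redP F)) // !pf_teichK.
    by rewrite -exprD; congr (_ ^+ _); have := ltn_ord i; lia.
  by rewrite sumr_const card_ord -mulr_natl prime_residue mul0r.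
rewrite /carry Ez Epow.
have -> : (teich a + teich b - (teich a + teich b + p%:R * S + varpi ^+ 2 * z)) / varpi
    = - ((p%:R / varpi) * S) - varpi * z.
  by field; exact: pf_unif_neq0.
have Oz1 : varpi * z \in O by rewrite -[varpi]expr1 unifM_int.
have OpS : p%:R / varpi * S \in O by rewrite rpredM ?prime_unif_int.
rewrite redB ?rpredN // red_unifM // subr0 redN // (redM (pf_redP F)) ?prime_unif_int //.
rewrite mulNr; congr (- (_ * _)); rewrite red_sum => [|i _]; last first.
  by rewrite !rpredM ?rpredX ?rpred_nat.
apply: eq_bigr => i _; rewrite !(redM (pf_redP F)) ?rpredM ?rpredX ?rpred_nat //.
by rewrite red_nat !redX // !pf_teichK.
Qed.

Lemma carry_eq0 (a b : k) : (1 < e)%N -> (0 < f)%N -> carry a b = 0.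
Proof.
move=> e1 f0; rewrite carryE ?(ltnW e1) //.
have /eqP -> : prime_red == 0 by rewrite prime_red_eq0 // ltnW.
by rewrite oppr0 mul0r.
Qed.

(** The sums of the [a] and of the [a + 1] cancel, being permutations of each other; what remains is
    q = p copies of [1] = 1, divided by pi. *)
Lemma sum_carry1 : f = 1%N -> (0 < e)%N -> \sum_a carry a 1 = prime_red.
Proof.
move=> f1 e0; rewrite -red_sum => [|a _]; last exact: carry_subproof.
rewrite -big_distrl /= sumrB big_split /=.
rewrite (_ : \sum_i teich (i + 1) = \sum_i teich i); last first.
  by rewrite [RHS](reindex_inj (addIr (1 : k))).
rewrite addrAC subrr add0r sumr_const (pf_inertia F) teich1.
have -> : (p ^ f = p)%N by rewrite f1 expn1.
by rewrite -mulr_natl mulr1.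
Qed.

End Integers.

(** * Weights *)

Lemma sym_coef_upper (C : fieldType) n (a b d : C) i m : (i <= n)%N -> (m <= n)%N ->
  sym_coef n a b 0 d i m = 'C(i, m)%:R * a ^+ (n - i) * b ^+ (i - m) * d ^+ m.
Proof.
move=> le_in; rewrite -ltnS => lt_mn.
pose cf' (m : 'I_n.+1) := 'C(i, m)%:R * a ^+ (n - i) * b ^+ (i - m) * d ^+ m.
apply: (sym_coef_uniq (cf := fun m => sym_coef n a b 0 d i m) (cf' := cf') _ (Ordinal lt_mn)).
rewrite -sym_coefE // !rmorph0 mul0r addr0 exprMn exprDn big_distrr /=.
pose t j := ('C(i, j)%:R * a ^+ (n - i) * b ^+ (i - j) * d ^+ j)%:P%:P
  * sym_x C ^+ (n - j) * sym_y C ^+ j.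
transitivity (\sum_(j < i.+1) t j).
  apply: eq_bigr => -[j /= lt_ji] _; rewrite /t -mulr_natl !exprMn.
  have -> : (n - j = (n - i) + (i - j))%N by lia.
  rewrite exprD !polyCM !rmorphXn /= !polyC_natr; ring.
rewrite (big_ord_widen n.+1 t) // [RHS](bigID (fun j : 'I_n.+1 => (j < i.+1)%N)) /=.
rewrite [X in _ + X]big1 ?addr0 // => j; rewrite -leqNgt => lt_ij.
by rewrite /cf' bin_small // !mul0r.
Qed.

Section Weights.
Variables (p e f : nat) (F : padicField p e f).
Variables (C : closedFieldType) (iota : {rmorphism pf_residue F -> C}).
Variables (r : 'I_f -> nat) (w : nat).
Local Notation v := (@pf_val p e f F).
Local Notation O := (val_ge v 0).
Local Notation red := (@pf_red p e f F).
Local Notation varpi := (pf_unif F).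
Local Notation k := (pf_residue F).
Local Notation W := (weight C r).
Local Notation X := (index_x r).
Local Notation Y := (index_y r).
Implicit Types (u : W) (i : multi_index r).

(* The action of (1 b; 0 1) on sigma. *)
Definition uact (b : k) (u : W) : W := [ffun m : multi_index r =>
  \sum_i (u i : C) * \prod_(j < f) ('C(i j, m j)%:R * (iota b ^+ (p ^ j)) ^+ (i j - m j))].

Lemma uact_linear b : linear (uact b).
Proof.
move=> a u u'; apply/ffunP => m; rewrite !ffunE.
rewrite scaler_sumr -big_split; apply: eq_bigr => i _ /=.
rewrite !ffunE; apply: (etrans (mulrDl _ _ _)); congr (_ + _).
exact: esym (mulrA _ _ _).
Qed.
HB.instance Definition _ b := GRing.isLinear.Build C W W _ (uact b) (uact_linear b).

Lemma ord_leq i j : (i j <= r j)%N. Proof. by rewrite -ltnS. Qed.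

Lemma det_red_iwahori g : g \in @iwahori p e f F ->
  red (\det (g : 'M_2)) = red ((g : 'M_2) 0 0) * red ((g : 'M_2) 1 1).
Proof.
case/andP=> /GL2_intP[gO _] g10.
by rewrite det22 redB ?rpredM // !(redM (pf_redP F)) // (red_val1 g10) mulr0 subr0.
Qed.

Lemma sigma_iwahori g u : g \in @iwahori p e f F ->
  sigma iota w g u = [ffun m : multi_index r =>
  iota (red ((g : 'M_2) 0 0) * red ((g : 'M_2) 1 1)) ^+ w * \sum_i (u i : C) * \prod_(j < f)
   ('C(i j, m j)%:R * red_frob iota j ((g : 'M_2) 0 0) ^+ (r j - i j)
    * red_frob iota j ((g : 'M_2) 0 1) ^+ (i j - m j)
    * red_frob iota j ((g : 'M_2) 1 1) ^+ m j)].
Proof.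
move=> Ig; apply/ffunP => m; rewrite !ffunE det_red_iwahori //; congr (_ * _).
apply: eq_bigr => i _; congr (_ * _); apply: eq_bigr => j _.
have -> : red_frob iota j ((g : 'M_2) 1 0) = 0.
  case/andP: Ig => _ g10; rewrite /red_frob (red_val1 g10) rmorph0 expr0n expn_eq0.
  by rewrite eqn0Ngt (prime_gt0 (pf_prime F)).
by rewrite sym_coef_upper ?ord_leq.
Qed.

Lemma g0_00 n x : (gl2_g0 n x : 'M[F]_2) 0 0 = varpi ^+ n. Proof. by rewrite mxE. Qed.
Lemma g0_01 n x : (gl2_g0 n x : 'M[F]_2) 0 1 = x. Proof. by rewrite mxE. Qed.
Lemma g0_10 n x : (gl2_g0 n x : 'M[F]_2) 1 0 = 0. Proof. by rewrite mxE. Qed.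
Lemma g0_11 n x : (gl2_g0 n x : 'M[F]_2) 1 1 = 1. Proof. by rewrite mxE. Qed.
Definition g0E := (g0_00, g0_01, g0_10, g0_11).

Lemma GL2_eq (g h : GL2 F) :
  (forall a b, (g : 'M_2) a b = (h : 'M_2) a b) -> g = h.
Proof. by move=> eq_gh; apply: val_inj; apply/matrixP. Qed.

Lemma ord2P (P : 'I_2 -> 'I_2 -> Prop) : P 0 0 -> P 0 1 -> P 1 0 -> P 1 1 ->
  forall a b, P a b.
Proof.
move=> P00 P01 P10 P11 a b.
have E (m : 'I_2) : m = 0 \/ m = 1.
  by case: m => [[|[|//]] ltm]; [left | right]; apply: val_inj.
by case: (E a) => ->; case: (E b) => ->.
Qed.

Lemma g0M n x m y : (gl2_g0 n x * gl2_g0 m y)%g = gl2_g0 (n + m) (x + varpi ^+ n * y) :> GL2 F.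
Proof.
apply: GL2_eq; apply: ord2P; rewrite GL2_mulE !g0E ?exprD; ring.
Qed.

Lemma u_iwahori b : b \in O -> gl2_g0 0 b \in @iwahori p e f F.
Proof.
move=> Ob; apply/andP; split; last by rewrite g0_10; apply/val_geP; left.
apply/GL2_intP; split; last first.
  by rewrite det22 !g0E expr0 mulr1 mulr0 subr0 pf_val1.
by apply: ord2P; rewrite g0E ?expr0 ?rpred1 ?rpred0.
Qed.

Lemma sigma_u b u : b \in O -> sigma iota w (gl2_g0 0 b) u = uact (red b) u.
Proof.
move=> Ob; rewrite sigma_iwahori ?u_iwahori //; apply/ffunP => m; rewrite !ffunE.
rewrite !g0E expr0 !(red1 (pf_redP F)) mulr1 rmorph1 expr1n mul1r.
apply: eq_bigr => i _; congr (_ * _); apply: eq_bigr => j _.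
by rewrite !red_frob1 !expr1n !mulr1.
Qed.

(* The diagonal coefficient at m of the action on sigma of a matrix which is
   triangular modulo pi. *)
Definition dchar (g : GL2 F) (m : multi_index r) : C :=
  iota (red ((g : 'M_2) 0 0) * red ((g : 'M_2) 1 1)) ^+ w
  * \prod_(j < f) (red_frob iota j ((g : 'M_2) 0 0) ^+ (r j - m j)
                   * red_frob iota j ((g : 'M_2) 1 1) ^+ m j).

Lemma sigma_diag g u m : g \in @iwahori p e f F -> red ((g : 'M_2) 0 1) = 0 ->
  sigma iota w g u m = dchar g m * (u m : C).
Proof.
move=> Ig g01; rewrite sigma_iwahori // ffunE /dchar -mulrA; congr (_ * _).
rewrite (@big_only1 _ _ _ _ m) // => [|i neq _].
  rewrite mulrC; congr (_ * _); apply: eq_bigr => j _.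
  by rewrite binn subnn expr0 mulr1 mul1r.
have /existsP[j neq_j] : [exists j, i j != m j].
  apply: contraR neq => /existsPn eq; apply/eqP/ffunP => j.
  by have /negPn/eqP := eq j.
apply: (etrans (congr1 _ _) (mulr0 _)); apply/eqP/prodf_eq0; exists j => //.
case: (ltngtP (i j) (m j)) => [ltim|ltmi|/val_inj/eqP]; last by rewrite (negPf neq_j).
  by rewrite bin_small // !mul0r.
rewrite {2}/red_frob g01 rmorph0 expr0n expn_eq0 eqn0Ngt (prime_gt0 (pf_prime F)) /=.
by rewrite expr0n subn_eq0 leqNgt ltmi mulr0 mul0r.
Qed.

Lemma uact0 u : uact 0 u = u.
Proof.
rewrite -{1}(red0 F) -sigma_u ?rpred0 //; rewrite -[RHS](sigma1 iota w).
by congr sigma; apply: GL2_eq; apply: ord2P; rewrite g0E mxE ?expr0.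
Qed.

Lemma uactD b c u : uact (b + c) u = uact b (uact c u).
Proof.
rewrite -[in LHS](pf_teichK b) -[in LHS](pf_teichK c) -(redD (pf_redP F)) ?teich_int //.
rewrite -[in RHS](pf_teichK b) -[in RHS](pf_teichK c).
have Ob := teich_int b; have Oc := teich_int c.
rewrite -(sigma_u _ (rpredD Ob Oc)) -(sigma_u u Oc) -(sigma_u _ Ob) -sigmaM.
- by rewrite g0M add0n expr0 mul1r addrC.
- by case/andP: (u_iwahori Ob).
by case/andP: (u_iwahori Oc).
Qed.

Hypothesis r_bounds : forall j, (2 < r j < p - 3)%N.

Lemma r_ltp j : (r j < p)%N.
Proof. by have /andP[_ /leq_trans] := r_bounds j; apply; rewrite leq_subr. Qed.

Definition digits_of (i : multi_index r) : digits p f :=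
  [ffun j => widen_ord (r_ltp j) (i j)].

Lemma digits_of_inj : injective digits_of.
Proof.
move=> i i' /ffunP eq_ii'; apply/ffunP => j; apply: val_inj.
by have /(congr1 val) := eq_ii' j; rewrite !ffunE.
Qed.

Definition in_box (d : digits p f) := [forall j, (d j <= r j)%N].

Lemma in_boxP d : reflect (exists i, d = digits_of i) (in_box d).
Proof.
apply: (iffP forallP) => [le_dr|[i ->] j]; last by rewrite ffunE ord_leq.
exists [ffun j => inord (d j)]; apply/ffunP => j; apply: val_inj.
by rewrite /= !ffunE /= inordK // ltnS.
Qed.

Definition evx u (b : k) : C := uact b u X.

Lemma evxE u b : evx u b = \sum_i (u i : C) * mon iota (digits_of i) b.
Proof.
rewrite /evx ffunE; apply: eq_bigr => i _; rewrite monE; congr (_ * _).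
by apply: eq_bigr => j _; rewrite !ffunE /= bin0 mul1r subn0.
Qed.

Lemma evxD u b c : evx (uact c u) b = evx u (b + c).
Proof. by rewrite /evx uactD. Qed.

Let pp := pf_prime F.
Let cardk : #|k| = (p ^ f)%N := pf_inertia F.
Let pC : p \in [pchar C] := pchar_C iota.
Local Notation coef := (coef iota).

Lemma coef_evx u d : coef (evx u) d = \sum_(i | digits_of i == d) (u i : C).
Proof.
rewrite (_ : evx u = fun b => \sum_i (u i : C) * mon iota (digits_of i) b); last first.
  by apply/funext => b; rewrite evxE.
rewrite coef_sumf [RHS]big_mkcond; apply: eq_bigr => i _.
by rewrite coefZ coef_mon //; case: ifP => _; rewrite ?mulr1 ?mulr0.
Qed.

Lemma coef_evx_digits u i : coef (evx u) (digits_of i) = u i.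
Proof.
by rewrite coef_evx (big_pred1 i) // => i'; rewrite /= (inj_eq digits_of_inj).
Qed.

Lemma coef_evx_out u d : ~~ in_box d -> coef (evx u) d = 0.
Proof.
move=> out; rewrite coef_evx big_pred0 // => i; apply/eqP => di.
by case/negP: out; apply/in_boxP; exists i.
Qed.

Lemma evx_onto (G : k -> C) : (forall d, ~~ in_box d -> coef G d = 0) ->
  exists u, forall b, G b = evx u b.
Proof.
move=> G_box; exists [ffun i => coef G (digits_of i)] => b.
rewrite evxE (coefP iota pp cardk G b) (bigID in_box) /= [X in _ + X]big1 ?addr0.
  pose h := digits_of; rewrite (reindex_onto h (fun d => [ffun j => inord (d j)])) /=.
    apply: eq_big => [i|i _]; last by rewrite ffunE.
    rewrite (introT (in_boxP _)); last by exists i.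
    apply/eqP/ffunP => j; apply: val_inj; rewrite !ffunE /= inordK // ltnS ord_leq //.
  move=> d /forallP le_dr; apply/ffunP => j; apply: val_inj.
  by rewrite /= !ffunE /= inordK // ltnS.
by move=> d /G_box ->; rewrite mul0r.
Qed.

Lemma evx_inj u u' : (forall b, evx u b = evx u' b) -> u = u'.
Proof.
move=> eq_uu'; apply/ffunP => i; rewrite -!coef_evx_digits.
by congr coef; apply/funext.
Qed.

Lemma evx_mon i b : evx (monomial C i) b = mon iota (digits_of i) b.
Proof.
rewrite evxE (bigD1 i) //= big1 ?addr0 => [|i' neq]; first by rewrite ffunE eqxx mul1r.
by rewrite ffunE (negPf neq) mul0r.
Qed.

Lemma index_xyE l j : index_xy r l j = (j == l) :> nat.
Proof.
rewrite ffunE inordK // ltnS; have /andP[/ltnW/ltnW + _] := r_bounds j.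
by apply: leq_trans; case: (j == l).
Qed.

Lemma evx_x b : evx (monomial C X) b = 1.
Proof. by rewrite evx_mon monE big1 // => j _; rewrite !ffunE. Qed.

Lemma evx_xy l b : evx (monomial C (index_xy r l)) b = iota b ^+ (p ^ l).
Proof.
rewrite evx_mon monE (bigD1 l) //= big1 ?mulr1 => [|j neq].
  by rewrite ffunE /= index_xyE eqxx expr1.
by rewrite ffunE /= index_xyE (negPf neq) expr0.
Qed.

Lemma evx_linear b a u u' : evx (a *: u + u') b = a * evx u b + evx u' b.
Proof. by rewrite /evx linearP !ffunE. Qed.

Lemma uact_x b : uact b (monomial C X) = monomial C X.
Proof. by apply: evx_inj => c; rewrite evxD !evx_x. Qed.

Lemma uact_xy b l :
  uact b (monomial C (index_xy r l))
  = monomial C (index_xy r l) + iota b ^+ (p ^ l) *: monomial C X.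
Proof.
apply: evx_inj => c; rewrite evxD evx_xy [in RHS]addrC evx_linear evx_x evx_xy mulr1 rmorphD.
by rewrite [RHS]addrC exprDn_pchar // pnatX (pnatE _ pp) pC.
Qed.

(** The matrix (1 b; 0 1) fixes x and sends y to b x + y, so only y^r contributes to y^r. *)
Lemma uact_ev_y b u : uact b u Y = u Y.
Proof.
rewrite ffunE (@big_only1 _ _ _ _ Y) // => [|i neq _].
  rewrite big1 ?mulr1 // => j _; rewrite !ffunE /= binn subnn expr0 mulr1 //.
have /existsP[j neq_j] : [exists j, i j != Y j].
  apply: contraR neq => /existsPn eq; apply/eqP/ffunP => j.
  by have /negPn/eqP := eq j.
rewrite (bigD1 j) //= bin_small ?mul0r ?mulr0 // ltn_neqAle.
by rewrite -val_eqE in neq_j; rewrite neq_j ffunE ord_leq.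
Qed.

End Weights.

(** * Coordinates on the tree *)

Section Tree.
Variables (p e f : nat) (F : padicField p e f).
Variables (C : closedFieldType) (iota : {rmorphism pf_residue F -> C}).
Variables (r : 'I_f -> nat) (w : nat).
Hypothesis r_bounds : forall j, (2 < r j < p - 3)%N.
Local Notation v := (@pf_val p e f F).
Local Notation O := (val_ge v 0).
Local Notation varpi := (pf_unif F).
Local Notation W := (weight C r).
Local Notation I := (ind iota r w).
Local Notation beta := (gl2_beta F).
Implicit Types (phi psi : I) (g h : GL2 F) (V : F -> W) (x y : F).

Lemma KZ_int g : g \in @GL2_int p e f F -> g \in @KZ p e f F /\ KZ_part g = g.
Proof.
move=> Kg; have E := KZ_part_id 0 Kg; rewrite pf_scalar0 mul1g in E.
by rewrite KZE E.
Qed.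

Lemma pf_scalar_entry s g a b :
  ((pf_scalar F s * g)%g : 'M_2) a b = varpi ^ s * (g : 'M_2) a b.
Proof. by rewrite gl2_mulE pf_scalarE mul_scalar_mx mxE. Qed.

Lemma unifXz_neq0 s : varpi ^ s != 0.
Proof. by rewrite expfz_neq0 // pf_unif_neq0. Qed.

Lemma val_geXz s : varpi ^ s \in val_ge v s.
Proof. by apply/val_geP; right; rewrite pf_valXz. Qed.

(** With the scalar pi^s divided out, the matrix is integral of unit determinant. A converse is
    [KZ_entry]. *)
Lemma KZ_of_entries g s : (forall a b, (g : 'M_2) a b \in val_ge v s) ->
  v (\det (g : 'M_2)) = 2 * s -> g \in @KZ p e f F.
Proof.
move=> sg dg; apply/KZP; exists s, (pf_scalar F (- s) * g)%g; split; last first.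
  by rewrite mulgA -pf_scalarD subrr pf_scalar0 mul1g.
apply/GL2_intP; split=> [a b|]; last by rewrite pf_scalar_det dg; ring.
by rewrite pf_scalar_entry -(addNr s) val_geM // val_geXz.
Qed.

(** On pi^s K the determinant has valuation 2 s and the entries at least s. This inequality is the
    test that tells the cosets apart. *)
Lemma KZ_entry g a b : g \in @KZ p e f F -> (g : 'M_2) a b != 0 ->
  v (\det (g : 'M_2)) <= 2 * v ((g : 'M_2) a b).
Proof.
case/KZP=> s [x [Kx ->]]; case/GL2_intP: Kx => xO dx.
rewrite pf_scalar_entry pf_scalar_det dx mulf_eq0 negb_or => /andP[_ xab0].
rewrite (nval_mul (pf_valP F)) ?unifXz_neq0 // pf_valXz addr0.
have := xO a b; rewrite unfold_in (negPf xab0) /=; lia.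
Qed.

Lemma val_det_g0 n x : v (\det (gl2_g0 n x : 'M[F]_2)) = n.
Proof. by rewrite det22 !g0E mulr1 mulr0 subr0 (pf_valXz F n). Qed.

Lemma val_det_quot g h : v (\det ((g^-1 * h)%g : 'M_2))
  = v (\det (h : 'M_2)) - v (\det (g : 'M_2)).
Proof.
rewrite -{2}(mulVKg g h) (GL2_detM g) (nval_mul (pf_valP F)) ?GL2_det_neq0 //.
by rewrite addrC addKr.
Qed.

Lemma g0_quotE n x h (M := (((gl2_g0 n x)^-1 * h)%g : 'M[F]_2)) :
  (forall b, M 1 b = (h : 'M_2) 1 b) /\
  (forall b, M 0 b = ((h : 'M_2) 0 b - x * (h : 'M_2) 1 b) / varpi ^+ n).
Proof.
have E a b : (h : 'M_2) a b = _ := congr1 (fun g => (g : 'M_2) a b) (esym (mulVKg (gl2_g0 n x) h)).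
have M1 b : M 1 b = (h : 'M_2) 1 b by rewrite [RHS]E (GL2_mulE (gl2_g0 n x)) !g0E mul0r add0r mul1r.
split=> // b; rewrite -M1 [in RHS]E (GL2_mulE (gl2_g0 n x)) !g0E addrK mulrC mulKf //.
exact: unifX_neq0.
Qed.

(** The determinant of the quotient has valuation m - n. [KZ_entry] at the entry 1 gives m <= n, at
    the entry pi^(m-n) it gives n <= m; then the entry (y - x) / pi^n has to be integral. *)
Lemma KZ_g0_g0 n m x y : ((gl2_g0 n x)^-1 * gl2_g0 m y)%g \in @KZ p e f F ->
  n = m /\ y - x \in val_ge v n.
Proof.
set M := (_ * _)%g => KM; have [M1 M0] := g0_quotE n x (gl2_g0 m y).
have dM : v (\det (M : 'M_2)) = m%:Z - n%:Z by rewrite val_det_quot !val_det_g0.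
have M11 : (M : 'M_2) 1 1 = 1 by rewrite M1 g0E.
have M00 : (M : 'M_2) 0 0 = varpi ^+ m / varpi ^+ n by rewrite M0 !g0E mulr0 subr0.
have := KZ_entry (a := 1) (b := 1) KM; rewrite M11 oner_neq0 pf_val1 dM => /(_ isT) le_mn.
have := KZ_entry (a := 0) (b := 0) KM; rewrite M00 mulf_neq0 ?invr_neq0 ?unifX_neq0 //.
rewrite (nval_mul (pf_valP F)) ?invr_neq0 ?unifX_neq0 // pf_valV ?unifX_neq0 //.
rewrite !(pf_valXz F (Posz _)) dM => /(_ isT) le_nm.
have eq_nm : n = m by lia.
split=> //; have M01 : (M : 'M_2) 0 1 = (y - x) / varpi ^+ n by rewrite M0 !g0E mulr1.
have -> : y - x = varpi ^+ n * (M : 'M_2) 0 1 by rewrite M01 mulrC divfK ?unifX_neq0.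
apply/val_geE; exists ((M : 'M_2) 0 1) => //; apply/val_geP.
have [->|M01_0] := eqVneq ((M : 'M_2) 0 1) 0; [by left | right].
by have := KZ_entry KM M01_0; rewrite dM eq_nm; lia.
Qed.

Lemma beta_rows h : (forall b, ((beta * h)%g : 'M_2) 0 b = (h : 'M_2) 1 b) /\
  (forall b, ((beta * h)%g : 'M_2) 1 b = varpi * (h : 'M_2) 0 b).
Proof. by split=> b; rewrite GL2_mulE !mxE /= !(mul0r, mul1r, add0r, addr0). Qed.

Lemma det_beta : \det (beta : 'M_2) = - varpi.
Proof. by rewrite det22 !mxE /= mul0r mul1r sub0r. Qed.

Lemma val_det_beta h : v (\det ((beta * h)%g : 'M_2)) = 1 + v (\det (h : 'M_2)).
Proof.
rewrite GL2_detM (nval_mul (pf_valP F)) ?GL2_det_neq0 // det_beta; congr (_ + _).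
have N1 : -1 != 0 :> F by rewrite oppr_eq0 oner_eq0.
rewrite -mulN1r (nval_mul (pf_valP F)) ?pf_unif_neq0 // pf_unif_val.
have := nval_mul (pf_valP F) N1 N1; rewrite mulrNN mulr1 pf_val1.
by move: (v (-1)) => s; lia.
Qed.

(** The upper right entry is a unit over pi^n while the determinant has valuation 1 + m - n, and 1 +
    m - n <= - 2 n is impossible. *)
Lemma KZ_g0_beta n m x y : x \in O -> y \in O ->
  ((gl2_g0 n x)^-1 * (beta * gl2_g0 m y))%g \notin @KZ p e f F.
Proof.
move=> Ox Oy; apply/negP; set M := (_ * _)%g => KM.
have [_ M0] := g0_quotE n x (beta * gl2_g0 m y)%g; have [b0 b1] := beta_rows (gl2_g0 m y).
have dM : v (\det (M : 'M_2)) = 1 + m%:Z - n%:Z by rewrite val_det_quot val_det_beta !val_det_g0.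
have M01 : (M : 'M_2) 0 1 = (1 - x * (varpi * y)) / varpi ^+ n by rewrite M0 b0 b1 !g0E.
have Oxy : x * y \in O by rewrite rpredM.
have Opxy : varpi * (x * y) \in O by rewrite -[varpi]expr1 unifM_int.
rewrite mulrCA in M01; set z := 1 - _ in M01.
have Oz : z \in O by rewrite rpredB ?rpred1.
have [|u0 vu] := red_neq0_val Oz.
  by rewrite /z (redB (rpred1 _) Opxy) (red_unifM Oxy) subr0 (red1 (pf_redP F)) oner_neq0.
have := KZ_entry (a := 0) (b := 1) KM.
rewrite M01 mulf_neq0 ?invr_neq0 ?unifX_neq0 // => /(_ isT).
rewrite (nval_mul (pf_valP F)) ?invr_neq0 ?unifX_neq0 // pf_valV ?unifX_neq0 //.
by rewrite vu (pf_valXz F n) dM; lia.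
Qed.

(** The case of a pivot of minimal valuation in the bottom row: x is the quotient of the two entries
    of its column, which clears the entry above it, and n is forced by the determinant, v(det h) - n
    = 2 m. *)
Lemma half_tree h b : (h : 'M_2) 1 b != 0 ->
  (forall a c, (h : 'M_2) a c \in val_ge v (v ((h : 'M_2) 1 b))) ->
  exists n x, x \in O /\ ((gl2_g0 n x)^-1 * h)%g \in @KZ p e f F.
Proof.
set m := v _ => h1b min_h; set D := v (\det (h : 'M_2)).
have D2m : 2 * m <= D.
  suff : \det (h : 'M_2) \in val_ge v (m + m).
    by rewrite unfold_in (negPf (GL2_det_neq0 h)) /= -/D; lia.
  by rewrite det22 val_geB // val_geM.
have [n Dn] : exists n : nat, n%:Z = D - 2 * m by exists (absz (D - 2 * m)%R); lia.
pose x := (h : 'M_2) 0 b / (h : 'M_2) 1 b; exists n, x; split.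
  by rewrite -(subrr m) val_geM //; apply/val_geP; right; rewrite pf_valV.
have [M1 M0] := g0_quotE n x h.
apply: (KZ_of_entries (s := m)); last by rewrite val_det_quot val_det_g0 Dn -/D; ring.
have Dq : \det (h : 'M_2) / (h : 'M_2) 1 b / varpi ^+ n \in val_ge v m.
  apply/val_geP; right; rewrite !(nval_mul (pf_valP F)) ?mulf_neq0 ?invr_neq0 ?unifX_neq0 ?GL2_det_neq0 //.
  rewrite !pf_valV ?unifX_neq0 // (pf_valXz F n) Dn -/D -/m; lia.
have M1m c : ((gl2_g0 n x)^-1 * h)%g 1 c \in val_ge v m by rewrite M1.
have {}M0 c : (((gl2_g0 n x)^-1 * h)%g : 'M_2) 0 c = ((h : 'M_2) 0 c * (h : 'M_2) 1 b
    - (h : 'M_2) 0 b * (h : 'M_2) 1 c) / (h : 'M_2) 1 b / varpi ^+ n.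
  rewrite M0 /x; congr (_ / _); rewrite [RHS]mulrBl mulfK //.
  by rewrite mulrAC.
have Em (t : 'I_2) : t = 0 \/ t = 1.
  by case: t => [[|[|//]] ltm]; [left | right]; apply: val_inj.
suff M0m c : ((gl2_g0 n x)^-1 * h)%g 0 c \in val_ge v m by apply: ord2P.
rewrite M0; case: (Em b) (Em c) Dq => -> [] ->; rewrite det22 => Dq.
- by rewrite subrr !mul0r; apply/val_geP; left.
- rewrite (_ : _ - _ = - ((h : 'M_2) 0 0 * (h : 'M_2) 1 1 - (h : 'M_2) 0 1 * (h : 'M_2) 1 0)); last by ring.
  by rewrite !mulNr val_geN.
- by [].
by rewrite subrr !mul0r; apply/val_geP; left.
Qed.

(** If no bottom entry has minimal valuation, those of the bottom row are all strictly larger than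
    the minimum. As [beta] exchanges the rows and multiplies the old top row by pi, [beta * h] has
    its pivot in the bottom row. *)
Lemma tree_cover h : exists n x, x \in O /\
  (((gl2_g0 n x)^-1 * h)%g \in @KZ p e f F \/ ((gl2_g0 n x)^-1 * (beta * h))%g \in @KZ p e f F).
Proof.
pose hh (t : 'I_2 * 'I_2) : F := (h : 'M_2) t.1 t.2.
have [t0 ht0] : exists t, hh t != 0.
  apply: contraPP (GL2_det_neq0 h) => h0; apply/negP; rewrite negbK det22.
  have h00 a b : (h : 'M_2) a b = 0.
    by apply/eqP/negPn/negP => hab; apply: h0; exists (a, b).
  by rewrite !h00 mul0r subrr.
case: (@Order.TotalTheory.arg_minP _ _ _ t0 (fun t => hh t != 0) (fun t => v (hh t)) ht0) => -[a b] hab min_ab.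
rewrite /hh /= in hab min_ab.
have minP c d : (h : 'M_2) c d \in val_ge v (v ((h : 'M_2) a b)).
  have [->|hcd] := eqVneq ((h : 'M_2) c d) 0; first by apply/val_geP; left.
  by apply/val_geP; right; apply: (min_ab (c, d)).
have [[d [h1d minD]]|no_piv] := pselect (exists d, (h : 'M_2) 1 d != 0 /\
    forall a c, (h : 'M_2) a c \in val_ge v (v ((h : 'M_2) 1 d))).
  by have [n [x [Ox KM]]] := half_tree h1d minD; exists n, x; split; [|left].
have a0 : a = 0.
  case: a hab minP {min_ab} => [[|[|//]] lta] hab minP; first exact: val_inj.
  case: no_piv; exists b; rewrite (_ : 1 = Ordinal lta) //; exact: val_inj.
rewrite a0 in hab minP; have [b0 b1] := beta_rows h.
have vb : v (((beta * h)%g : 'M_2) 1 b) = 1 + v ((h : 'M_2) 0 b).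
  by rewrite b1 (nval_mul (pf_valP F)) ?pf_unif_neq0 // pf_unif_val.
have [n [x [Ox KM]]] : exists n x, x \in O /\ ((gl2_g0 n x)^-1 * (beta * h))%g \in @KZ p e f F.
  apply: (half_tree (b := b)); first by rewrite b1 mulf_neq0 ?pf_unif_neq0.
  rewrite vb => c d; case: c => [[|[|//]] ltc].
    rewrite (_ : Ordinal ltc = 0) ?b0; last exact: val_inj.
    have [->|h1d] := eqVneq ((h : 'M_2) 1 d) 0; first by apply/val_geP; left.
    apply/val_geP; right; have := minP 1 d; rewrite unfold_in (negPf h1d) /=.
    rewrite le_eqVlt => /orP[/eqP eq_v|]; last by lia.
    by case: no_piv; exists d; rewrite -eq_v.
  rewrite (_ : Ordinal ltc = 1) ?b1; last exact: val_inj.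
  by apply: val_geM => //; apply/val_geP; right; rewrite pf_unif_val.
by exists n, x; split; [|right].
Qed.

End Tree.

(** * Elements of the induction as families of vectors of sigma *)

Section Coordinates.
Variables (p e f : nat) (F : padicField p e f).
Variables (C : closedFieldType) (iota : {rmorphism pf_residue F -> C}).
Variables (r : 'I_f -> nat) (w : nat).
Hypothesis r_bounds : forall j, (2 < r j < p - 3)%N.
Local Notation v := (@pf_val p e f F).
Local Notation O := (val_ge v 0).
Local Notation red := (@pf_red p e f F).
Local Notation varpi := (pf_unif F).
Local Notation k := (pf_residue F).
Local Notation W := (weight C r).
Local Notation uact := (uact iota).
Local Notation Ind := (ind iota r w).
Local Notation beta := (gl2_beta F).
Local Notation tens := (@tens p e f F C iota r w).
Implicit Types (phi psi : Ind) (g h : GL2 F) (V : F -> W) (x y : F) (u : W) (m n N : nat).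

(* Here x is any integer, not only an element of I_n: translations are then
   substitutions, and the redundancy is the condition [is_level]. *)
Definition co n x (phi : Ind) : W := phi (gl2_g0 n x)^-1%g.
Arguments co : simpl never.

Lemma co_linear n x : linear (co n x). Proof. by []. Qed.
HB.instance Definition _ n x := GRing.isLinear.Build C Ind W _ (co n x) (co_linear n x).
HB.instance Definition _ g :=
  GRing.isLinear.Build C Ind Ind _ (@act p e f F C iota r w g) (act_linear g).

Lemma tens_linear g : linear (tens g).
Proof.
move=> a u u'; apply: val_inj; apply/funext => h /=.
rewrite [RHS](_ : _ = a *: (if (h * g)%g \in KZ (F:=F) then sigma_KZ iota w (h * g)%g u else 0)
  + (if (h * g)%g \in KZ (F:=F) then sigma_KZ iota w (h * g)%g u' else 0)) //.
by case: ifP => _; rewrite ?scaler0 ?addr0 // /sigma_KZ sigma_linear.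
Qed.
HB.instance Definition _ g := GRing.isLinear.Build C W Ind _ (tens g) (tens_linear g).

Definition is_level n V := forall x b, x \in O -> b \in O ->
  V (x + varpi ^+ n * b) = uact (- red b) (V x).

Lemma g0V b : (gl2_g0 0 b)^-1%g = gl2_g0 0 (- b) :> GL2 F.
Proof.
apply: (@mulgI _ (gl2_g0 0 b)); rewrite mulgV g0M add0n expr0 mul1r subrr.
by apply: GL2_eq; apply: ord2P; rewrite g0E mxE ?expr0.
Qed.

Lemma sigma_KZ_u b u : b \in O -> sigma_KZ iota w (gl2_g0 0 b) u = uact (red b) u.
Proof.
move=> Ob; have /andP[/KZ_int[_ E] _] := u_iwahori Ob.
by rewrite /sigma_KZ E sigma_u.
Qed.

Lemma u_KZ b : b \in O -> gl2_g0 0 b \in @KZ p e f F.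
Proof. by move=> /u_iwahori/andP[/KZ_int[]]. Qed.

Lemma co_level n phi : is_level n (fun x => co n x phi).
Proof.
move=> x b _ Ob; rewrite /co (_ : gl2_g0 n (x + _) = gl2_g0 n x * gl2_g0 0 b)%g; last by rewrite g0M addn0.
rewrite invgM g0V.
rewrite (indP phi).1 ?u_KZ ?rpredN // sigma_KZ_u ?rpredN //.
by rewrite redN.
Qed.

Lemma co_tens n x u m y : co m y (tens (gl2_g0 n x) u)
  = if ((gl2_g0 m y)^-1 * gl2_g0 n x)%g \in KZ (F:=F)
    then sigma_KZ iota w ((gl2_g0 m y)^-1 * gl2_g0 n x)%g u else 0.
Proof. by []. Qed.

Lemma co_tens_same n x u : co n x (tens (gl2_g0 n x) u) = u.
Proof. by rewrite /co tensV. Qed.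

Lemma co_tens_neq n x u m y : (m = n -> y - x \notin val_ge v n) ->
  co m y (tens (gl2_g0 n x) u) = 0.
Proof.
move=> neq; rewrite co_tens; case: ifP => // /KZ_g0_g0[eq_mn]; rewrite eq_mn => xy.
by case/negP: (neq eq_mn); rewrite -opprB val_geN.
Qed.

Lemma co_beta_tens n x u m y : x \in O -> y \in O ->
  co m y (act beta (tens (gl2_g0 n x) u)) = 0.
Proof.
move=> Ox Oy; rewrite act_tens /co /=.
by rewrite (negPf (KZ_g0_beta _ _ Oy Ox)).
Qed.

(** [beta] squares to the scalar matrix of the uniformizer, which acts trivially. *)
Lemma act_betaK phi : act beta (act beta phi) = phi.
Proof.
apply: val_inj; apply/funext => h /=; rewrite -mulgA.
have -> : (beta * beta)%g = pf_scalar F 1.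
  apply: GL2_eq => a b; rewrite -[pf_scalar F 1]mulg1 pf_scalar_entry GL2_mulE.
  rewrite expr1z mxE; move: a b; apply: ord2P; rewrite !mxE /= ?mulr1n ?mulr0n; ring.
have K1 : (pf_scalar F 1 * 1)%g \in @KZ p e f F by apply/KZP; exists 1, 1%g; rewrite GL2_int1.
rewrite -pf_scalarC -[pf_scalar F 1]mulg1 (indP phi).1 //.
rewrite /sigma_KZ KZ_part_id ?GL2_int1 //; exact: sigma1.
Qed.

(* The element supported on level n of the first side with coordinates V. *)
Definition level_ind n V : Ind :=
  \sum_(mu : n.-tuple k) tens (gl2_g0 n (teich_sum mu)) (V (teich_sum mu)).

Lemma co_level_ind n V m x : is_level n V -> x \in O ->
  co m x (level_ind n V) = if m == n then V x else 0.
Proof.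
move=> lV Ox; rewrite /level_ind linear_sum /=; case: eqP => [->|neq]; last first.
  by apply: big1 => mu _; apply: co_tens_neq.
rewrite (@big_only1 _ _ _ _ (digs n x)) //= => [|mu neq _]; last first.
  by apply: co_tens_neq => _; apply: contraNN neq => /digs_teich_sum_eq ->.
have [z Oz] : exists2 z, z \in O & x = teich_sum (digs n x) + varpi ^+ n * z.
  by exists (iter n (@dshift _ _ _ F) x); [exact: iter_dshift_int | exact: digsK].
have Oy := teich_sum_int (digs n x); move: (teich_sum _) Oy => y Oy ->.
by rewrite (co_level n (tens (gl2_g0 n y) (V y)) Oy Oz) co_tens_same lV.
Qed.

Lemma co_beta_level_ind n V m x : x \in O -> co m x (act beta (level_ind n V)) = 0.
Proof.
move=> Ox; rewrite /level_ind !linear_sum /=; apply: big1 => mu _.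
by rewrite co_beta_tens ?teich_sum_int.
Qed.

Lemma coords_inj phi : (forall n x, x \in O -> co n x phi = 0) ->
  (forall n x, x \in O -> co n x (act beta phi) = 0) -> phi = 0.
Proof.
move=> phi0 bphi0; apply: val_inj; apply/funext => g; rewrite [RHS](_ : _ = 0) //=.
have [n [x [Ox KM]]] := tree_cover (g^-1)%g.
have main psi t h : co n x psi = 0 -> ((gl2_g0 n x)^-1 * t)%g \in @KZ p e f F ->
    (h * t = 1)%g -> psi h = 0.
  move=> psi0 KM' ht; have -> : h = (((gl2_g0 n x)^-1 * t)^-1 * (gl2_g0 n x)^-1)%g.
    rewrite invgM invgK mulgK; apply: (@mulIg _ t); by rewrite ht mulVg.
  by rewrite (indP psi).1 ?KZV // -/(co n x psi) psi0 sigma_KZ0.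
case: KM => KM; first by apply: main KM _; rewrite ?phi0 ?mulgV.
have := main (act beta phi) _ (g * beta^-1)%g (bphi0 _ _ Ox) KM.
by rewrite /= mulgVK => -> //; rewrite mulgA mulgVK mulgV.
Qed.

(** By [KZ_g0_g0], a coset meets at most one level. *)
Lemma tree_finite g : exists N, forall n x, (N <= n)%N -> x \in O ->
  ((gl2_g0 n x)^-1 * g)%g \notin @KZ p e f F.
Proof.
have [[m [y [Oy Km]]]|no] := pselect (exists m y, y \in O /\ ((gl2_g0 m y)^-1 * g)%g \in @KZ p e f F).
  exists m.+1 => n x lt_mn Ox; apply/negP => Kn.
  have : ((gl2_g0 n x)^-1 * gl2_g0 m y)%g \in @KZ p e f F.
    rewrite -[(_ * gl2_g0 m y)%g](mulgK ((gl2_g0 m y)^-1 * g)%g) mulgA mulgK.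
    by rewrite (KZ_mull _ Kn) KZV.
  by case/KZ_g0_g0 => eq_nm _; rewrite eq_nm ltnn in lt_mn.
by exists 0%N => n x _ Ox; apply/negP => Kn; apply: no; exists n, x.
Qed.

Definition below N phi := forall n x, (N <= n)%N -> x \in O -> co n x phi = 0.

Lemma below_exists phi : exists N, below N phi.
Proof.
have [_ [s phis]] := indP phi.
have [N HN] : exists N, forall n x g0, (N <= n)%N -> x \in O -> g0 \in s ->
    ((gl2_g0 n x)^-1 * g0^-1)%g \notin @KZ p e f F.
  elim: s {phis} => [|g0 s [N HN]]; first by exists 0%N.
  have [N' HN'] := tree_finite (g0^-1)%g; exists (maxn N N') => n x g1.
  rewrite geq_max => /andP[le_N le_N'] Ox; rewrite inE => /orP[/eqP -> | sg1].
    exact: HN'.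
  exact: HN.
exists N => n x le_N Ox; apply/eqP/negPn/negP => /phis[g0 sg0].
by apply/negP; apply: HN.
Qed.

(** It reduces additive statements on [phi], such as [co_T], to elements supported on one level of
    one side. *)
Lemma ind_decomp phi : exists N, phi = \sum_(n < N) level_ind n (fun x => co n x phi)
  + \sum_(n < N) act beta (level_ind n (fun x => co n x (act beta phi))).
Proof.
have [N1 H1] := below_exists phi; have [N2 H2] := below_exists (act beta phi).
exists (maxn N1 N2); apply/eqP; rewrite -subr_eq0; apply/eqP.
have E psi (psi' := act beta psi) N n x : x \in O -> below N psi ->
    co n x psi - (co n x (\sum_(n < N) level_ind n (fun x => co n x psi))
      + co n x (\sum_(n < N) act beta (level_ind n (fun x => co n x psi')))) = 0.
  move=> Ox HN; rewrite !linear_sum /= [X in _ - (_ + X)]big1 => [|i _]; last first.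
    exact: co_beta_level_ind.
  rewrite addr0 (eq_bigr (fun i : 'I_N => if n == i :> nat then co i x psi else 0)) => [|i _];
    last exact: (co_level_ind n (co_level i psi) Ox).
  case: (ltnP n N) => [ltn|leN].
    rewrite (@big_only1 _ _ _ _ (Ordinal ltn)) //= ?eqxx ?subrr // => i neq _.
    by case: eqP => // eq_ni; case/eqP: neq; apply: val_inj.
  rewrite big1 ?subr0 ?HN // => i _; case: eqP => // eq_ni.
  by have := ltn_ord i; rewrite -eq_ni ltnNge leN.
have W1 : below (maxn N1 N2) phi by move=> n x; rewrite geq_max => /andP[/H1 + _]; apply.
have W2 : below (maxn N1 N2) (act beta phi).
  by move=> n x; rewrite geq_max => /andP[_ /H2]; apply.
have B1 N : act beta (\sum_(n < N) level_ind n (fun x => co n x phi))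
    = \sum_(n < N) act beta (level_ind n (fun x => co n x (act beta (act beta phi)))).
  by rewrite linear_sum act_betaK.
have B2 N : act beta (\sum_(n < N) act beta (level_ind n (fun x => co n x (act beta phi))))
    = \sum_(n < N) level_ind n (fun x => co n x (act beta phi)).
  by rewrite linear_sum /=; apply: eq_bigr => i _; rewrite act_betaK.
apply: coords_inj => n x Ox.
  rewrite (linearB (co n x)) (linearD (co n x)).
  exact: (E phi (maxn N1 N2) n x Ox W1).
rewrite (linearB (act beta)) (linearD (act beta)) /= B1 B2 (linearB (co n x)) (linearD (co n x)).
rewrite [X in _ - X]addrC; exact: (E (act beta phi) (maxn N1 N2) n x Ox W2).
Qed.

End Coordinates.
Arguments co : simpl never.

(** * The Hecke operator *)

Section Hecke.
Variables (p e f : nat) (F : padicField p e f).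
Variables (C : closedFieldType) (iota : {rmorphism pf_residue F -> C}).
Variables (r : 'I_f -> nat) (w : nat).
Hypothesis r_bounds : forall j, (2 < r j < p - 3)%N.
Variable T : {linear ind iota r w -> ind iota r w}.
Hypothesis T_hecke : is_hecke T.
Local Notation v := (@pf_val p e f F).
Local Notation O := (val_ge v 0).
Local Notation red := (@pf_red p e f F).
Local Notation teich := (@pf_teich p e f F).
Local Notation varpi := (pf_unif F).
Local Notation k := (pf_residue F).
Local Notation W := (weight C r).
Local Notation mX := (monomial C (index_x r)).
Local Notation mY := (monomial C (index_y r)).
Local Notation evX u := ((u : W) (index_x r) : C).
Local Notation evY u := ((u : W) (index_y r) : C).
Local Notation uact := (uact iota).
Local Notation Ind := (ind iota r w).
Local Notation beta := (gl2_beta F).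
Local Notation tens := (@tens p e f F C iota r w).
Local Notation co := (@co p e f F C iota r w).
Local Notation level_ind := (@level_ind p e f F C iota r w).
Local Notation is_level := (@is_level p e f F C iota r).
Implicit Types (phi psi : Ind) (g h : GL2 F) (V : F -> W) (x y : F) (u : W) (m n N : nat).

Definition up V x : W := evX (V x) *: mX.
Definition down n V x : W := \sum_l evY (V (x + varpi ^+ n * teich l)) *: uact l mY.

Lemma evY_mY : evY mY = 1. Proof. by rewrite ffunE eqxx. Qed.

Lemma level_period n V x b : is_level n V -> x \in O -> b \in O -> red b = 0 ->
  V (x + varpi ^+ n * b) = V x.
Proof. by move=> lV Ox Ob rb; rewrite lV // rb oppr0 uact0. Qed.

Lemma level_periodS n V x b : is_level n V -> x \in O -> b \in O -> V (x + varpi ^+ n.+1 * b) = V x.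
Proof.
move=> lV Ox Ob; rewrite exprSr -mulrA level_period ?red_unifM //.
by rewrite -[varpi]expr1 unifM_int.
Qed.

Lemma up_level n V : is_level n V -> is_level n.+1 (up V).
Proof.
by move=> lV x b Ox Ob; rewrite /up level_periodS // linearZ /= uact_x.
Qed.

Lemma down_level n V : is_level n.+1 V -> is_level n (down n V).
Proof.
(* Adding pi^n b moves the digit of rank n by [red b], whence the reindexing. The discrepancy is in
   (pi^(n+1)), where the level condition acts by a unipotent and leaves the y^r coordinate alone. *)
move=> lV x b Ox Ob; rewrite /down linear_sum /= (reindex_inj (addrI (- red b))) /=.
apply: eq_bigr => l _.
transitivity (evY (V (x + varpi ^+ n * teich l)) *: uact (- red b) (uact l mY)); last first.
  by rewrite linearZ.
have [z Oz Ez] : exists2 z, z \in O & b + teich (- red b + l) = teich l + varpi * z.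
  suff /(val_geE 1)[z Oz E] : b + teich (- red b + l) - teich l \in val_ge v 1.
    by exists z => //; rewrite -[varpi]expr1 -E [RHS]addrC subrK.
  have Oblt : b + teich (- red b + l) \in O by rewrite rpredD ?teich_int.
  rewrite -(red_eq0 (pf_redP F)) ?rpredB ?teich_int // redB ?teich_int //.
  by rewrite (redD (pf_redP F)) ?teich_int // !pf_teichK addNKr subrr.
have -> : x + varpi ^+ n * b + varpi ^+ n * teich (- red b + l)
    = x + varpi ^+ n * teich l + varpi ^+ n.+1 * z.
  by rewrite -addrA -mulrDr Ez mulrDr mulrA -exprSr addrA.
by rewrite lV ?rpredD ?unifM_int ?teich_int // uact_ev_y uactD.
Qed.

Fact swap_subproof : 0 * 0 - 1 * 1 != 0 :> F.
Proof. by rewrite mul0r mul1r sub0r oppr_eq0 oner_eq0. Qed.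
Definition swap : GL2 F := gl22 swap_subproof.

Definition sgn : C := (-1) ^+ w.

Lemma swap_det : \det (swap : 'M_2) = -1.
Proof. by rewrite det22 !mxE /= mul0r mul1r sub0r. Qed.

Lemma swap_int : swap \in @GL2_int p e f F.
Proof.
apply/GL2_intP; split.
  by apply: ord2P; rewrite mxE /= ?rpred0 ?rpred1.
rewrite swap_det; have N1 : -1 != 0 :> F by rewrite oppr_eq0 oner_eq0.
have := nval_mul (pf_valP F) N1 N1; rewrite mulrNN mulr1 pf_val1.
by move: (v (-1)) => s; lia.
Qed.

Lemma sym_coef_swap (n m : nat) : (m <= n)%N -> sym_coef n 0 1 1 0 n m = (m == 0%N)%:R :> C.
Proof.
move=> le_mn; rewrite /sym_coef subnn expr0 mul1r !rmorph1 !rmorph0 mul1r mul0r addr0.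
rewrite -rmorphXn coefC; case: eqP => [->|]; last by rewrite coef0.
by rewrite subn0 coefXn eqxx.
Qed.

Lemma sigma_swap_y : sigma iota w swap mY = sgn *: mX.
Proof.
apply/ffunP => m; rewrite /sigma !ffunE swap_det redN ?rpred1 // (red1 (pf_redP F)).
rewrite rmorphN rmorph1 -/sgn; apply: (congr1 ( *%R sgn)).
rewrite (@big_only1 _ _ _ _ (index_y r)) //= => [|i neq _]; last first.
  by rewrite ffunE (negPf neq) mul0r.
rewrite ffunE eqxx mul1r (eq_bigr (fun j => (m j == 0%N :> nat)%:R)) => [|j _]; last first.
  by rewrite !mxE /= red_frob0 red_frob1 ffunE /= sym_coef_swap ?ord_leq.
have [->|neq] := eqVneq m (index_x r); first by rewrite big1 // => j _; rewrite ffunE.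
have /existsP[j neq_j] : [exists j, m j != index_x r j].
  apply: contraR neq => /existsPn eq; apply/eqP/ffunP => j.
  by have /negPn/eqP := eq j.
apply/eqP/prodf_eq0; exists j => //; rewrite -val_eqE ffunE /= in neq_j.
by rewrite (negPf neq_j).
Qed.

(** [gl2_alpha] is [beta] times the matrix exchanging x and y, of determinant -1: up to (-1)^w, the
    element alpha (x) y^r is the root vector of the second side. *)
Lemma tens_alpha_y : tens (gl2_alpha F) mY = act beta (tens 1%g (sgn *: mX)).
Proof.
have -> : gl2_alpha F = (beta * swap)%g.
  by apply: GL2_eq; apply: ord2P; rewrite GL2_mulE !mxE /=; ring.
have [Ks Es] := KZ_int swap_int.
by rewrite act_tens mulg1 tens_KZ // /sigma_KZ Es sigma_swap_y.
Qed.

Lemma T_tens g u : T (tens g u) =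
  \sum_l tens (g * gl2_g0 1 (teich l))%g (evx iota u (- l) *: mX)
  + tens (g * gl2_alpha F)%g (evY u *: mY).
Proof.
have [TG T1] := T_hecke.
rewrite (_ : tens g u = act g (tens 1%g u)); last by rewrite act_tens mulg1.
rewrite TG T1 linearD linear_sum /= act_tens; congr (_ + _).
apply: eq_bigr => l _; rewrite act_tens; congr (tens _ (_ *: _)).
rewrite (evxE iota r_bounds); apply: eq_bigr => i _; congr (_ * _).
rewrite /mon rmorphN; congr (_ ^+ _).
by apply: eq_bigr => j _; rewrite ffunE.
Qed.

(** Hence the alpha term of T, taken at level n+1, lands on level n: the origin of [down]. *)
Lemma g0_alpha n x : (gl2_g0 n.+1 x * gl2_alpha F = gl2_g0 n x * pf_scalar F 1)%g.
Proof.
rewrite -pf_scalarC; apply: GL2_eq => a b; rewrite pf_scalar_entry GL2_mulE.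
by move: a b; apply: ord2P; rewrite !g0E !mxE /= expr1z ?exprS; ring.
Qed.

Lemma tens_scalar g s u : tens (g * pf_scalar F s)%g u = tens g u.
Proof.
have E : (pf_scalar F s * 1)%g = pf_scalar F s by rewrite mulg1.
rewrite tens_KZ; last by apply/KZP; exists s, 1%g; rewrite GL2_int1 E.
by rewrite /sigma_KZ -E KZ_part_id ?GL2_int1 // sigma1.
Qed.

Lemma tuple_sum_rcons (V : zmodType) n (G : n.+1.-tuple k -> V) :
  \sum_mu G mu = \sum_(mu : n.-tuple k) \sum_l G [tuple of rcons mu l].
Proof.
rewrite pair_bigA /=.
pose h (t : n.-tuple k * k) : n.+1.-tuple k := [tuple of rcons t.1 t.2].
rewrite (reindex h) //; apply/onW_bij/inj_card_bij; last first.
  by rewrite card_prod !card_tuple expnS mulnC.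
move=> [mu l] [mu' l'] /(congr1 val)/= /rcons_inj[eq_mu ->].
by congr (_, _); apply: val_inj.
Qed.

(** The argument [- l] coming from T agrees with the sign in [is_level]: what reaches the child of
    digit l is the x^r coordinate of [V] there. *)
Lemma T_level_up n V : is_level n V ->
  \sum_(mu : n.-tuple k) \sum_l tens (gl2_g0 n (teich_sum mu) * gl2_g0 1 (teich l))%g
     (evx iota (V (teich_sum mu)) (- l) *: mX) = level_ind n.+1 (up V).
Proof.
move=> lV; rewrite /level_ind tuple_sum_rcons; apply: eq_bigr => mu _.
apply: eq_bigr => l _; rewrite g0M addn1 teich_sum_rcons; congr (tens _ (_ *: _)).
by rewrite lV ?teich_int ?teich_sum_int // pf_teichK.
Qed.

Lemma T_levelS n V : is_level n.+1 V ->
  T (level_ind n.+1 V) = level_ind n.+2 (up V) + level_ind n (down n V).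
Proof.
move=> lV; rewrite {1}/level_ind linear_sum /=.
under eq_bigr do rewrite T_tens.
rewrite big_split /= T_level_up //; congr (_ + _).
rewrite tuple_sum_rcons; apply: eq_bigr => mu _; rewrite /down linear_sum /=.
apply: eq_bigr => l _; rewrite g0_alpha tens_scalar teich_sum_rcons.
have -> : gl2_g0 n (teich_sum mu + varpi ^+ n * teich l)
    = (gl2_g0 n (teich_sum mu) * gl2_g0 0 (teich l))%g by rewrite g0M addn0.
by rewrite tens_KZ ?u_KZ ?teich_int // sigma_KZ_u ?teich_int // pf_teichK linearZ.
Qed.

Lemma teich_sum0 (mu : 0.-tuple k) : teich_sum mu = 0.
Proof. by rewrite /teich_sum big_ord0. Qed.

Lemma g0_1 : gl2_g0 0 0 = 1%g :> GL2 F.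
Proof. by apply: GL2_eq; apply: ord2P; rewrite g0E mxE ?expr0. Qed.

Lemma level_ind0 V : level_ind 0 V = tens 1%g (V 0).
Proof.
rewrite /level_ind (@big_only1 _ _ _ _ [tuple]) //= => [|mu]; last by rewrite tuple0.
by rewrite teich_sum0 g0_1.
Qed.

(** At the root there is no level below, and the alpha term crosses to the root of the second
    side. *)
Lemma T_level0 V : is_level 0 V ->
  T (level_ind 0 V) = level_ind 1 (up V) + act beta (level_ind 0 (fun=> (sgn * evY (V 0)) *: mX)).
Proof.
move=> lV; rewrite {1}/level_ind linear_sum /=.
under eq_bigr do rewrite T_tens.
rewrite big_split /= T_level_up //; congr (_ + _).
rewrite (@big_only1 _ _ _ _ [tuple]) //= => [|mu]; last by rewrite tuple0.
rewrite teich_sum0 level_ind0 g0_1.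
by rewrite mul1g linearZ /= tens_alpha_y -!linearZ /= scalerA mulrC.
Qed.

(** Stated as a predicate of [phi] closed under sums, so that [ind_decomp] proves it level by
    level. *)
Definition co_T_at n x phi := co n x (T phi) = (if n is m.+1 then up (fun x => co m x phi) x
    else (sgn * evY (co 0 0 (act beta phi))) *: mX) + down n (fun x => co n.+1 x phi) x.

Lemma co_T_atD n x phi psi : co_T_at n x phi -> co_T_at n x psi -> co_T_at n x (phi + psi).
Proof.
rewrite /co_T_at !linearD /= => -> ->.
rewrite addrACA; congr (_ + _).
  case: n => [|n]; last by rewrite /up linearD ffunE scalerDl.
  by rewrite ffunE mulrDr scalerDl.
rewrite /down -big_split; apply: eq_bigr => l _ /=.
by rewrite linearD ffunE scalerDl.
Qed.

Lemma down0 n x : down n (fun=> 0) x = 0.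
Proof. by rewrite /down big1 // => l _; rewrite ffunE scale0r. Qed.

Lemma co_T_at_level n x m V : is_level m V -> x \in O -> co_T_at n x (level_ind m V).
Proof.
move=> lV Ox; rewrite /co_T_at.
have Ol l s : x + varpi ^+ s * teich l \in O by rewrite rpredD ?unifM_int ?teich_int.
have O0 : 0 \in O := rpred0 _.
have Ed : down n (fun x => co n.+1 x (level_ind m V)) x = if n.+1 == m then down n V x else 0.
  rewrite /down; under eq_bigr do rewrite (co_level_ind w n.+1 lV (Ol _ _)).
  by case: eqP => // _; rewrite big1 // => l _; rewrite ffunE scale0r.
rewrite Ed; case: m lV {Ed} => [|m] lV.
  rewrite T_level0 // linearD /= co_beta_level_ind // addr0 addr0.
  rewrite (co_level_ind w n (up_level lV) Ox); case: n Ol => [|n] _ /=.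
    by rewrite co_beta_level_ind // ffunE mulr0 scale0r.
  by rewrite eqSS /up (co_level_ind w n lV Ox); case: eqP => // _; rewrite ffunE scale0r.
rewrite T_levelS // linearD /= (co_level_ind w n (up_level lV) Ox).
rewrite (co_level_ind w n (down_level lV) Ox) eqSS.
have -> : (if n == m then down m V x else 0) = (if n == m then down n V x else 0).
  by case: eqP => // ->.
congr (_ + _); case: n Ol => [|n] _ /=.
  by rewrite co_beta_level_ind // ffunE mulr0 scale0r.
by rewrite eqSS /up (co_level_ind w n lV Ox); case: eqP => // _; rewrite ffunE scale0r.
Qed.

Lemma T_act g phi : T (act g phi) = act g (T phi).
Proof. by case: T_hecke => ->. Qed.

Lemma co_T_at_beta_level n x m V : is_level m V -> x \in O ->
  co_T_at n x (act beta (level_ind m V)).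
Proof.
move=> lV Ox; rewrite /co_T_at.
have Ol l s : x + varpi ^+ s * teich l \in O by rewrite rpredD ?unifM_int ?teich_int.
have O0 : 0 \in O := rpred0 _.
have -> : down n (fun x => co n.+1 x (act beta (level_ind m V))) x = 0.
  by rewrite /down big1 // => l _; rewrite co_beta_level_ind // ffunE scale0r.
rewrite addr0 T_act; case: m lV => [|m] lV.
  rewrite T_level0 // linearD /= act_betaK linearD /= co_beta_level_ind // add0r.
  rewrite co_level_ind; last 2 first.
  - by move=> y b _ _; rewrite linearZ /= uact_x.
  - by [].
  case: n Ol => [|n] _ /=.
    by rewrite act_betaK (co_level_ind w 0 lV O0).
  by rewrite /up co_beta_level_ind // ffunE scale0r.
rewrite T_levelS // linearD /= linearD /= !co_beta_level_ind // addr0.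
case: n Ol => [|n] _ /=; last by rewrite /up co_beta_level_ind // ffunE scale0r.
by rewrite act_betaK (co_level_ind w 0 lV O0) /= ffunE mulr0 scale0r.
Qed.

Lemma co_T n x phi : x \in O -> co_T_at n x phi.
Proof.
move=> Ox; have [N ->] := ind_decomp phi.
have T0 : co_T_at n x 0.
  have E0 m : (fun x => co m x 0) = fun=> 0 by apply/funext => y; rewrite linear0.
  rewrite /co_T_at !linear0 E0 down0 addr0; case: n => [|n].
    by rewrite ffunE mulr0 scale0r.
  by rewrite /up ffunE scale0r.
apply: co_T_atD; apply: (big_ind (co_T_at n x)) => // [psi psi'|i _];
  try exact: co_T_atD.
  exact/co_T_at_level/Ox/co_level.
exact/co_T_at_beta_level/Ox/co_level.
Qed.

End Hecke.

(** * The action of the Iwahori subgroup *)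

Lemma moebius_diff (K : fieldType) (a b c d x y : K) :
  c * x + d != 0 -> c * (x + y) + d != 0 ->
  (a * (x + y) + b) / (c * (x + y) + d)
  = (a * x + b) / (c * x + d) + y * (a * d - b * c) / ((c * x + d) * (c * (x + y) + d)).
Proof. by move=> D0 D0'; field; rewrite D0 D0'. Qed.

(* Second order expansion of 1 / (D (D + u c v t)) at t = 0. *)
Lemma moebius_expand (K : fieldType) (D c d t u vn : K) :
  D != 0 -> D + u * c * (vn * t) != 0 ->
  t * d / (D * (D + u * c * (vn * t)))
  = d * D^-1 ^+ 2 * t + u * (- (c * vn * d * D^-1 ^+ 3) * t ^+ 2
      + u * (t ^+ 3 * d * c ^+ 2 * vn ^+ 2 * D^-1 ^+ 3 * (D + u * c * (vn * t))^-1)).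
Proof. by move=> D0 D0'; field; rewrite D0 D0'. Qed.

Section Moebius.
Variables (p e f : nat) (F : padicField p e f).
Variables (C : closedFieldType) (iota : {rmorphism pf_residue F -> C}).
Variables (r : 'I_f -> nat) (w : nat).
Local Notation v := (@pf_val p e f F).
Local Notation O := (val_ge v 0).
Local Notation red := (@pf_red p e f F).
Local Notation teich := (@pf_teich p e f F).
Local Notation varpi := (pf_unif F).
Local Notation k := (pf_residue F).
Local Notation W := (weight C r).
Local Notation Ind := (ind iota r w).
Local Notation beta := (gl2_beta F).
Local Notation co := (@co p e f F C iota r w).
Implicit Types (phi psi : Ind) (g h m : GL2 F) (V : F -> W) (x y : F) (u : W) (n N : nat).

(* The Iwahori subgroup acts on each level of the first side of the tree by
   homographies of x. *)
Definition mob m x : F :=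
  ((m : 'M_2) 0 0 * x + (m : 'M_2) 0 1) / ((m : 'M_2) 1 0 * x + (m : 'M_2) 1 1).
Definition ratio m : k := red ((m : 'M_2) 0 0) / red ((m : 'M_2) 1 1).

Lemma iwahori_diag m : m \in @iwahori p e f F ->
  red ((m : 'M_2) 0 0) != 0 /\ red ((m : 'M_2) 1 1) != 0.
Proof.
move=> Im; have := det_red_iwahori Im; case/andP: Im => /GL2_intP[mO dm] m10 E.
apply/andP; rewrite -negb_or -mulf_eq0 -E (red_eq0 (pf_redP F)) ?GL2_int_det //.
  by rewrite unfold_in (negPf (GL2_det_neq0 m)) /= dm.
exact/GL2_intP.
Qed.

Lemma iwahori_int m a b : m \in @iwahori p e f F -> (m : 'M_2) a b \in O.
Proof. by case/andP=> /GL2_intP[mO _] _. Qed.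

Lemma mob_denom m x : m \in @iwahori p e f F -> x \in O ->
  [/\ (m : 'M_2) 1 0 * x + (m : 'M_2) 1 1 \in O,
      (m : 'M_2) 1 0 * x + (m : 'M_2) 1 1 != 0 &
      red ((m : 'M_2) 1 0 * x + (m : 'M_2) 1 1) = red ((m : 'M_2) 1 1)].
Proof.
move=> Im Ox; have mO := iwahori_int _ _ Im; have [_ m11] := iwahori_diag Im.
have OD : (m : 'M_2) 1 0 * x + (m : 'M_2) 1 1 \in O by rewrite rpredD ?rpredM.
have rD : red ((m : 'M_2) 1 0 * x + (m : 'M_2) 1 1) = red ((m : 'M_2) 1 1).
  have /andP[_ m10] := Im; rewrite (redD (pf_redP F)) ?rpredM //.
  by rewrite (redM (pf_redP F)) // (red_val1 m10) mul0r add0r.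
by split=> //; have [] := red_neq0_val OD; rewrite ?rD.
Qed.

Lemma mob_int m x : m \in @iwahori p e f F -> x \in O -> mob m x \in O.
Proof.
move=> Im Ox; have mO := iwahori_int _ _ Im; have [OD D0 rD] := mob_denom Im Ox.
by rewrite rpredM ?rpredD ?rpredM // intV // rD; have [] := iwahori_diag Im.
Qed.

Lemma mob_diff m x y : m \in @iwahori p e f F -> x \in O -> y \in O ->
  mob m (x + y) = mob m x + y * \det (m : 'M_2)
    / (((m : 'M_2) 1 0 * x + (m : 'M_2) 1 1) * ((m : 'M_2) 1 0 * (x + y) + (m : 'M_2) 1 1)).
Proof.
move=> Im Ox Oy; have [_ Dx _] := mob_denom Im Ox.
have [_ Dxy _] := mob_denom Im (rpredD Ox Oy).
by rewrite /mob det22 moebius_diff.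
Qed.

(** The derivative of the homography is det m / (c x + d)^2, which reduces to [ratio m] since c is
    in (pi). *)
Lemma mob_lin m n x b : m \in @iwahori p e f F -> x \in O -> b \in O ->
  exists2 c, c \in O & mob m (x + varpi ^+ n * b) = mob m x + varpi ^+ n * c
    /\ red c = ratio m * red b.
Proof.
move=> Im Ox Ob; have Onb : varpi ^+ n * b \in O by rewrite unifM_int.
have [OD D0 rD] := mob_denom Im Ox.
have [OD' D0' rD'] := mob_denom Im (rpredD Ox Onb).
have [m00 m11] := iwahori_diag Im.
have Odet : \det (m : 'M_2) \in O by case/andP: Im => /GL2_int_det.
have rDD : red (((m : 'M_2) 1 0 * x + (m : 'M_2) 1 1)
    * ((m : 'M_2) 1 0 * (x + varpi ^+ n * b) + (m : 'M_2) 1 1)) = red ((m : 'M_2) 1 1) ^+ 2.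
  by rewrite (redM (pf_redP F)) // rD rD' expr2.
exists (b * \det (m : 'M_2) / (((m : 'M_2) 1 0 * x + (m : 'M_2) 1 1)
    * ((m : 'M_2) 1 0 * (x + varpi ^+ n * b) + (m : 'M_2) 1 1))).
  by rewrite rpredM ?rpredM // intV ?rpredM // rDD expf_neq0.
split; first by rewrite mob_diff // !mulrA.
rewrite (redM (pf_redP F)) ?rpredM ?intV ?rpredM ?rDD ?expf_neq0 //.
rewrite redV ?rpredM ?rDD ?expf_neq0 // (redM (pf_redP F)) // det_red_iwahori //.
suff gen (K : fieldType) (a c d : K) : d != 0 -> c * (a * d) / d ^+ 2 = a / d * c by exact: gen.
by move=> d0; field.
Qed.

Lemma dig_mob m n x b : m \in @iwahori p e f F -> x \in O -> b \in O ->
  dig n (mob m (x + varpi ^+ n * b)) = dig n (mob m x) + ratio m * red b.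
Proof.
move=> Im Ox Ob; have [c Oc [-> rc]] := mob_lin n Im Ox Ob.
by rewrite dig_add ?mob_int // rc.
Qed.

(** Each further order of the expansion brings a factor of the lower left entry, hence of pi; one
    rank beyond n, only the linear and quadratic terms are visible. *)
Lemma mob_quad m n x : m \in @iwahori p e f F -> x \in O ->
  exists s t, [/\ s \in O, t \in O & forall l, exists2 z, z \in O &
    mob m (x + varpi ^+ n * teich l) = mob m x
      + varpi ^+ n * (s * teich l + varpi ^+ 1 * (t * teich l ^+ 2 + varpi * z))].
Proof.
move=> Im Ox; have [OD D0 rD] := mob_denom Im Ox.
have [m00 m11] := iwahori_diag Im.
have Odet : \det (m : 'M_2) \in O by case/andP: Im => /GL2_int_det.
have [c Oc Ec] : exists2 c, c \in O & (m : 'M_2) 1 0 = varpi * c.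
  by case/andP: Im => _ /(val_geE 1)[c Oc ->]; exists c.
have mOb := mob_diff Im Ox; have den := mob_denom Im; have m11O := iwahori_int 1 1 Im.
rewrite Ec in OD D0 rD mOb den.
set D := varpi * c * x + (m : 'M_2) 1 1 in OD D0 rD mOb.
have OV : D^-1 \in O by rewrite intV // rD.
set d := \det _ in mOb Odet.
exists (d / D ^+ 2), (- (c * varpi ^+ n * d / D ^+ 3)).
have Ov j : varpi ^+ j \in O := unif_int F j.
split; rewrite ?rpredN ?rpredM // -?exprVn ?rpredX //.
move=> l; have Ot := teich_int l; have Ont : varpi ^+ n * teich l \in O by rewrite rpredM.
have [OD' D0' rD'] := den _ (rpredD Ox Ont).
set D' := varpi * c * _ + _ in OD' D0' rD'.
have OV' : D'^-1 \in O by rewrite intV // rD'.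
exists (teich l ^+ 3 * d * c ^+ 2 * (varpi ^+ n) ^+ 2 * D^-1 ^+ 3 * D'^-1).
  by do ?apply: rpredM => //; rewrite ?rpredX.
rewrite mOb // -/D'; have ED' : D' = D + varpi * c * (varpi ^+ n * teich l).
  by rewrite /D' /D; ring.
congr (_ + _); rewrite expr1 ED' in D0' *.
by rewrite -(moebius_expand d D0 D0') !mulrA.
Qed.

(** For e > 1 no carry disturbs the two terms of [mob_quad]. *)
Lemma dig_mobS m n x : (1 < e)%N -> (0 < f)%N -> m \in @iwahori p e f F -> x \in O ->
  exists a b c, forall l, dig n.+1 (mob m (x + varpi ^+ n * teich l)) = a + b * l + c * l ^+ 2.
Proof.
move=> e1 f0 Im Ox; have [s [t [Os Ot H]]] := mob_quad n Im Ox.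
exists (dig n.+1 (mob m x)), (dig 1 s), (red t) => l; have [z Oz ->] := H l.
have Ol := teich_int l.
have Oz' : varpi * z \in O by rewrite -[varpi]expr1 unifM_int.
have Oq : t * teich l ^+ 2 + varpi * z \in O by rewrite rpredD // rpredM ?rpredX.
have Osq : s * teich l + varpi ^+ 1 * (t * teich l ^+ 2 + varpi * z) \in O.
  by rewrite rpredD ?unifM_int // rpredM.
rewrite dig_addS // ?mob_int // carry_eq0 // addr0 -addrA.
congr (_ + _); rewrite (dig_add 1 (rpredM Os Ol) Oq) (dig_teichM 1 l Os); congr (_ + _).
have Ol2 : teich l ^+ 2 \in O by rewrite rpredX.
rewrite (redD (pf_redP F) (rpredM Ot Ol2) Oz') (red_unifM Oz) addr0.
by rewrite (redM (pf_redP F) Ot Ol2) (redX 2 Ol) pf_teichK.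
Qed.

Lemma dchar_neq0 m (i : multi_index r) : m \in @iwahori p e f F -> dchar iota w m i != 0.
Proof.
move=> Im; have [m00 m11] := iwahori_diag Im.
have Z x j : red x != 0 -> red_frob iota j x != 0.
  by move=> rx; rewrite expf_neq0 // fmorph_eq0.
rewrite mulf_neq0 ?expf_neq0 ?fmorph_eq0 ?mulf_neq0 //.
by apply/prodf_neq0 => j _; rewrite mulf_neq0 // expf_neq0 // Z.
Qed.

Lemma ind_int g h phi : g \in @GL2_int p e f F -> phi (g * h)%g = sigma iota w g (phi h).
Proof.
by move=> Kg; have [KZg E] := KZ_int Kg; rewrite ((indP phi).1 g h KZg) /sigma_KZ E.
Qed.

(** [m * gl2_g0 n x] is [gl2_g0 n (mob m x)] times an Iwahori matrix with zero upper right entry,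
    which acts diagonally with the scalars of [m]. The inverse of [m] appears because coordinates
    are values at inverses. *)
Lemma co_act m n x phi i : m \in @iwahori p e f F -> x \in O ->
  dchar iota w m i * (co n x (act (m^-1)%g phi) i : C) = co n (mob m x) phi i.
Proof.
move=> Im Ox; set y := mob m x; have Oy : y \in O := mob_int Im Ox.
have mO := iwahori_int _ _ Im; have [OD D0 rD] := mob_denom Im Ox.
pose K := ((gl2_g0 n y)^-1 * (m * gl2_g0 n x))%g.
have [K1 K0] := g0_quotE n y (m * gl2_g0 n x)%g; rewrite -/K in K1 K0.
have [/andP[/GL2_intP[_ dm] m10] v0] : m \in @iwahori p e f F /\ varpi ^+ n != 0.
  by rewrite unifX_neq0.
have K10 : (K : 'M_2) 1 0 = (m : 'M_2) 1 0 * varpi ^+ n.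
  by rewrite K1 GL2_mulE !g0E mulr0 addr0.
have K11 : (K : 'M_2) 1 1 = (m : 'M_2) 1 0 * x + (m : 'M_2) 1 1.
  by rewrite K1 GL2_mulE !g0E mulr1.
have K00 : (K : 'M_2) 0 0 = (m : 'M_2) 0 0 - y * (m : 'M_2) 1 0.
  by rewrite K0 !GL2_mulE !g0E !mulr0 !addr0 mulrA -mulrBl mulfK.
have K01 : (K : 'M_2) 0 1 = 0.
  by rewrite K0 !GL2_mulE !g0E !mulr1 /y /mob divfK // subrr mul0r.
have IK : K \in @iwahori p e f F.
  apply/andP; split; last by rewrite K10 mulrC (@val_geM _ _ _ F 0 1) ?unif_int.
  apply/GL2_intP; split.
    apply: ord2P; rewrite ?K00 ?K01 ?K10 ?K11 ?rpred0 //.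
      by rewrite rpredB // rpredM.
    by rewrite rpredM ?unif_int.
  rewrite val_det_quot GL2_detM (nval_mul (pf_valP F)) ?GL2_det_neq0 // !val_det_g0 dm.
  by rewrite add0r subrr.
have dK : dchar iota w K i = dchar iota w m i.
  have r00 : red ((K : 'M_2) 0 0) = red ((m : 'M_2) 0 0).
    rewrite K00 (redB (mO 0 0) (rpredM Oy (mO 1 0))) (redM (pf_redP F) Oy (mO 1 0)).
    by rewrite (red_val1 m10) mulr0 subr0.
  by rewrite /dchar /red_frob r00 K11 rD.
have Kint : K \in @GL2_int p e f F by case/andP: IK.
have EK : (m * gl2_g0 n x = gl2_g0 n y * K)%g by rewrite /K mulVKg.
clearbody K.
have K01' : red ((K : 'M_2) 0 1) = 0 by rewrite K01 red0.
rewrite -dK -(@sigma_diag _ _ _ F C iota r w K (co n x (act (m^-1)%g phi)) i IK K01').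
suff -> : sigma iota w K (co n x (act (m^-1)%g phi)) = co n y phi by [].
rewrite -[LHS](ind_int _ phi Kint) /co /=; congr (phi _).
by rewrite -invgM EK invgM mulgA mulgV mul1g.
Qed.

Lemma beta_conj_iwahori m : m \in @iwahori p e f F -> exists m',
  [/\ m' \in @iwahori p e f F, (m * beta = beta * m')%g,
      (m' : 'M_2) 0 0 = (m : 'M_2) 1 1, (m' : 'M_2) 1 1 = (m : 'M_2) 0 0
    & varpi * (m' : 'M_2) 0 1 = (m : 'M_2) 1 0].
Proof.
move=> Im; pose m' := (beta^-1 * (m * beta))%g.
have E : (m * beta = beta * m')%g by rewrite /m' mulVKg.
have [R0 R1] := beta_rows m'; rewrite -E in R0 R1.
have v0 := pf_unif_neq0 F.
have m'10 : (m' : 'M_2) 1 0 = (m : 'M_2) 0 1 * varpi.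
  by rewrite -R0 GL2_mulE !mxE /= mulr0 add0r.
have m'11 : (m' : 'M_2) 1 1 = (m : 'M_2) 0 0.
  by rewrite -R0 GL2_mulE !mxE /= mulr1 mulr0 addr0.
have m'00 : (m' : 'M_2) 0 0 = (m : 'M_2) 1 1.
  by apply: (mulfI v0); rewrite -R1 GL2_mulE !mxE /= mulr0 add0r mulrC.
have m'01 : varpi * (m' : 'M_2) 0 1 = (m : 'M_2) 1 0.
  by rewrite -R1 GL2_mulE !mxE /= mulr1 mulr0 addr0.
exists m'; split=> //; have mO := iwahori_int _ _ Im.
have /andP[/GL2_intP[_ dm] m10] := Im.
apply/andP; split; last first.
  by rewrite m'10; apply: (@val_geM _ _ _ F 0 1) => //; apply: (val_ge_unif F 1).
apply/GL2_intP; split.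
  have O01 : (m' : 'M_2) 0 1 \in O.
    by have /(val_geE 1)[z Oz] := m10; rewrite -m'01 expr1 => /(mulfI v0) ->.
  apply: ord2P; rewrite ?m'10 ?m'11 ?m'00 ?rpredM //.
  by rewrite -[varpi]expr1 unif_int.
rewrite det22 m'10 m'11 m'00 (_ : _ - _ = \det (m : 'M_2)) ?dm // det22 -m'01; ring.
Qed.

End Moebius.

(** * Functions on a level that lie in the image of T *)

Section Lift.
Variables (p e f : nat) (F : padicField p e f).
Variables (C : closedFieldType) (iota : {rmorphism pf_residue F -> C}).
Variables (r : 'I_f -> nat) (w : nat).
Hypothesis r_bounds : forall j, (2 < r j < p - 3)%N.
Variable T : {linear ind iota r w -> ind iota r w}.
Hypothesis T_hecke : is_hecke T.
Local Notation v := (@pf_val p e f F).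
Local Notation O := (val_ge v 0).
Local Notation red := (@pf_red p e f F).
Local Notation teich := (@pf_teich p e f F).
Local Notation varpi := (pf_unif F).
Local Notation k := (pf_residue F).
Local Notation W := (weight C r).
Local Notation mX := (monomial C (index_x r)).
Local Notation mY := (monomial C (index_y r)).
Local Notation mXY l := (monomial C (index_xy r l)).
Local Notation evX u := ((u : W) (index_x r) : C).
Local Notation evY u := ((u : W) (index_y r) : C).
Local Notation uact := (uact iota).
Local Notation Ind := (ind iota r w).
Local Notation beta := (gl2_beta F).
Local Notation co := (@co p e f F C iota r w).
Local Notation level_ind := (@level_ind p e f F C iota r w).
Local Notation is_level := (@is_level p e f F C iota r).
Local Notation coef := (@coef p f k C iota).
Local Notation in_box := (@in_box p f r).
Local Notation digits_of := (@digits_of p f r r_bounds).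
Implicit Types (phi psi : Ind) (g h : GL2 F) (V : F -> W) (x y : F) (u : W) (m n N : nat).
Implicit Types (G : F -> C) (d : digits p f).

Let pp := pf_prime F.
Let cardk : #|k| = (p ^ f)%N := pf_inertia F.
Let pC : p \in [pchar C] := pchar_C iota.

Definition single (l : 'I_f) (i : 'I_p) : digits p f :=
  [ffun j => if j == l then i else Ordinal (prime_gt0 pp)].

Lemma mon_single l i b : mon iota (single l i) b = (iota b ^+ (p ^ l)) ^+ i.
Proof.
rewrite monE (@big_only1 _ _ _ _ l) //= ?ffunE ?eqxx // => j neq _.
by rewrite ffunE (negPf neq).
Qed.

Lemma single_eq l i l' i' : single l i = single l' i' -> (0 < i)%N -> l = l' /\ i = i'.
Proof.
move=> /ffunP E i0; have := E l; rewrite !ffunE eqxx.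
by case: eqP => [-> -> //|_ i00]; rewrite i00 in i0.
Qed.

Lemma in_box_single l i : in_box (single l i) = (i <= r l)%N.
Proof.
apply/forallP/idP => [/(_ l)|le_i j]; rewrite ffunE ?eqxx //.
by case: eqP => [->|].
Qed.

Lemma coef_single (l : 'I_f) (c : nat -> C) d :
  coef (fun b => \sum_(i < p) c i * (iota b ^+ (p ^ l)) ^+ i) d
  = \sum_(i < p) c i * (single l i == d)%:R.
Proof.
rewrite coef_sumf; apply: eq_bigr => i _; rewrite coefZ -(coef_mon iota pp cardk).
by congr (_ * coef _ _); apply/funext => b; rewrite mon_single.
Qed.

Lemma coef_binom (l : 'I_f) n (a c : C) d : (n < p)%N ->
  coef (fun b => (a + c * iota b ^+ (p ^ l)) ^+ n) d
  = \sum_(i < p) ('C(n, i)%:R * a ^+ (n - i) * c ^+ i) * (single l i == d)%:R.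
Proof.
move=> ltn; rewrite -(coef_single l (fun i => 'C(n, i)%:R * a ^+ (n - i) * c ^+ i)).
congr coef; apply/funext => b; rewrite exprDn.
rewrite (big_ord_widen p (fun i => (a ^+ (n - i) * (c * iota b ^+ (p ^ l)) ^+ i) *+ 'C(n, i))) //.
rewrite [RHS](bigID (fun i : 'I_p => (i < n.+1)%N)) /= [X in _ + X]big1 ?addr0 => [|i].
  by apply: eq_bigr => i _; rewrite exprMn -mulr_natl !mulrA.
by rewrite -leqNgt => /bin_small ->; rewrite !mul0r.
Qed.

Lemma frobD (j : nat) (a b : C) : (a + b) ^+ (p ^ j) = a ^+ (p ^ j) + b ^+ (p ^ j).
Proof. by rewrite exprDn_pchar // pnatX (pnatE _ pp) pC. Qed.

Lemma frobN (j : nat) (a : C) : (- a) ^+ (p ^ j) = - a ^+ (p ^ j).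
Proof.
apply/eqP; rewrite -addr_eq0 -frobD addNr expr0n expn_eq0.
by rewrite eqn0Ngt (prime_gt0 pp).
Qed.

Fact one_lt_subproof : (1 < p)%N. Proof. exact: prime_gt1. Qed.
Definition one_p : 'I_p := Ordinal one_lt_subproof.

Lemma digits_ofXY l : digits_of (index_xy r l) = single l one_p.
Proof.
apply/ffunP => j; apply: val_inj; rewrite ffunE /= (index_xyE r_bounds) ffunE.
by case: eqP.
Qed.

(** All digits of the exponent of y^r are positive. So for f > 1 a function with exponents having a
    single nonzero digit never meets y^r. *)
Lemma digits_ofY_single l i : single l i = digits_of (index_y r) ->
  (i = r l :> nat) /\ (forall j, j = l).
Proof.
move=> /ffunP E; split=> [|j].
  by have := congr1 val (E l); rewrite !ffunE eqxx /= => ->.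
have := congr1 val (E j); rewrite !ffunE /=; case: eqP => //= _ r0.
by have := r_bounds j; rewrite -r0.
Qed.

(** The sign makes [tr] of the x^r coordinates equal to [evx] of the vector at x, see [evx_tr]. *)
Definition tr G n x : k -> C := fun l => G (x + varpi ^+ n * teich (- l)).

Lemma evx_tr n V x : is_level n V -> x \in O -> evx iota (V x) = tr (fun x => evX (V x)) n x.
Proof.
move=> lV Ox; apply/funext => l; rewrite /tr lV ?teich_int // pf_teichK opprK.
by [].
Qed.

(** At each x a vector is chosen by [evx_onto]; injectivity of [evx] makes the choices
    compatible. *)
Lemma level_lift n G : (forall x b, x \in O -> b \in O -> G (x + varpi ^+ n.+1 * b) = G x) ->
  (forall x d, x \in O -> ~~ in_box d -> coef (tr G n x) d = 0) ->
  exists V, [/\ is_level n V, (forall x, x \in O -> evX (V x) = G x)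
    & forall x, x \in O -> evx iota (V x) = tr G n x].
Proof.
move=> Gper Gbox.
have /choice[V HV] : forall x, exists u, x \in O -> evx iota u = tr G n x.
  move=> x; have [Ox|_] := boolP (x \in O); last by exists 0.
  have [u Hu] := evx_onto r_bounds (fun d => Gbox x d Ox).
  by exists u => _; apply/funext => l; rewrite Hu.
have E x : x \in O -> evX (V x) = G x.
  move=> Ox; rewrite -[V x](uact0 iota w) -[LHS]/(evx iota (V x) 0) HV // /tr oppr0.
  by rewrite teich0 mulr0 addr0.
exists V; split=> // x b Ox Ob; apply: (evx_inj (iota := iota) r_bounds) => l.
rewrite (evxD iota w) !HV ?rpredD ?unifM_int // /tr.
have Oz : b + teich (- l) \in O by rewrite rpredD ?teich_int.
suff [z Oz' Ez] : exists2 z, z \in O &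
    b + teich (- l) = teich (- (l - red b)) + varpi * z.
  rewrite -addrA -mulrDr Ez mulrDr addrA [varpi ^+ n * (_ * _)]mulrA -exprSr Gper //.
  by rewrite rpredD ?unifM_int ?teich_int.
suff /(val_geE 1)[z Oz' Ez] : b + teich (- l) - teich (- (l - red b)) \in val_ge v 1.
  by exists z => //; rewrite -[varpi]expr1 -Ez [RHS]addrC subrK.
rewrite -(red_eq0 (pf_redP F)) ?rpredB ?teich_int // (redB Oz) ?teich_int //.
by rewrite (redD (pf_redP F)) ?teich_int // !pf_teichK opprB subrr.
Qed.

Definition at_level n phi V :=
  [/\ forall x, x \in O -> co n x phi = V x,
      forall m x, m != n -> x \in O -> co m x phi = 0
    & forall m x, x \in O -> co m x (act beta phi) = 0].

Lemma at_level_ind n V : is_level n V -> at_level n (level_ind n V) V.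
Proof.
move=> lV; split=> [x Ox|m x neq Ox|m x Ox].
- by rewrite co_level_ind // eqxx.
- by rewrite co_level_ind // (negPf neq).
exact: co_beta_level_ind.
Qed.

Lemma at_level_eq n phi psi V V' : at_level n phi V -> at_level n psi V' ->
  (forall x, x \in O -> V x = V' x) -> phi = psi.
Proof.
move=> [P1 P2 P3] [Q1 Q2 Q3] EV; apply/eqP; rewrite -subr_eq0; apply/eqP.
apply: coords_inj => m x Ox; rewrite !linearB /=; last by rewrite P3 // Q3 // subrr.
have [->|neq] := eqVneq m n; first by rewrite P1 // Q1 // EV // subrr.
by rewrite P2 // Q2 // subrr.
Qed.

Lemma at_levelZD n a phi psi V V' : at_level n phi V -> at_level n psi V' ->
  at_level n (a *: phi + psi) (fun x => a *: V x + V' x).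
Proof.
move=> [P1 P2 P3] [Q1 Q2 Q3]; split=> [x Ox|m x neq Ox|m x Ox]; rewrite !linearP /=.
- by rewrite P1 ?Q1.
- by rewrite P2 ?Q2 // scaler0 addr0.
by rewrite P3 ?Q3 // scaler0 addr0.
Qed.

(* Here the other component of T, going down the tree, vanishes. *)
Lemma absorb n phi G V : at_level n.+1 phi (fun x => G x *: mX) ->
  is_level n V -> (forall x, x \in O -> evX (V x) = G x) ->
  (n = 0%N -> evY (V 0) = 0) ->
  (forall n', n = n'.+1 -> forall x, x \in O -> down iota n' V x = 0) ->
  phi = T (level_ind n V).
Proof.
move=> aphi lV EV V0 VS.
have upV := at_level_ind (up_level r_bounds lV).
have E : phi = level_ind n.+1 (up V).
  by apply: (at_level_eq aphi upV) => x Ox; rewrite /up EV.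
case: n => [|n] in aphi lV EV V0 VS upV E *.
  rewrite (T_level0 r_bounds T_hecke lV) -E level_ind0 V0 // mulr0 scale0r linear0.
  by rewrite linear0 addr0.
rewrite (T_levelS r_bounds T_hecke lV) -E [X in _ + X](_ : _ = 0) ?addr0 //.
rewrite /level_ind big1 // => mu _; rewrite (VS n) ?teich_sum_int //; exact: linear0.
Qed.

Lemma at_level_per n phi G x b : at_level n phi (fun x => G x *: mX) -> x \in O -> b \in O ->
  G (x + varpi ^+ n * b) = G x.
Proof.
move=> [P _ _] Ox Ob; have Oxb : x + varpi ^+ n * b \in O by rewrite rpredD ?unifM_int.
have := P _ Oxb; rewrite (co_level n phi Ox Ob) P // linearZ /= (uact_x iota w r_bounds).
by move/ffunP/(_ (index_x r)); rewrite !ffunE eqxx => E; rewrite -[LHS]mulr1 -[RHS]mulr1 -[LHS]E.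
Qed.

(** [absorb] with both obstructions read off the coefficients of [tr G n x]: exponents outside the
    box, and, at the exponent of y^r, the part of T that goes down or crosses the root. *)
Lemma absorb_lift n phi G : at_level n.+1 phi (fun x => G x *: mX) ->
  (forall x d, x \in O -> ~~ in_box d -> coef (tr G n x) d = 0) ->
  (n = 0%N -> coef (tr G n 0) (digits_of (index_y r)) = 0) ->
  (forall n', n = n'.+1 -> forall x, x \in O ->
    \sum_l coef (tr G n (x + varpi ^+ n' * teich l)) (digits_of (index_y r)) *: uact l mY = 0) ->
  exists psi, phi = T psi.
Proof.
move=> aphi Gbox G0 GS.
have [V [lV EV trV]] := level_lift (fun x b => at_level_per aphi) Gbox.
have EY x : x \in O -> evY (V x) = coef (tr G n x) (digits_of (index_y r)).
  by move=> Ox; rewrite -trV // (coef_evx_digits iota r_bounds).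
exists (level_ind n V); apply: (absorb aphi lV EV) => [n0|n' En x Ox].
  by rewrite EY ?rpred0 ?G0.
rewrite -[RHS](GS n' En x Ox); apply: eq_bigr => l _.
by rewrite EY // rpredD ?unifM_int ?teich_int.
Qed.

Lemma dig_teich_sum_out n (mu : n.-tuple k) : dig n (teich_sum mu) = 0.
Proof.
elim: n mu => [|n IH] mu; first by rewrite teich_sum0 dig0.
case/tupleP: mu => a mu; rewrite teich_sum_cons digS -[RHS](IH mu); congr dig.
have Om := teich_sum_int mu; have Ovm : varpi * teich_sum mu \in O.
  by rewrite -[varpi]expr1 unifM_int.
rewrite /dshift (redD (pf_redP F) (teich_int a) Ovm) pf_teichK red_unifM //.
rewrite addr0 addrAC subrr add0r mulrC mulKf //; exact: pf_unif_neq0.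
Qed.

(** Ranks start at 0: the last digit of an element of I_(n+1) has rank n. *)
Lemma at_level_s n j : at_level n.+1 (elt_s iota r w n.+1 j) (fun x => iota (dig n x) ^+ j *: mX).
Proof.
pose V x : W := iota (dig n x) ^+ j *: mX.
have lV : is_level n.+1 V.
  by move=> x b Ox Ob; rewrite /V dig_add_lt // linearZ /= (uact_x iota w r_bounds).
suff -> : elt_s iota r w n.+1 j = level_ind n.+1 V by apply: at_level_ind.
rewrite /elt_s /level_ind; apply: eq_bigr => mu _; rewrite /V -[n in dig n]/(val (@ord_max n)).
rewrite dig_teich_sum (tnth_nth 0) /= -nth_last size_tuple.
by rewrite (set_nth_default 0) ?size_tuple.
Qed.

(** The x^r term vanishes on the representatives in I_n, whose digit of rank n is 0; it comes from
    extending the coordinates to all integers x. *)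
Lemma at_level_t n l : at_level n (elt_t iota r w n l)
  (fun x => - iota (dig n x) ^+ (p ^ l) *: mX + mXY l).
Proof.
pose V x := uact (- dig n x) (mXY l).
have lV : is_level n V.
  move=> x b Ox Ob; rewrite /V dig_add // opprD addrC uactD //.
have EV x : V x = - iota (dig n x) ^+ (p ^ l) *: mX + mXY l.
  by rewrite /V (uact_xy iota w r_bounds) addrC rmorphN frobN.
have -> : elt_t iota r w n l = level_ind n V.
  rewrite /elt_t /level_ind; apply: eq_bigr => mu _.
  by rewrite /V dig_teich_sum_out oppr0 uact0.
rewrite (_ : (fun x => _) = V); first exact: at_level_ind.
by apply/funext => x; rewrite EV.
Qed.

Lemma at_level_base : at_level 0 (tens iota w 1%g mX : Ind) (fun=> mX).
Proof.
rewrite -(level_ind0 iota w (fun=> mX)); apply: at_level_ind => x b _ _.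
by rewrite (uact_x iota w r_bounds).
Qed.

End Lift.

(** * Eigenvectors of the Iwahori subgroup modulo the image of T *)

Section Equivariance.
Variables (p e f : nat) (F : padicField p e f).
Variables (C : closedFieldType) (iota : {rmorphism pf_residue F -> C}).
Variables (r : 'I_f -> nat) (w : nat).
Hypothesis r_bounds : forall j, (2 < r j < p - 3)%N.
Variable T : {linear ind iota r w -> ind iota r w}.
Hypothesis T_hecke : is_hecke T.
Local Notation v := (@pf_val p e f F).
Local Notation O := (val_ge v 0).
Local Notation red := (@pf_red p e f F).
Local Notation teich := (@pf_teich p e f F).
Local Notation varpi := (pf_unif F).
Local Notation k := (pf_residue F).
Local Notation W := (weight C r).
Local Notation mX := (monomial C (index_x r)).
Local Notation mY := (monomial C (index_y r)).
Local Notation uact := (uact iota).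
Local Notation Ind := (ind iota r w).
Local Notation beta := (gl2_beta F).
Local Notation co := (@co p e f F C iota r w).
Local Notation coef := (@coef p f k C iota).
Local Notation in_box := (@in_box p f r).
Local Notation digits_of := (@digits_of p f r r_bounds).
Implicit Types (phi psi : Ind) (g h m : GL2 F) (V : F -> W) (x y : F) (u : W) (n N : nat).
Implicit Types (G : F -> C) (d : digits p f).

Local Notation tens := (@tens p e f F C iota r w).
Local Notation at_level := (@at_level p e f F C iota r w).

Lemma iwahori_inv g : g \in @iwahori p e f F -> (g^-1)%g \in @iwahori p e f F.
Proof.
move=> Ig; have Kg : g \in @GL2_int p e f F by case/andP: Ig.
have KV := GL2_intV Kg; apply/andP; split=> //.
have [_ g11] := iwahori_diag Ig; have gO a b := iwahori_int a b Ig.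
have VO : forall a b, ((g^-1)%g : 'M_2) a b \in O by case/GL2_intP: KV.
have [g110 _] := red_neq0_val (gO 1 1) g11.
have := GL2_mulE g (g^-1)%g 1 0; rewrite mulgV gl2_1E mxE /= => /esym/eqP.
rewrite addrC addr_eq0 => /eqP E.
have -> : ((g^-1)%g : 'M_2) 1 0 = - ((g : 'M_2) 1 0 * (((g^-1)%g : 'M_2) 0 0 / (g : 'M_2) 1 1)).
  by apply: (mulfI g110); rewrite E mulrN mulrCA [_ / _]mulrC mulVKf.
case/andP: Ig => _ g10; rewrite val_geN //; apply: (@val_geM _ _ _ F 1 0) => //.
by rewrite rpredM // intV.
Qed.

Lemma pro_p_red g : g \in @pro_p_iwahori p e f F -> [/\ g \in @iwahori p e f F,
  red ((g : 'M_2) 0 0) = 1 & red ((g : 'M_2) 1 1) = 1].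
Proof.
case/and3P => Ig g00 g11; split=> //; apply/eqP; rewrite -subr_eq0.
  have O00 := iwahori_int 0 0 Ig; rewrite -(red1 (pf_redP F)) -(redB O00) ?rpred1 //.
  by rewrite (red_val1 g00).
have O11 := iwahori_int 1 1 Ig; rewrite -(red1 (pf_redP F)) -(redB O11) ?rpred1 //.
by rewrite (red_val1 g11).
Qed.

Lemma pro_pP g : g \in @iwahori p e f F -> red ((g : 'M_2) 0 0) = 1 -> red ((g : 'M_2) 1 1) = 1 ->
  g \in @pro_p_iwahori p e f F.
Proof.
move=> Ig r0 r1; have gO a b := iwahori_int a b Ig.
apply/and3P; split=> //; rewrite -(red_eq0 (pf_redP F)) ?rpredB ?rpred1 ?gO //.
  by rewrite (redB (gO 0 0)) ?rpred1 // r0 (red1 (pf_redP F)) subrr.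
by rewrite (redB (gO 1 1)) ?rpred1 // r1 (red1 (pf_redP F)) subrr.
Qed.

Lemma pro_p_inv g : g \in @pro_p_iwahori p e f F -> (g^-1)%g \in @pro_p_iwahori p e f F.
Proof.
move=> /pro_p_red[Ig r0 r1]; have IV := iwahori_inv Ig.
have gO a b := iwahori_int a b Ig; have VO a b := iwahori_int a b IV.
have /andP[_ V10] := IV; have /andP[_ g10] := Ig.
apply: pro_pP => //.
  have := GL2_mulE g (g^-1)%g 0 0; rewrite mulgV gl2_1E mxE /= mulr1n => /(congr1 red).
  rewrite (red1 (pf_redP F)) (redD (pf_redP F)) ?rpredM // !(redM (pf_redP F)) //.
  by rewrite r0 (red_val1 V10) mulr0 addr0 mul1r.
have := GL2_mulE g (g^-1)%g 1 1; rewrite mulgV gl2_1E mxE /= mulr1n => /(congr1 red).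
rewrite (red1 (pf_redP F)) (redD (pf_redP F)) ?rpredM // !(redM (pf_redP F)) //.
by rewrite r1 (red_val1 g10) mul0r add0r mul1r.
Qed.

Lemma act_mul g h phi : act g (act h phi) = act (g * h)%g phi.
Proof. by apply: val_inj; apply/funext => t; rewrite /= mulgA. Qed.

(** [beta] normalizes I and I(1), exchanging the diagonal entries; this carries statements from one
    side of the tree to the other. *)
Lemma act_beta_iwahori m : m \in @iwahori p e f F -> exists m',
  [/\ m' \in @iwahori p e f F,
      m \in @pro_p_iwahori p e f F -> m' \in @pro_p_iwahori p e f F,
      varpi * (m' : 'M_2) 0 1 = (m : 'M_2) 1 0 &
      (forall phi, act beta (act (m^-1)%g phi) = act (m'^-1)%g (act beta phi)) /\
      (forall phi, act (m^-1)%g (act beta phi) = act beta (act (m'^-1)%g phi))].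
Proof.
move=> Im; have [m' [Im' E m00 m11 m01]] := beta_conj_iwahori Im.
have E2 phi : act (m^-1)%g (act beta phi) = act beta (act (m'^-1)%g phi).
  rewrite !act_mul; congr act; apply: (@mulgI _ m); rewrite mulVKg mulgA E.
  by rewrite -mulgA mulgV mulg1.
exists m'; split=> //; first by move=> /pro_p_red[_ r0 r1]; apply: pro_pP; rewrite ?m00 ?m11.
split=> // phi; rewrite -{1}(act_betaK phi) E2 act_betaK //.
Qed.

Lemma dchar_pro_p m (i : multi_index r) : m \in @pro_p_iwahori p e f F -> dchar iota w m i = 1.
Proof.
move=> /pro_p_red[_ r0 r1]; rewrite /dchar /red_frob r0 r1 mulr1 rmorph1 expr1n mul1r.
by rewrite big1 // => j _; rewrite !expr1n mulr1.
Qed.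

Lemma ratio_pro_p m : m \in @pro_p_iwahori p e f F -> ratio m = 1.
Proof. by move=> /pro_p_red[_ r0 r1]; rewrite /ratio r0 r1 divr1. Qed.

Lemma co_act_eq m n x phi i : m \in @iwahori p e f F -> x \in O ->
  (co n x (act (m^-1)%g phi) i : C) = (dchar iota w m i)^-1 * co n (mob m x) phi i.
Proof. by move=> Im Ox; rewrite -co_act // mulKf // dchar_neq0. Qed.

Lemma co_act_eq0 m n x phi : m \in @iwahori p e f F -> x \in O ->
  co n (mob m x) phi = 0 -> co n x (act (m^-1)%g phi) = 0.
Proof.
move=> Im Ox E; apply/ffunP => i; rewrite [LHS]co_act_eq // E !ffunE; exact: mulr0.
Qed.

Lemma at_level_act m n phi V : m \in @iwahori p e f F -> at_level n phi V ->
  at_level n (act (m^-1)%g phi) (fun x => [ffun i => (dchar iota w m i)^-1 * V (mob m x) i]).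
Proof.
move=> Im [P1 P2 P3]; split=> [x Ox|j x neq Ox|j x Ox].
- by apply/ffunP => i; rewrite co_act_eq // P1 ?mob_int // !ffunE.
- by apply: co_act_eq0 => //; rewrite P2 ?mob_int.
have [m' [Im' _ _ [-> _]]] := act_beta_iwahori Im.
by apply: co_act_eq0 => //; rewrite P3 ?mob_int.
Qed.

Definition s_exp (l : 'I_f) : nat := p ^ l * (r l).+1.

Lemma r_ltpS l : ((r l).+1 < p)%N.
Proof. by have /andP[_] := r_bounds l; lia. Qed.

Lemma tr_pow (a b : k) (l : 'I_f) j d : (j < p)%N ->
  coef (fun t => iota (a + b * t) ^+ (p ^ l * j)) d
  = \sum_(i < p) ('C(j, i)%:R * (iota a ^+ (p ^ l)) ^+ (j - i) * (iota b ^+ (p ^ l)) ^+ i)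
     * (single F l i == d)%:R.
Proof.
move=> ltj; rewrite -(coef_binom iota l _ _ d ltj); congr (coef _ _); apply/funext => t.
by rewrite exprM rmorphD rmorphM (frobD iota) exprMn.
Qed.

Lemma uact_mY_single l0 (t : k) i : (forall j : 'I_f, j = l0) ->
  uact t mY i = 'C(r l0, i l0)%:R * (iota t ^+ (p ^ l0)) ^+ (r l0 - i l0).
Proof.
move=> only; rewrite ffunE (@big_only1 _ _ _ _ (index_y r)) //= => [|i' neq _].
  rewrite ffunE eqxx mul1r (@big_only1 _ _ _ _ l0) //= => [|j /eqP[]//].
  by rewrite ffunE.
by rewrite ffunE (negPf neq) mul0r.
Qed.

(** The coordinates are power sums of exponent at most r + 2 < p - 1 = q - 1. *)
Lemma sum_quad_mY l0 (a b c : C) : f = 1%N -> (forall j : 'I_f, j = l0) ->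
  \sum_l (a + b * iota l + c * iota l ^+ 2) *: uact l mY = 0.
Proof.
move=> f1 only; have l00 : l0 = 0%N :> nat by have := ltn_ord l0; lia.
have E (i : multi_index r) : \sum_l (a + b * iota l + c * iota l ^+ 2)
    * ('C(r l0, i l0)%:R * (iota l ^+ (p ^ l0)) ^+ (r l0 - i l0)) = 0 :> C.
  set t := (r l0 - i l0)%N.
  have lt_t : (t.+2 < #|k|.-1)%N.
    have -> : #|k| = p by rewrite pf_inertia -[RHS]expn1; congr expn.
    by have := r_bounds l0; rewrite /t; lia.
  transitivity ('C(r l0, i l0)%:R * (a * \sum_l iota l ^+ t + b * \sum_l iota l ^+ t.+1
      + c * \sum_l iota l ^+ t.+2)).
    rewrite !big_distrr -!big_split /= big_distrr; apply: eq_bigr => l _ /=.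
    by rewrite l00 expn0 expr1 !exprS; ring.
  rewrite !sum_exp_eq0 ?mulr0 ?addr0 ?mulr0 //; apply: leq_trans lt_t => //.
  exact: leqW.
apply/ffunP => i; rewrite sum_ffunE [RHS]ffunE -[RHS](E i); apply: eq_bigr => l _.
by rewrite ffunE (uact_mY_single _ _ only).
Qed.

(** Along the last digit, the difference to be absorbed is one of (r_l + 1)-th powers of two affine
    functions with the same slope; the leading terms cancel and the rest is in the box. For f = 1
    the coefficient of y^r remains: it is quadratic in the digit of rank n - 1 and killed by
    [sum_quad_mY], which requires n > 0. *)
Lemma eig_s n l m : m \in @iwahori p e f F -> (1 < f)%N \/ ((1 < e)%N /\ (0 < n)%N) ->
  exists psi, act (m^-1)%g (elt_s iota r w n.+1 (s_exp l))
  = ((dchar iota w m (index_x r))^-1 * iota (ratio m) ^+ s_exp l) *: elt_s iota r w n.+1 (s_exp l)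
    + T psi.
Proof.
move=> Im cond; set c1 := (dchar _ _ _ _)^-1; set a := _ * _.
have lS := at_level_s iota w r_bounds n (s_exp l).
have f0 : (0 < f)%N by apply: leq_ltn_trans (ltn_ord l).
set s := elt_s _ _ _ _ _ in lS *.
pose G x := c1 * iota (dig n (mob m x)) ^+ s_exp l - a * iota (dig n x) ^+ s_exp l.
have lG : at_level n.+1 (- a *: s + act (m^-1)%g s) (fun x => G x *: mX).
  have [Q1 Q2 Q3] := at_levelZD (- a) lS (at_level_act Im lS).
  split=> // x Ox; rewrite Q1 //; apply/ffunP => i; rewrite !ffunE.
  have [->|neq] := eqVneq i (index_x r).
    have gen (y z t u : C) : - y * (z * 1) + t * (u * 1) = (t * u - y * z) * 1 by ring.
    exact: gen.
  have gen (y z t u b : C) : - y * (z * 0) + t * (u * 0) = b * 0 by ring.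
  exact: gen.
have trG x : x \in O -> tr G n x = fun t =>
    c1 * iota (dig n (mob m x) + (- ratio m) * t) ^+ s_exp l
    + - c1 * iota (ratio m * dig n x + (- ratio m) * t) ^+ s_exp l.
  move=> Ox; apply/funext => t; rewrite /tr /G dig_mob ?teich_int // pf_teichK.
  rewrite dig_add ?teich_int // pf_teichK mulrN mulNr mulNr; congr (_ - _).
  rewrite /a -mulrA; congr (_ * _); rewrite -exprMn -rmorphM; congr (iota _ ^+ _).
  by rewrite mulrDr mulrN.
pose R := iota (- ratio m) ^+ (p ^ l).
pose Y x := iota (dig n (mob m x)) ^+ (p ^ l) : C.
pose Y' x := iota (ratio m * dig n x) ^+ (p ^ l) : C.
have coefG x d : x \in O -> coef (tr G n x) d
    = \sum_(i < p) c1 * ('C((r l).+1, i)%:R * (Y x ^+ ((r l).+1 - i) - Y' x ^+ ((r l).+1 - i)) * R ^+ i)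
       * (single F l i == d)%:R.
  move=> Ox; rewrite trG // coefZD coefZ /s_exp !(tr_pow _ _ _ _ (r_ltpS l)).
  rewrite !big_distrr -big_split /=; apply: eq_bigr => i _; rewrite -/(Y x) -/(Y' x) -/R; ring.
have [psi Epsi] : exists psi, - a *: s + act (m^-1)%g s = T psi.
  apply: (absorb_lift (r_bounds := r_bounds) T_hecke lG) => [x d Ox out|n0|n' En x Ox].
  - rewrite coefG // big1 // => i _; case: eqP => [Ed|]; last by rewrite mulr0.
    have : ~~ (i <= r l)%N by rewrite -(in_box_single F r l i) Ed.
    rewrite -ltnNge leq_eqVlt => /orP[/eqP <-|lt_i].
      by rewrite subnn !expr0 subrr mulr0 mul0r mulr0 mul0r.
    by rewrite bin_small // !mul0r mulr0 mul0r.
  - rewrite coefG ?rpred0 // big1 // => i _; case: eqP => [Ed|]; last by rewrite mulr0.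
    have [_ only] := digits_ofY_single Ed; case: cond => [f1|[_]]; last by rewrite n0.
    have := only (Ordinal f1); have := only (Ordinal f0) => <- /(congr1 val) //.
  case: (ltnP 1 f) => f1.
    rewrite big1 // => t _; rewrite coefG ?rpredD ?unifM_int ?teich_int // big1 ?scale0r // => i _.
    case: eqP => [Ed|]; last by rewrite mulr0.
    have [_ only] := digits_ofY_single Ed.
    have := only (Ordinal f1); have := only (Ordinal f0) => <- /(congr1 val) //.
  have e1 : (1 < e)%N by case: cond => [|[]//]; rewrite ltnNge f1.
  have f1' : f = 1%N by apply/eqP; rewrite eqn_leq f1 f0.
  have l0 : l = 0%N :> nat by have := ltn_ord l; lia.
  have only (j : 'I_f) : j = l by apply: val_inj; have := ltn_ord j; rewrite /= l0; lia.
  (* With n = n' + 1, the digit of rank n of the image is quadratic in the digit t of rank n', over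
     which the part going down sums. *)
  have [A [B [D HD]]] := dig_mobS n' e1 f0 Im Ox.
  pose K : C := c1 * (r l).+1%:R * R ^+ r l.
  have EY t : coef (tr G n (x + varpi ^+ n' * teich t)) (digits_of (index_y r))
      = K * (iota (A - ratio m * dig n x) + iota B * iota t + iota D * iota t ^+ 2).
    have Oxt : x + varpi ^+ n' * teich t \in O by rewrite rpredD ?unifM_int ?teich_int.
    rewrite coefG // (@big_only1 _ _ _ _ (Ordinal (r_ltp r_bounds l))) //= => [|i neq _].
      rewrite (_ : (single F l _ == _) = true) ?mulr1; last first.
        apply/eqP/ffunP => j; apply: val_inj.
        by rewrite (only j) !ffunE eqxx.
      rewrite binSn subSnn !expr1 /Y /Y' l0 expn0 !expr1 En HD.
      rewrite dig_addS ?teich_int // carry_eq0 // addr0.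
      have -> : dig 1 (teich t) = 0.
        by rewrite -[teich t]mul1r dig_teichM ?rpred1 // -teich1 /dig /= /dshift pf_teichK subrr mul0r red0 mul0r.
      by rewrite addr0 /K !(rmorphB, rmorphD, rmorphM, rmorphXn) /=; ring.
    case: eqP => [Ed|]; last by rewrite mulr0.
    have [Ei _] := digits_ofY_single Ed; case/eqP: neq; exact: val_inj.
  under eq_bigr do rewrite EY -scalerA.
  by rewrite -scaler_sumr (sum_quad_mY _ _ _ f1' only) scaler0.
by exists psi; rewrite -Epsi scaleNr addrA subrr add0r.
Qed.

(** The components on x_l^(r_l - 1) y_l cancel. The x^r component left is, by [dig_mobS], a
    quadratic polynomial twisted by Frobenius; as 2 < r_l, it meets neither obstruction of
    [absorb_lift]. *)
Lemma eig_t n l m : m \in @iwahori p e f F -> (1 < e)%N ->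
  exists psi, act (m^-1)%g (elt_t iota r w n.+1 l)
  = (dchar iota w m (index_xy r l))^-1 *: elt_t iota r w n.+1 l + T psi.
Proof.
move=> Im e1; set c2 := (dchar _ _ _ _)^-1.
have lT := at_level_t iota w r_bounds n.+1 l.
have f0 : (0 < f)%N by apply: leq_ltn_trans (ltn_ord l).
set t := elt_t _ _ _ _ _ in lT *.
pose c1 := (dchar iota w m (index_x r))^-1.
pose G x := - c1 * iota (dig n.+1 (mob m x)) ^+ (p ^ l) + c2 * iota (dig n.+1 x) ^+ (p ^ l).
have neqX : index_xy r l != index_x r.
  apply/eqP => /ffunP/(_ l)/(congr1 val) /=; rewrite (index_xyE r_bounds) eqxx ffunE //.
have lG : at_level n.+1 (- c2 *: t + act (m^-1)%g t) (fun x => G x *: mX).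
  have [Q1 Q2 Q3] := at_levelZD (- c2) lT (at_level_act Im lT).
  split=> // x Ox; rewrite Q1 //; apply/ffunP => i; rewrite !ffunE.
  have [->|neq] := eqVneq i (index_x r).
    rewrite eq_sym (negPf neqX).
    have gen (y z b u : C) : - y * (- z * 1 + 0) + b * (- u * 1 + 0) = (- b * u + y * z) * 1.
      by ring.
    exact: gen.
  case: eqP => [->|_].
    have gen (y z u b : C) : - y * (- z * 0 + 1) + y * (- u * 0 + 1) = b * 0 by ring.
    exact: gen.
  have gen (y z b u a : C) : - y * (- z * 0 + 0) + b * (- u * 0 + 0) = a * 0 by ring.
  exact: gen.
have r2 : (2 < r l)%N by case/andP: (r_bounds l).
have coefG x : x \in O -> exists a b c : C, forall d, coef (tr G n x) d
    = \sum_(i < p) nth 0 [:: a; b; c] i * (single F l i == d)%:R.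
  move=> Ox; have [A [B [D HD]]] := dig_mobS n e1 f0 Im Ox.
  exists (- c1 * iota A ^+ (p ^ l) + c2 * iota (dig n.+1 x) ^+ (p ^ l)),
    (c1 * iota B ^+ (p ^ l)), (- c1 * iota D ^+ (p ^ l)) => d'.
  rewrite -(coef_single iota l (fun i => nth 0 [:: _; _; _] i)).
  congr (coef _ _); apply/funext => u; rewrite /tr /G HD.
  rewrite dig_addS ?teich_int // carry_eq0 // addr0.
  have -> : dig 1 (teich (- u)) = 0.
    by rewrite -[teich _]mul1r dig_teichM ?rpred1 // -teich1 /dig /= /dshift pf_teichK subrr mul0r red0 mul0r.
  rewrite addr0.
  have p3 : (2 < p)%N by have := r_ltp r_bounds l; lia.
  rewrite (bigD1 (Ordinal (ltnW (ltnW p3)))) //= (bigD1 (Ordinal (ltnW p3))) //= (bigD1 (Ordinal p3)) //=.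
  rewrite big1 => [|[i lti] /=]; last first.
    by rewrite -!val_eqE /=; case: i lti => [|[|[|i]]] //= _ _; rewrite nth_nil mul0r.
  have -> : A + B * - u + D * (- u) ^+ 2 = A - B * u + D * (u * u) by ring.
  rewrite !(rmorphD, rmorphN, rmorphM) !(frobD iota) (frobN iota) !exprMn; ring.
have [psi Epsi] : exists psi, - c2 *: t + act (m^-1)%g t = T psi.
  have box x : x \in O -> forall d, (~~ in_box d \/ d = digits_of (index_y r)) -> coef (tr G n x) d = 0.
    move=> Ox d Hd; have [a [b [c ->]]] := coefG x Ox; rewrite big1 // => j _.
    case: eqP => [Ed|]; last by rewrite mulr0.
    suff j2 : (2 < j)%N by rewrite nth_default ?mul0r.
    case: Hd => [|Hd]; first by rewrite -Ed in_box_single -ltnNge; apply: ltn_trans.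
    by have [-> _] := digits_ofY_single (etrans Ed Hd).
  apply: (absorb_lift (r_bounds := r_bounds) T_hecke lG) => [x d Ox out|n0|n' En x Ox].
  - by apply: (box x Ox); left.
  - by apply: (box 0 (rpred0 _)); right.
  rewrite big1 // => u _; rewrite box ?scale0r ?rpredD ?unifM_int ?teich_int //.
  by right.
by exists psi; rewrite -Epsi scaleNr addrA subrr add0r.
Qed.

Lemma eig_base m : m \in @iwahori p e f F ->
  act (m^-1)%g (tens 1%g mX : Ind) = (dchar iota w m (index_x r))^-1 *: (tens 1%g mX : Ind).
Proof.
move=> Im; have lB := at_level_base iota w r_bounds.
have l0 : at_level 0 (0 : Ind) (fun=> 0) by split=> *; rewrite !linear0.
have := at_levelZD (dchar iota w m (index_x r))^-1 lB l0; rewrite addr0.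
move/(at_level_eq (at_level_act Im lB)); apply => x Ox.
apply/ffunP => i; rewrite !ffunE addr0.
by have [->|neq] := eqVneq i (index_x r); rewrite ?mulr0 // -[_ *: _]/(_ * _) mulr0.
Qed.

End Equivariance.

(** * Invariants modulo the image of T *)

Section Invariance.
Variables (p e f : nat) (F : padicField p e f).
Variables (C : closedFieldType) (iota : {rmorphism pf_residue F -> C}).
Variables (r : 'I_f -> nat) (w : nat).
Hypothesis r_bounds : forall j, (2 < r j < p - 3)%N.
Variable T : {linear ind iota r w -> ind iota r w}.
Hypothesis T_hecke : is_hecke T.
Local Notation v := (@pf_val p e f F).
Local Notation O := (val_ge v 0).
Local Notation red := (@pf_red p e f F).
Local Notation teich := (@pf_teich p e f F).
Local Notation varpi := (pf_unif F).
Local Notation k := (pf_residue F).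
Local Notation W := (weight C r).
Local Notation mX := (monomial C (index_x r)).
Local Notation mXY l := (monomial C (index_xy r l)).
Local Notation evX u := ((u : W) (index_x r) : C).
Local Notation uact := (uact iota).
Local Notation Ind := (ind iota r w).
Local Notation beta := (gl2_beta F).
Local Notation co := (@co p e f F C iota r w).
Local Notation coef := (@coef p f k C iota).
Local Notation in_box := (@in_box p f r).
Local Notation digits_of := (@digits_of p f r r_bounds).
Implicit Types (phi psi : Ind) (g h m : GL2 F) (V : F -> W) (x y : F) (u : W) (n N : nat).
Implicit Types (G : F -> C) (d : digits p f).

Let pp := pf_prime F.
Let cardk : #|k| = (p ^ f)%N := pf_inertia F.
Let pC : p \in [pchar C] := pchar_C iota.

Definition below2 N phi := below N phi /\ below N (act beta phi).
(* I(1)-invariance of the image in the cokernel of T. *)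
Definition inv_mod phi := forall m, m \in @pro_p_iwahori p e f F ->
  exists psi, act (m^-1)%g phi - phi = T psi.

Lemma belowZD N a phi psi : below N phi -> below N psi -> below N (a *: phi + psi).
Proof. by move=> b1 b2 n x leN Ox; rewrite linearP /= b1 ?b2 // scaler0 addr0. Qed.

Lemma below2ZD N a phi psi : below2 N phi -> below2 N psi -> below2 N (a *: phi + psi).
Proof. by move=> [b1 b1'] [b2 b2']; split; rewrite ?linearP; apply: belowZD. Qed.

Lemma below2_beta N phi : below2 N phi -> below2 N (act beta phi).
Proof. by case=> b b'; split=> //; rewrite act_betaK. Qed.

Lemma below_act N m phi : m \in @iwahori p e f F -> below N phi -> below N (act (m^-1)%g phi).
Proof. by move=> Im bN n x leN Ox; apply: co_act_eq0 => //; rewrite bN ?mob_int. Qed.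

Lemma below2_act N m phi : m \in @iwahori p e f F -> below2 N phi -> below2 N (act (m^-1)%g phi).
Proof.
move=> Im [b b']; split; first exact: below_act.
by have [m' [Im' _ _ [-> _]]] := @act_beta_iwahori _ _ _ F C iota r w m Im; apply: below_act.
Qed.

Lemma below2_leq M N phi : (M <= N)%N -> below2 M phi -> below2 N phi.
Proof.
by move=> leMN [b b']; split=> n x leN; [apply: b | apply: b']; apply: leq_trans leN.
Qed.

Lemma below2_exists phi : exists N, below2 N phi.
Proof.
have [N1 H1] := below_exists phi; have [N2 H2] := below_exists (act beta phi).
by exists (maxn N1 N2); split=> n x; rewrite geq_max => /andP[l1 l2]; [apply: H1 | apply: H2].
Qed.

Lemma below2_0 phi : below2 0 phi -> phi = 0.
Proof. by case=> b b'; apply: coords_inj => n x Ox; [apply: b | apply: b']. Qed.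

Lemma evX_co_inj n psi : (forall x, x \in O -> evX (co n x psi) = 0) ->
  forall x, x \in O -> co n x psi = 0.
Proof.
move=> psi0 x Ox; apply: (evx_inj (iota := iota) r_bounds) => t.
rewrite (evx_tr (co_level n psi) Ox) /tr psi0 ?rpredD ?unifM_int ?teich_int //.
by rewrite /evx linear0 ffunE.
Qed.

Lemma downE0 n x V : (forall y, y \in O -> V y = 0) -> x \in O -> down iota n V x = 0.
Proof.
move=> V0 Ox; rewrite /down big1 // => l _.
by rewrite V0 ?rpredD ?unifM_int ?teich_int // ffunE scale0r.
Qed.

Lemma co_TS n x psi : x \in O -> below n.+2 psi ->
  co n.+1 x (T psi) = evX (co n x psi) *: mX.
Proof.
move=> Ox bpsi; have := co_T r_bounds T_hecke n.+1 psi Ox; rewrite /co_T_at => ->.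
by rewrite downE0 ?addr0 // => y Oy; apply: bpsi.
Qed.

Lemma scale_mX_eq0 (c : C) : c *: mX = 0 -> c = 0.
Proof.
move/ffunP/(_ (index_x r)); rewrite !ffunE eqxx => E.
by rewrite -[c]mulr1; exact: E.
Qed.

(** Descent on a bound M of the support of [psi]: for M >= N, level M+1 of [T psi] vanishes and
    shows the x^r coordinates of level M of [psi], which determine that level. *)
Lemma T_below2 N psi : below2 N.+1 (T psi) -> below2 N psi.
Proof.
have half M psi' : (N <= M)%N -> below M.+1 psi' -> below N.+1 (T psi') -> below M psi'.
  move=> leNM bM bT n x; rewrite leq_eqVlt => /orP[/eqP <-|lt]; last exact: bM.
  move: x; apply: evX_co_inj => x Ox; apply: scale_mX_eq0.
  by rewrite -co_TS ?bT // => n' y len; apply: bM; apply: ltnW.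
move=> [bT bT']; have [M] := below2_exists psi; elim: M => [|M IH].
  exact: below2_leq.
have [leNM [bM bM']|ltMN] := leqP N M; last exact: below2_leq.
by apply: IH; split; apply: half; rewrite // -?(T_act T_hecke) // in bT' *.
Qed.

Lemma inv_modZD a phi psi : inv_mod phi -> inv_mod psi -> inv_mod (a *: phi + psi).
Proof.
move=> i1 i2 m Pm; have [t1 E1] := i1 m Pm; have [t2 E2] := i2 m Pm.
exists (a *: t1 + t2); rewrite !linearP /= -E1 -E2 scalerBr.
by rewrite scalerN addrACA.
Qed.

Lemma inv_mod_T psi : inv_mod (T psi).
Proof.
move=> m Pm; exists (act (m^-1)%g psi - psi).
by rewrite linearB /= (T_act T_hecke).
Qed.

Lemma inv_mod_beta phi : inv_mod phi -> inv_mod (act beta phi).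
Proof.
move=> i m Pm; have [Ipm _ _] := pro_p_red Pm.
have [m' [Im' Pm' _ [_ E]]] := @act_beta_iwahori _ _ _ F C iota r w m Ipm.
have [psi Epsi] := i m' (Pm' Pm); exists (act beta psi).
by rewrite E (T_act T_hecke) -Epsi linearB.
Qed.

Lemma u_pro_p b : b \in O -> gl2_g0 0 b \in @pro_p_iwahori p e f F.
Proof.
by move=> Ob; apply: pro_pP; rewrite ?u_iwahori ?g0E ?expr0 ?(red1 (pf_redP F)).
Qed.

Lemma co_act_u n x b phi : x \in O -> b \in O ->
  co n x (act (gl2_g0 0 b)^-1%g phi) = co n (x + b) phi.
Proof.
move=> Ox Ob; have Pu := u_pro_p Ob; have [Iu _ _] := pro_p_red Pu.
apply/ffunP => i; rewrite [LHS]co_act_eq // dchar_pro_p // invr1.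
have -> : mob (gl2_g0 0 b) x = x + b by rewrite /mob !g0E mul0r add0r divr1 expr0 mul1r.
exact: mul1r.
Qed.

Lemma inv_shift n phi c : inv_mod phi -> below2 n.+2 phi -> c \in O ->
  exists psi, [/\ below2 n.+1 psi, act (gl2_g0 0 c)^-1%g phi - phi = T psi
    & forall x, x \in O -> co n.+1 (x + c) phi = co n.+1 x phi + evX (co n x psi) *: mX].
Proof.
move=> iphi bphi Oc; have [psi Epsi] := iphi _ (u_pro_p Oc).
have [Iu _ _] := pro_p_red (u_pro_p Oc).
have bpsi : below2 n.+1 psi.
  apply: T_below2; rewrite -Epsi addrC -scaleN1r; apply: below2ZD => //.
  exact: below2_act.
exists psi; split=> // x Ox; rewrite -co_act_u //.
have [b _] := bpsi; rewrite -co_TS // => [|m y lem]; last by apply: b; apply: ltnW.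
by rewrite -Epsi linearB /= addrC subrK.
Qed.

Lemma index_xy_neq l : index_xy r l != index_x r.
Proof.
apply/eqP => /ffunP/(_ l)/(congr1 val) /=; rewrite (index_xyE r_bounds) eqxx ffunE //.
Qed.

Lemma inv_non_x n phi x i : inv_mod phi -> below2 n.+2 phi -> x \in O ->
  i != index_x r -> co n.+1 x phi i = co n.+1 0 phi i.
Proof.
move=> iphi bphi Ox neq; have [psi [_ _ E]] := inv_shift iphi bphi Ox.
rewrite -[x]add0r E ?rpred0 // !ffunE (negPf neq).
exact: (etrans (congr1 _ (mulr0 _)) (addr0 _)).
Qed.

(** The coordinates of [u] other than x^r are fixed by unipotents. Some digit i_l is positive, so
    the exponent i dominates p^l and [coef_transl_inv] applies there. *)
Lemma inv_support n phi i : inv_mod phi -> below2 n.+2 phi ->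
  i != index_x r -> (forall l, i != index_xy r l) -> co n.+1 0 phi i = 0.
Proof.
move=> iphi bphi neqX neqXY; set u := co n.+1 0 phi.
have u_inv t j : j != index_x r -> uact t u j = u j.
  move=> neq; have := co_level n.+1 phi (rpred0 _) (teich_int (- t)).
  rewrite pf_teichK opprK => <-.
  by rewrite add0r [LHS](inv_non_x iphi bphi) // unifM_int ?teich_int.
have /existsP[l neq_l] : [exists l, i l != index_x r l].
  apply: contraR neqX => /existsPn eq; apply/eqP/ffunP => l.
  by have /negPn/eqP := eq l.
have i_gt0 : (0 < i l)%N by rewrite lt0n; rewrite -val_eqE ffunE in neq_l.
rewrite -[LHS](coef_evx_digits iota r_bounds).
apply: (coef_transl_inv pp cardk pC (m := digits_of (index_xy r l))) => [c|j|].
- rewrite (coef_evx_digits iota r_bounds) -(u_inv c _ (index_xy_neq l)).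
  rewrite -(coef_evx_digits iota r_bounds (uact c u)); congr (coef _ _).
  by apply/funext => b; rewrite (evxD iota w).
- by rewrite (digits_ofXY F r_bounds) !ffunE; case: eqP => [->|].
by rewrite (inj_eq (@digits_of_inj _ _ _ r_bounds)).
Qed.

Lemma inv_top n phi x : inv_mod phi -> below2 n.+2 phi -> x \in O ->
  co n.+1 x phi = evX (co n.+1 x phi) *: mX
    + \sum_l (co n.+1 0 phi (index_xy r l) : C) *: mXY l.
Proof.
move=> iphi bphi Ox; apply/ffunP => i; rewrite !ffunE sum_ffunE.
have [->|neqX] := eqVneq i (index_x r).
  rewrite big1 => [|l _]; last first.
    rewrite !ffunE eq_sym (negPf (index_xy_neq l)); exact: mulr0.
  by rewrite addr0; exact: esym (mulr1 _).
rewrite (inv_non_x iphi bphi Ox neqX).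
transitivity (\sum_l (co n.+1 0 phi (index_xy r l) : C) * (i == index_xy r l)%:R); last first.
  rewrite -[LHS]add0r; congr (_ + _); first by apply: esym; apply: mulr0.
  by apply: eq_bigr => l _; rewrite !ffunE.
have [/existsP[l /eqP ->]|/existsPn neqXY] := boolP [exists l, i == index_xy r l].
  rewrite (@big_only1 _ _ _ _ l) //= ?eqxx ?mulr1 // => l' neq _.
  case: eqP => [E|_]; last by rewrite mulr0.
  case/eqP: neq; apply/eqP; have /ffunP/(_ l')/(congr1 val) /= := E.
  by rewrite !(index_xyE r_bounds) eqxx; case: eqP.
rewrite (inv_support iphi bphi neqX neqXY) big1 // => l _.
by rewrite (negPf (neqXY l)) mulr0.
Qed.

(* The last digit of x + y is the sum of the last digits of x and y up to a
   carry; for e = 1 the term of degree p - 1 of the carry obstructs the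
   invariance of t_n^l. *)
Lemma inv_xy_eq0 n phi l : e = 1%N -> inv_mod phi -> below2 n.+2 phi ->
  co n.+1 0 phi (index_xy r l) = 0.
Proof.
move=> e1 iphi bphi; set chi := fun l => (co n.+1 0 phi (index_xy r l) : C).
have f0 : (0 < f)%N := leq_ltn_trans (leq0n l) (ltn_ord l).
have e0 : (0 < e)%N by rewrite e1.
pose psi x : C := evX (co n.+1 x phi).
(* Unipotents send x_l^(r_l - 1) y_l to itself plus a multiple of x^r: this measures how far [psi]
   is from being periodic. *)
have psi_per x b : x \in O -> b \in O ->
    psi (x + varpi ^+ n.+1 * b) = psi x + \sum_l chi l * (- iota (red b)) ^+ (p ^ l).
  move=> Ox Ob; rewrite /psi (co_level n.+1 phi Ox Ob) (inv_top iphi bphi Ox).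
  rewrite linearD linearZ /= (uact_x iota w r_bounds) linear_sum /=.
  rewrite !ffunE !sum_ffunE eqxx.
  rewrite [X in _ = _ + X + _]big1 ?addr0; last first.
    move=> j _; rewrite !ffunE eq_sym (negPf (index_xy_neq j)); exact: mulr0.
  apply: (congr1 (fun z : C => (co n.+1 x phi (index_x r) : C) * 1 + z)).
  apply: eq_bigr => j _; rewrite linearZ /= (uact_xy iota w r_bounds) !ffunE.
  rewrite eqxx eq_sym (negPf (index_xy_neq j)) rmorphN.
  have gen (y z : C) : y * (0 + z * 1) = y * z by rewrite add0r mulr1.
  exact: gen.
pose g := tr psi n 0.
(* [carryE] involves p^(f-1)-th powers; after the Frobenius of index j this is index j - 1,
   cyclically modulo f. *)
pose kap (j : 'I_f) := ord_pred j.
have frob_kap (j : 'I_f) (t : k) : iota t ^+ (p ^ (f.-1 + j)) = iota t ^+ (p ^ kap j).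
  have q_per a b : iota t ^+ (p ^ (f * a + b)) = iota t ^+ (p ^ b).
    elim: a => [|a IH]; first by rewrite muln0.
    rewrite mulnS -addnA expnD exprM -rmorphXn -(pf_inertia F) expf_card.
    exact: IH.
  have -> : (f.-1 + j = f * ((f.-1 + j) %/ f) + kap j)%N.
    rewrite /kap /= (_ : (j + f).-1 = f.-1 + j)%N; last by lia.
    by rewrite mulnC -divn_eq.
  exact: q_per.
have p1 : (0 < p.-1)%N by have := r_ltp r_bounds l; have := r_bounds l; lia.
pose pm : 'I_p := Ordinal (etrans (congr1 (leq^~ p) (prednK (prime_gt0 pp))) (leqnn p)).
pose m := single F (kap l) pm.
pose eps := iota (@prime_red p e f F).
have carry_iota (t c : k) (j : 'I_f) : (- iota (carry (- t) (- c))) ^+ (p ^ j)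
    = \sum_(i < p | (0 < i)%N) (- eps * ('C(p, i) %/ p)%:R) ^+ (p ^ j)
       * (iota t ^+ (p ^ kap j)) ^+ (p - i) * (iota c ^+ (p ^ kap j)) ^+ i.
  have -> : - iota (carry (- t) (- c)) = \sum_(i < p | (0 < i)%N) - eps * ('C(p, i) %/ p)%:R
       * (iota t ^+ (p ^ f.-1)) ^+ (p - i) * (iota c ^+ (p ^ f.-1)) ^+ i.
    rewrite carryE // rmorphM rmorphN mulNr opprK rmorph_sum big_distrr /=.
    apply: eq_bigr => i _; rewrite !rmorphM rmorph_nat !rmorphXn !rmorphN !(frobN iota).
    rewrite -/eps [in X in _ * X ^+ i]/=.
    have /(congr1 (fun z : C => z)) : (-1) ^+ (p - i) * (-1) ^+ i = -1 :> C.
      rewrite -exprD subnK; last exact: ltnW.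
      by have := frobN iota 1 (1 : C); rewrite expn1 expr1n.
    rewrite [(- (iota t ^+ _)) ^+ _]exprNn [(- (iota c ^+ _)) ^+ _]exprNn.
    move: ((-1) ^+ (p - i)) ((-1) ^+ i) => z1 z2 /= Ez.
    have gen (y z t1 t2 : C) : y * (z * (z1 * t1) * (z2 * t2)) = (z1 * z2) * (y * z * t1 * t2).
      by ring.
    by rewrite gen Ez mulN1r !mulNr.
  have sumfrob (h : 'I_p -> C) (A : pred 'I_p) :
      (\sum_(i < p | A i) h i) ^+ (p ^ j) = \sum_(i < p | A i) h i ^+ (p ^ j).
    elim/big_rec2: _ => [|i y z _ <-]; last by rewrite (frobD iota).
    by rewrite expr0n expn_eq0 eqn0Ngt (prime_gt0 pp).
  rewrite sumfrob; apply: eq_bigr => i _; rewrite !exprMn.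
  have E (t' : k) s : (((iota t' ^+ (p ^ f.-1)) ^+ s) ^+ (p ^ j)) = (iota t' ^+ (p ^ kap j)) ^+ s.
    by rewrite exprAC; congr (_ ^+ _); rewrite -exprM -expnD frob_kap.
  by rewrite !E.
(* Translating by c changes [g] by a function from sigma, except that [-t] + [-c] and [-t - c]
   differ by a carry, on which [psi] is not periodic. *)
have g_diff c : exists u, forall t, g (t + c)
    = g t + evx iota u t - \sum_j chi j * (- iota (carry (- t) (- c))) ^+ (p ^ j).
  have Oc : varpi ^+ n * teich (- c) \in O by rewrite unifM_int ?teich_int.
  have [V [_ _ EV]] := inv_shift iphi bphi Oc; exists (co n 0 V) => t.
  have Ot : varpi ^+ n * teich (- t) \in O by rewrite unifM_int ?teich_int.
  have Otc : varpi ^+ n * teich (- (t + c)) \in O by rewrite unifM_int ?teich_int.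
  pose z := (teich (- t) + teich (- c) - teich (- t + - c)) / varpi.
  have Oz : z \in O := carry_subproof (- t) (- c).
  have Ez : varpi ^+ n * teich (- t) + varpi ^+ n * teich (- c)
      = varpi ^+ n * teich (- (t + c)) + varpi ^+ n.+1 * z.
    rewrite exprSr -mulrA /z [varpi * _]mulrC divfK ?pf_unif_neq0 // opprD; ring.
  have := psi_per _ _ Otc Oz; rewrite -Ez /psi EV // !ffunE eqxx.
  rewrite (evx_tr (co_level n V) (rpred0 _)) /g /tr !add0r -/(psi _) => E.
  have gen (y a b q : C) : y + a * 1 = b + q -> b = y + a - q.
    by rewrite mulr1 => ->; rewrite addrK.
  exact: gen E.
have m_out : ~~ in_box m by rewrite in_box_single -ltnNge /=; have := r_bounds (kap l); lia.
(* The digit p - 1 of [m] forbids any power of c in the digit [kap l], whereas the carry contributes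
   there the term of degree p - 1 in t and 1 in c, with coefficient a nonzero multiple of a power of
   [eps] times [chi l]. *)
have main : coef (fun c => coef (fun t => g (t + c)) m - coef g m) (single F (kap l) (one_p F)) = 0.
  apply: (coef_transl_diff_max iota pp cardk pC g (i := kap l)); last by rewrite ffunE eqxx.
  by rewrite ffunE eqxx.
(* The exponent of t facing c^i in the carry; the default value is met only at i = 0, absent from
   the sums. *)
pose cmp (i : 'I_p) : 'I_p := insubd pm (p - i)%N.
have cmpE (i : 'I_p) : (0 < i)%N -> cmp i = (p - i)%N :> nat.
  by move=> i0; rewrite val_insubd ifT //; have := ltn_ord i; lia.
pose wt (j : 'I_f) (i : 'I_p) := chi j * (- eps * ('C(p, i) %/ p)%:R) ^+ (p ^ j).
have coef1 c : coef (fun t => g (t + c)) m - coef g m = - \sum_j \sum_(i < p | (0 < i)%N)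
    wt j i * (single F (kap j) (cmp i) == m)%:R * mon iota (single F (kap j) i) c.
  have [u Eu] := g_diff c.
  rewrite (_ : (fun t => g (t + c)) = (fun t => (g t + evx iota u t)
     - \sum_j chi j * (- iota (carry (- t) (- c))) ^+ (p ^ j))); last first.
    by apply/funext => t; rewrite Eu.
  rewrite coefB coefD (coef_evx_out iota r_bounds u m_out) addr0 addrAC subrr add0r.
  congr (- _); rewrite coef_sumf; apply: eq_bigr => j _.
  rewrite coefZ (_ : (fun t => (- iota (carry (- t) (- c))) ^+ (p ^ j)) = fun t =>
    \sum_(i < p | (0 < i)%N) ((- eps * ('C(p, i) %/ p)%:R) ^+ (p ^ j)
       * mon iota (single F (kap j) i) c) * mon iota (single F (kap j) (cmp i)) t).
    rewrite coef_sumf big_distrr; apply: eq_bigr => i i0 /=.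
    rewrite coefZ (coef_mon iota pp cardk) /wt; ring.
  apply/funext => t; rewrite carry_iota; apply: eq_bigr => i i0.
  rewrite !mon_single cmpE //.
  ring.
move: main; rewrite (_ : (fun c => _) = (fun c => -1 * (\sum_j \sum_(i < p | (0 < i)%N)
    wt j i * (single F (kap j) (cmp i) == m)%:R * mon iota (single F (kap j) i) c))); last first.
  by apply/funext => c; rewrite coef1 mulN1r.
rewrite coefZ coef_sumf mulN1r => /eqP; rewrite oppr_eq0 => /eqP.
rewrite (@big_only1 _ _ _ _ l) //= => [|j neq _]; last first.
  rewrite coef_sumf big1 // => i i0; rewrite coefZ (coef_mon iota pp cardk).
  have [/single_eq/(_ i0)[E _]|_] := eqVneq (single F (kap j) i) (single F (kap l) (one_p F));
    last by rewrite mulr0.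
  by case/eqP: neq; apply: (can_inj (@ord_predK f)).
rewrite coef_sumf (@big_only1 _ _ _ _ (one_p F)) //= => [|i neq i0]; last first.
  rewrite coefZ (coef_mon iota pp cardk).
  have [/single_eq/(_ i0)[_ E]|_] := eqVneq (single F (kap l) i) (single F (kap l) (one_p F));
    last by rewrite mulr0.
  by case/eqP: neq.
rewrite coefZ (coef_mon iota pp cardk) eqxx mulr1.
have -> : single F (kap l) (cmp (one_p F)) = m.
  by congr single; apply: val_inj; rewrite /= cmpE // subn1.
rewrite eqxx mulr1 /wt bin1 divnn (prime_gt0 pp) mulr1 => /eqP.
have eps0 : eps != 0 by rewrite fmorph_eq0 (prime_red_eq0 F e0) e1.
by rewrite mulf_eq0 expf_eq0 oppr_eq0 (negPf eps0) andbF orbF => /eqP.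
Qed.

End Invariance.

(** * The x^r component at the top level, and the excluded s_n *)

Section TopLevel.
Variables (p e f : nat) (F : padicField p e f).
Variables (C : closedFieldType) (iota : {rmorphism pf_residue F -> C}).
Variables (r : 'I_f -> nat) (w : nat).
Hypothesis r_bounds : forall j, (2 < r j < p - 3)%N.
Variable T : {linear ind iota r w -> ind iota r w}.
Hypothesis T_hecke : is_hecke T.
Local Notation v := (@pf_val p e f F).
Local Notation O := (val_ge v 0).
Local Notation teich := (@pf_teich p e f F).
Local Notation varpi := (pf_unif F).
Local Notation k := (pf_residue F).
Local Notation W := (weight C r).
Local Notation mX := (monomial C (index_x r)).
Local Notation evX u := ((u : W) (index_x r) : C).
Local Notation evY u := ((u : W) (index_y r) : C).
Local Notation uact := (uact iota).
Local Notation Ind := (ind iota r w).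
Local Notation beta := (gl2_beta F).
Local Notation co := (@co p e f F C iota r w).
Local Notation is_level := (@is_level p e f F C iota r).
Local Notation coef := (@coef p f k C iota).
Local Notation in_box := (@in_box p f r).
Local Notation digits_of := (@digits_of p f r r_bounds).
Implicit Types (phi psi : Ind) (g h m : GL2 F) (V : F -> W) (x y : F) (u : W) (n N : nat).
Implicit Types (G : F -> C) (d : digits p f).

Let pp := pf_prime F.
Let cardk : #|k| = (p ^ f)%N := pf_inertia F.
Let pC : p \in [pchar C] := pchar_C iota.

Local Notation Inv := (inv_mod T).
Local Notation s_exp := (@s_exp p f r).

Definition r_succ (l : 'I_f) : 'I_p := Ordinal (r_ltpS r_bounds l).

Lemma mX_add (a b c : C) : a *: mX = b *: mX + c *: mX -> a = b + c.
Proof.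
by rewrite -scalerDl => /eqP; rewrite -subr_eq0 -scalerBl => /eqP/scale_mX_eq0/eqP;
  rewrite subr_eq0 => /eqP.
Qed.

Lemma co_mX_per n phi (psi : F -> C) x b : (forall x, x \in O -> co n x phi = psi x *: mX) ->
  x \in O -> b \in O -> psi (x + varpi ^+ n * b) = psi x.
Proof.
move=> E Ox Ob; have Oxb : x + varpi ^+ n * b \in O by rewrite rpredD ?unifM_int.
have := E _ Oxb; rewrite (co_level n phi Ox Ob) E // linearZ /= (uact_x iota w r_bounds).
by move/esym/eqP; rewrite -subr_eq0 -scalerBl => /eqP/scale_mX_eq0/eqP; rewrite subr_eq0 => /eqP.
Qed.

Lemma tr_s_exp n x (l : 'I_f) d : x \in O ->
  coef (tr (fun x => iota (dig n x) ^+ s_exp l) n x) d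
  = \sum_(i < p) ('C((r l).+1, i)%:R * (iota (dig n x) ^+ (p ^ l)) ^+ ((r l).+1 - i) * (-1) ^+ i)
     * (single F l i == d)%:R.
Proof.
move=> Ox; rewrite (_ : tr _ n x = fun t => iota (dig n x + -1 * t) ^+ (p ^ l * (r l).+1)).
  rewrite (@tr_pow _ _ _ _ _ iota _ _ _ _ d (r_ltpS r_bounds l)).
  by rewrite rmorphN rmorph1 (frobN iota) expr1n.
by apply/funext => t; rewrite /tr dig_add ?teich_int // pf_teichK mulN1r.
Qed.

Lemma tr_s_exp_out n x (l : 'I_f) d : x \in O -> ~~ in_box d ->
  coef (tr (fun x => iota (dig n x) ^+ s_exp l) n x) d
  = (-1) ^+ (r l).+1 * (single F l (r_succ l) == d)%:R.
Proof.
move=> Ox out; rewrite tr_s_exp // (@big_only1 _ _ _ _ (r_succ l)) //= => [|i neq _].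
  by rewrite binn subnn expr0 !mul1r.
case: eqP => [Ed|]; last by rewrite mulr0.
have : ~~ (i <= r l)%N by rewrite -(in_box_single F r l i) Ed.
rewrite -ltnNge leq_eqVlt => /orP[/eqP E|lt_i].
  by case/eqP: neq; apply: val_inj.
by rewrite bin_small // !mul0r.
Qed.

(** Translations change [psi] by functions from sigma, so its coefficients outside the box are
    invariant. An exponent outside the box dominates r_l + 1 in some digit l, and the exponent p^l
    (r_l + 1) is itself outside the box: by [coef_transl_inv] only the latter survive. *)
Lemma inv_x n phi (psi : F -> C) : Inv phi -> below2 n.+2 phi ->
  (forall x, x \in O -> co n.+1 x phi = psi x *: mX) ->
  exists (a : 'I_f -> C) V, is_level n V /\ forall x, x \in O ->
    psi x = \sum_l a l * iota (dig n x) ^+ s_exp l + evX (V x).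
Proof.
move=> iphi bphi E; have per := co_mX_per E.
have shift c x d : c \in O -> x \in O -> ~~ in_box d ->
    coef (tr (fun y => psi (y + c)) n x) d = coef (tr psi n x) d.
  move=> Oc Ox out; have [V [_ _ EV]] := inv_shift r_bounds T_hecke iphi bphi Oc.
  rewrite -[RHS]addr0 -(coef_evx_out iota r_bounds (co n x V) out) -coefD.
  congr (coef _ _); apply/funext => t.
  have Oxt : x + varpi ^+ n * teich (- t) \in O by rewrite rpredD ?unifM_int ?teich_int.
  rewrite (evx_tr (co_level n V) Ox) /tr; have := EV _ Oxt.
  by rewrite (E _ (rpredD Oxt Oc)) (E _ Oxt) => /mX_add.
have tr_inv x c d : x \in O -> ~~ in_box d ->
    coef (fun t => tr psi n x (t + c)) d = coef (tr psi n x) d.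
  move=> Ox out; have Oc : varpi ^+ n * teich (- c) \in O by rewrite unifM_int ?teich_int.
  rewrite -(shift _ x d Oc) //; congr (coef _ _); apply/funext => t; rewrite /tr.
  (* The carry sits at rank n+1, where [psi] is periodic. *)
  pose z := (teich (- t) + teich (- c) - teich (- t + - c)) / varpi.
  have Oz : z \in O := carry_subproof (- t) (- c).
  have Otc : x + varpi ^+ n * teich (- (t + c)) \in O by rewrite rpredD ?unifM_int ?teich_int.
  rewrite -(per _ z Otc Oz); congr psi; rewrite exprSr -mulrA /z [varpi * _]mulrC.
  by rewrite divfK ?pf_unif_neq0 // opprD; ring.
have coef0 x d : x \in O -> ~~ in_box d -> (forall l, single F l (r_succ l) != d) ->
    coef (tr psi n x) d = 0.
  move=> Ox out neq; have /forallPn[l] := out; rewrite -ltnNge => lt_l.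
  have m_out : ~~ in_box (single F l (r_succ l)) by rewrite in_box_single -ltnNge /=.
  apply: (coef_transl_inv pp cardk pC (m := single F l (r_succ l))) => [c|j|].
  - exact: tr_inv.
  - by rewrite ffunE; case: eqP => [->|].
  by rewrite eq_sym.
pose A l := coef (tr psi n 0) (single F l (r_succ l)).
have coefA x l : x \in O -> coef (tr psi n x) (single F l (r_succ l)) = A l.
  move=> Ox; rewrite /A -[RHS](shift x) ?rpred0 //; last by rewrite in_box_single -ltnNge /=.
  by congr (coef _ _); apply/funext => t; rewrite /tr add0r addrC.
(* The sign undoes the one in [tr], see [tr_s_exp_out]. *)
pose a l := (-1) ^+ (r l).+1 * A l; pose G x := psi x - \sum_l a l * iota (dig n x) ^+ s_exp l.
have [||V [lV EV _]] := @level_lift p e f F C iota r w r_bounds n G.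
- move=> x b Ox Ob; rewrite /G per //; congr (_ - _); apply: eq_bigr => l _.
  by rewrite dig_add_lt.
- move=> x d Ox out; rewrite (_ : tr G n x = fun t => tr psi n x t - \sum_l a l * tr (fun x => iota (dig n x) ^+ s_exp l) n x t) //.
  rewrite coefB coef_sumf.
  under eq_bigr do rewrite coefZ tr_s_exp_out //.
  have [/existsP[l /eqP Ed]|/existsPn neq] := boolP [exists l, single F l (r_succ l) == d].
    rewrite (@big_only1 _ _ _ _ l) //= => [|l' neq _]; last first.
      case: eqP => [E'|]; last by rewrite !mulr0.
      by have [Ell _] := single_eq (etrans E' (esym Ed)) isT; rewrite Ell eqxx in neq.
    rewrite Ed eqxx mulr1 /a -Ed coefA // mulrAC -exprMn mulrNN mulr1 expr1n mul1r.
    by rewrite subrr.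
  rewrite coef0 // big1 ?subrr // => l _.
  by rewrite (negPf (neq l)) !mulr0.
exists a, V; split=> // x Ox; rewrite EV // /G addrC subrK //.
Qed.

Lemma r_succ_neq0 l : (r l).+1%:R != 0 :> C.
Proof.
rewrite -(dvdn_pcharf pC) gtnNdvd //; exact: (r_ltpS r_bounds).
Qed.

Lemma dig1_teich a : dig 1 (teich a) = 0.
Proof. by rewrite digS /dig /= /dshift pf_teichK subrr mul0r red0. Qed.

(* For f = 1, the y^r component of the inverse image under T of
   (u_c - 1) s_(n+1) is a nonzero multiple of the variation of the digit of
   rank n. *)
Lemma evY_shift n phi psi l0 (a : C) c x : (forall j : 'I_f, j = l0) ->
  (forall x, x \in O -> co n.+1 x phi = (a * iota (dig n x) ^+ s_exp l0) *: mX) ->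
  (forall x, x \in O -> co n.+1 (x + c) phi = co n.+1 x phi + evX (co n x psi) *: mX) ->
  c \in O -> x \in O ->
  evY (co n x psi) = a * ((r l0).+1%:R * (-1) ^+ r l0) * iota (dig n (x + c) - dig n x).
Proof.
move=> only Ephi Epsi Oc Ox.
have l00 : l0 = 0%N :> nat.
  have f0 : (0 < f)%N := leq_ltn_trans (leq0n l0) (ltn_ord l0).
  by rewrite -(only (Ordinal f0)).
rewrite -(coef_evx_digits iota r_bounds) (evx_tr (co_level n psi) Ox).
pose S x := iota (dig n x) ^+ s_exp l0 : C.
have -> : tr (fun y => evX (co n y psi)) n x
    = fun t => a * tr S n (x + c) t + - a * tr S n x t.
  apply/funext => t; rewrite /tr.
  have Oxt : x + varpi ^+ n * teich (- t) \in O by rewrite rpredD ?unifM_int ?teich_int.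
  have := Epsi _ Oxt; rewrite (Ephi _ (rpredD Oxt Oc)) (Ephi _ Oxt) => /mX_add E.
  have gen (y z u : C) : y = z + u -> u = y - z by move=> ->; rewrite addrC addKr.
  by rewrite (gen _ _ _ E) mulNr /S [x + c + _]addrAC.
have Y_single : single F l0 (Ordinal (r_ltp r_bounds l0)) = digits_of (index_y r).
  by apply/ffunP => j; apply: val_inj; rewrite (only j) !ffunE eqxx.
rewrite coefZD coefZ !tr_s_exp ?rpredD //.
have pick z : \sum_(i < p) ('C((r l0).+1, i)%:R * z ^+ ((r l0).+1 - i) * (-1) ^+ i)
     * (single F l0 i == digits_of (index_y r))%:R = (r l0).+1%:R * z * (-1) ^+ r l0 :> C.
  rewrite (@big_only1 _ _ _ _ (Ordinal (r_ltp r_bounds l0))) //= => [|i neq _].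
    by rewrite Y_single eqxx mulr1 binSn subSnn expr1.
  case: eqP => [Ed|]; last by rewrite mulr0.
  have [Ei _] := digits_ofY_single Ed; case/eqP: neq; exact: val_inj.
rewrite !pick l00 expn0 !expr1 rmorphB; ring.
Qed.

Lemma ord_f1_eq : f = 1%N -> forall l0 j : 'I_f, j = l0.
Proof.
by move=> f1 l0 j; apply: val_inj => /=; have := ltn_ord j; have := ltn_ord l0; lia.
Qed.

Lemma evY_mX : f = 1%N -> evY mX = 0.
Proof.
move=> f1; have f0 : (0 < f)%N by rewrite f1.
rewrite ffunE; case: eqP => // /ffunP/(_ (Ordinal f0))/(congr1 val) /=.
by rewrite !ffunE /= => E; have := r_bounds (Ordinal f0); rewrite E.
Qed.

(* For c = pi^n, T psi = (u_c - 1) phi has at level n the y^r coordinate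
   sum_l carry(l, 1), up to a nonzero factor; this is the
   reduction of p / pi, whereas (u_c - 1) phi has no y^r coordinate there. *)
Lemma s_excluded n phi l0 (a : C) : f = 1%N -> e = 1%N -> Inv phi -> below2 n.+3 phi ->
  (forall x, x \in O -> co n.+2 x phi = (a * iota (dig n.+1 x) ^+ s_exp l0) *: mX) -> a = 0.
Proof.
move=> f1 e1 iphi bphi Ephi; have only := ord_f1_eq f1 l0; have e0 : (0 < e)%N by rewrite e1.
pose c := varpi ^+ n * teich 1; have Oc : c \in O by rewrite unifM_int ?teich_int.
have [psi [bpsi Tpsi Epsi]] := inv_shift r_bounds T_hecke iphi bphi Oc.
pose K : C := a * ((r l0).+1%:R * (-1) ^+ r l0).
have EY l : evY (co n.+1 (0 + varpi ^+ n * teich l) psi) = K * iota (carry l 1).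
  have Ol : varpi ^+ n * teich l \in O by rewrite unifM_int ?teich_int.
  rewrite add0r (evY_shift only Ephi Epsi Oc Ol) -/K; congr (_ * iota _).
  rewrite dig_addS ?teich_int // dig1_teich addr0 addrAC subrr add0r.
  have -> : dig n (varpi ^+ n * teich l) = l.
    by rewrite -[varpi ^+ n * _]add0r dig_add ?rpred0 ?teich_int // dig0 add0r pf_teichK.
  by rewrite pf_teichK.
have := co_T r_bounds T_hecke n psi (rpred0 O); rewrite /co_T_at -Tpsi linearB /=.
(* On level n the translation by c is [uact (-1)], which fixes y^r coordinates. *)
rewrite co_act_u ?rpred0 // /c (co_level n phi (rpred0 _) (teich_int _)) pf_teichK.
move/(congr1 (fun u : W => evY u)).
have -> : evY (uact (-1) (co n 0 phi) - co n 0 phi) = 0.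
  rewrite ffunE [X in _ + X]ffunE (uact_ev_y iota); exact: subrr.
have up0 : evY (match n with 0%N => (sgn C w * evY (co 0 0 (act beta psi))) *: mX
    | n'.+1 => up (fun x => co n' x psi) 0 end) = 0.
  by case: (n) => [|n']; rewrite ?/up ffunE evY_mX //; apply: mulr0.
rewrite !ffunE => /esym; rewrite [X in X + _]up0 add0r /down sum_ffunE.
rewrite (eq_bigr (fun l => K * iota (carry l 1))) => [|l _]; last first.
  rewrite ffunE EY uact_ev_y evY_mY; exact: mulr1.
rewrite -big_distrr -rmorph_sum (sum_carry1 F f1 e0) => /eqP.
have pr0 : prime_red F != 0 by rewrite (prime_red_eq0 F e0) e1.
rewrite mulf_eq0 fmorph_eq0 (negPf pr0) orbF /K !mulf_eq0 (negPf (r_succ_neq0 l0)).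
by rewrite signr_eq0 !orbF => /eqP.
Qed.

(* (1 1; 0 1) changes nothing at the vertex beta, where T psi would have a nonzero
   x^r coordinate. *)
Lemma s_excluded0 phi l0 (a : C) : f = 1%N -> Inv phi -> below2 2 phi ->
  (forall x, x \in O -> co 1 x phi = (a * iota (dig 0 x) ^+ s_exp l0) *: mX) -> a = 0.
Proof.
move=> f1 iphi bphi Ephi; have only := ord_f1_eq f1 l0.
have O1 : 1 \in O := rpred1 _; have O0 : 0 \in O := rpred0 _.
have [psi [[bpsi bpsi'] Tpsi Epsi]] := inv_shift r_bounds T_hecke iphi bphi O1.
have EY := evY_shift only Ephi Epsi O1 O0.
rewrite add0r dig0 subr0 /dig /= (red1 (pf_redP F)) rmorph1 mulr1 in EY.
have Pu := u_pro_p O1; have [Iu _ _] := pro_p_red Pu.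
have [m' [Im' Pm' m01 [E _]]] := @act_beta_iwahori _ _ _ F C iota r w _ Iu.
have EB : co 0 0 (act beta (T psi)) = 0.
  rewrite -Tpsi linearB /= E linearB /=; apply/ffunP => i.
  rewrite !ffunE [X in X - _]co_act_eq // dchar_pro_p ?Pm' // invr1.
  (* Conjugation by [beta] makes the upper unipotent lower triangular, and its homography fixes
     0. *)
  rewrite (_ : mob m' 0 = 0); last first.
    rewrite g0_10 in m01; rewrite /mob mulr0 add0r.
    by move/eqP: m01; rewrite mulf_eq0 (negPf (pf_unif_neq0 F)) /= => /eqP ->; rewrite mul0r.
  apply: (etrans (congr1 (fun z => z - _) (mul1r _))); exact: subrr.
have := co_T r_bounds T_hecke 0 (act beta psi) O0; rewrite /co_T_at (T_act T_hecke) EB act_betaK.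
rewrite downE0 //; last by move=> y Oy; apply: bpsi'.
rewrite addr0 => /esym/scale_mX_eq0/eqP; rewrite EY !mulf_eq0 !signr_eq0 (negPf (r_succ_neq0 l0)).
by rewrite /= !orbF => /eqP.
Qed.

End TopLevel.

(** * Spanning, by descent on the level *)

Section Spanning.
Variables (p e f : nat) (F : padicField p e f).
Variables (C : closedFieldType) (iota : {rmorphism pf_residue F -> C}).
Variables (r : 'I_f -> nat) (w : nat).
Hypothesis r_bounds : forall j, (2 < r j < p - 3)%N.
Variable T : {linear ind iota r w -> ind iota r w}.
Hypothesis T_hecke : is_hecke T.
Local Notation v := (@pf_val p e f F).
Local Notation O := (val_ge v 0).
Local Notation W := (weight C r).
Local Notation mX := (monomial C (index_x r)).
Local Notation mXY l := (monomial C (index_xy r l)).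
Local Notation evX u := ((u : W) (index_x r) : C).
Local Notation Ind := (ind iota r w).
Local Notation beta := (gl2_beta F).
Local Notation co := (@co p e f F C iota r w).
Local Notation level_ind := (@level_ind p e f F C iota r w).
Local Notation is_level := (@is_level p e f F C iota r).
Implicit Types (phi psi : Ind) (g h m : GL2 F) (V : F -> W) (x y : F) (u : W) (n N : nat).
Implicit Types (G : F -> C) (d : digits p f).

Local Notation tens := (@tens p e f F C iota r w).
Local Notation at_level := (@at_level p e f F C iota r w).

Local Notation Inv := (inv_mod T).
Local Notation s_exp := (@s_exp p f r).
Local Notation elt_s := (elt_s iota r w).
Local Notation elt_t := (elt_t iota r w).
Local Notation base := (tens 1%g mX : Ind).

(** The index is the level minus one: [0 < n] is the bound of S_2. *)
Definition s_allowed n := (1 < f)%N || (1 < e)%N && (0 < n)%N.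

Lemma at_level_below n N phi V : at_level n phi V -> (n < N)%N -> below N phi.
Proof.
by case=> _ P _ ltnN m x leN Ox; apply: P => //; rewrite neq_ltn (leq_trans ltnN leN) orbT.
Qed.

Lemma at_level_beta n phi V : at_level n phi V -> below 0 (act beta phi).
Proof. by case=> _ _ P m x _ Ox; apply: P. Qed.

Lemma below_leq M N phi : (M <= N)%N -> below M phi -> below N phi.
Proof. by move=> leMN b n x leN; apply: b; apply: leq_trans leN. Qed.

Lemma inv_mod0 : Inv 0.
Proof. by rewrite -(linear0 T); apply: (inv_mod_T T_hecke). Qed.

Lemma inv_mod_s n l : s_allowed n -> Inv (elt_s n.+1 (s_exp l)).
Proof.
move=> ok m Pm; have [Im _ _] := pro_p_red Pm.
have ok' : (1 < f)%N \/ (1 < e)%N /\ (0 < n)%N by case/orP: ok => [|/andP]; [left | right].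
have [psi E] := eig_s r_bounds T_hecke l Im ok'; exists psi.
rewrite E dchar_pro_p // ratio_pro_p // rmorph1 expr1n invr1 mul1r scale1r.
by rewrite addrC addKr.
Qed.

Lemma inv_mod_t n l : (1 < e)%N -> Inv (elt_t n.+1 l).
Proof.
move=> e1 m Pm; have [Im _ _] := pro_p_red Pm.
have [psi E] := eig_t r_bounds T_hecke n l Im e1; exists psi.
rewrite E dchar_pro_p // invr1 scale1r.
by rewrite addrC addKr.
Qed.

Lemma s_excluded_not_allowed n phi l (a : C) : f = 1%N -> (0 < e)%N ->
  ~~ ((1 < e)%N && (0 < n)%N) -> Inv phi -> below2 n.+2 phi ->
  (forall x, x \in O -> co n.+1 x phi = (a * iota (dig n x) ^+ s_exp l) *: mX) -> a = 0.
Proof.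
case: n => [|n] f1 e0 en iphi bphi E; first exact: (s_excluded0 r_bounds T_hecke f1 iphi bphi E).
have e1 : e = 1%N by move: en e0; clear; lia.
exact: (s_excluded r_bounds T_hecke f1 e1 iphi bphi E).
Qed.

Section Span.
(** [P] stands for membership in the span of the family modulo the image of T; the descent only
    needs its closure properties. *)
Variable P : Ind -> Prop.
Hypothesis PZD : forall a phi psi, P phi -> P psi -> P (a *: phi + psi).
Hypothesis PT : forall psi, P (T psi).
Hypothesis P_t : forall n l, (1 < e)%N -> P (elt_t n.+1 l) /\ P (act beta (elt_t n.+1 l)).
Hypothesis P_s : forall n l, s_allowed n ->
  P (elt_s n.+1 (s_exp l)) /\ P (act beta (elt_s n.+1 (s_exp l))).
Hypothesis P_base : P base /\ P (act beta base).
Hypothesis e_gt0 : (0 < e)%N.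

(* The corrections allowed at level n+1 of the first side: they change the other
   side only at level 0. *)
Definition good n th :=
  [/\ P th, P (act beta th), Inv th, below n.+2 th & below 1 (act beta th)].

Lemma goodZD n a th th' : good n th -> good n th' -> good n (a *: th + th').
Proof.
move=> [p1 p2 i b1 b2] [p1' p2' i' b1' b2']; split; rewrite ?linearP.
- exact: PZD.
- exact: PZD.
- exact: inv_modZD.
- exact: belowZD.
exact: belowZD.
Qed.

Lemma good0 n : good n 0.
Proof.
have P0 : P 0 by rewrite -(linear0 T).
have b0 N : below N (0 : Ind) by move=> m x _ _; rewrite linear0.
have E0 : act beta (0 : Ind) = 0 by rewrite linear0.
by split; rewrite ?E0 //; exact: inv_mod0.
Qed.

(** Only the terms with nonzero coefficient need be allowed, since the exclusion lemmas conclude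
    that a coefficient is zero. *)
Lemma good_sum n (a : 'I_f -> C) (th : 'I_f -> Ind) :
  (forall l, a l != 0 -> good n (th l)) -> good n (\sum_l a l *: th l).
Proof.
move=> g; elim/big_ind: _ => [|u u' gu gu'|l _]; first exact: good0.
  by rewrite -[u]scale1r; apply: goodZD.
have [->|a0] := eqVneq (a l) 0; first by rewrite scale0r; exact: good0.
by rewrite -[_ *: _]addr0; apply: goodZD; [exact: g | exact: good0].
Qed.

Lemma good_t n l : (1 < e)%N -> good n (elt_t n.+1 l).
Proof.
move=> e1; have [P1 P2] := P_t n l e1; have a := at_level_t iota w r_bounds n.+1 l.
split=> //; first exact: inv_mod_t.
  exact: (at_level_below a).
exact: below_leq (at_level_beta a).
Qed.

Lemma good_s n l : s_allowed n -> good n (elt_s n.+1 (s_exp l)).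
Proof.
move=> ok; have [P1 P2] := P_s l ok; have a := at_level_s iota w r_bounds n (s_exp l).
split=> //; first exact: inv_mod_s.
  exact: (at_level_below a).
exact: below_leq (at_level_beta a).
Qed.

Lemma good_T n V : is_level n V -> good n (T (level_ind n V)).
Proof.
move=> lV; have a := at_level_ind w lV.
have bT N psi : below N.+1 psi -> below N.+2 (T psi).
  move=> b [//|m] x lem Ox; rewrite (co_TS r_bounds T_hecke) //; last first.
    exact: (below_leq (leqW (ltnW lem)) b).
  by rewrite b // ffunE scale0r.
have bT0 psi : below 0 psi -> below 1 (T psi).
  move=> b [//|m] x lem Ox; rewrite (co_TS r_bounds T_hecke) //; last first.
    exact: below_leq b.
  by rewrite b // ffunE scale0r.
split; rewrite -?(T_act T_hecke).
- exact: PT.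
- exact: PT.
- exact: (inv_mod_T T_hecke).
- by apply: bT; apply: at_level_below a _.
by apply: bT0; apply: at_level_beta a.
Qed.

Lemma half_step n phi : Inv phi -> below2 n.+2 phi ->
  exists2 th, good n th & below n.+1 (phi - th).
Proof.
move=> iphi bphi.
pose chi l := (co n.+1 0 phi (index_xy r l) : C).
pose th1 := \sum_l chi l *: elt_t n.+1 l.
have g1 : good n th1.
  apply: good_sum => l chi0; apply: good_t; rewrite ltn_neqAle e_gt0 andbT.
  apply: contra_neq chi0 => e1; exact: (inv_xy_eq0 r_bounds T_hecke l (esym e1) iphi bphi).
have sub th phi' : good n th -> Inv phi' -> below2 n.+2 phi' ->
    Inv (phi' - th) /\ below2 n.+2 (phi' - th).
  move=> [_ _ i b1 b2] i' b'; rewrite addrC -scaleN1r; split; first exact: inv_modZD.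
  by apply: below2ZD => //; split=> //; apply: below_leq b2.
have [i1 b1] := sub _ _ g1 iphi bphi; set phi1 := phi - th1 in i1 b1.
pose psi x : C := evX (co n.+1 x phi) + \sum_l chi l * iota (dig n.+1 x) ^+ (p ^ l).
have E1 x : x \in O -> co n.+1 x phi1 = psi x *: mX.
  move=> Ox; rewrite /phi1 linearB /= (inv_top r_bounds T_hecke iphi bphi Ox).
  rewrite /th1 linear_sum /= -/(chi _).
  rewrite [X in _ - X](eq_bigr (fun l => chi l *: mXY l - (chi l * iota (dig n.+1 x) ^+ (p ^ l)) *: mX)).
    rewrite big_split /= sumrN opprD addrA addrK.
    by rewrite opprK /psi scalerDl scaler_suml.
  move=> l _; have [E _ _] := at_level_t iota w r_bounds n.+1 l.
  by rewrite linearZ /= E // scalerDr scalerA mulrN scaleNr addrC.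
have [a [V [lV EV]]] := inv_x r_bounds T_hecke i1 b1 E1.
have g2 := good_T lV; have [i2 b2] := sub _ _ g2 i1 b1.
have aV := at_level_ind w lV.
have ET x : x \in O -> co n.+1 x (T (level_ind n V)) = evX (V x) *: mX.
  move=> Ox; rewrite (co_TS r_bounds T_hecke) //; last exact: (at_level_below aV).
  by have [-> ] := aV.
set phi2 := phi1 - _ in i2 b2.
have E2 x : x \in O -> co n.+1 x phi2 = (\sum_l a l * iota (dig n x) ^+ s_exp l) *: mX.
  by move=> Ox; rewrite /phi2 linearB /= E1 // ET // EV // scalerDl addrK.
pose th3 := \sum_l a l *: elt_s n.+1 (s_exp l).
have g3 : good n th3.
  apply: good_sum => l al0; apply: good_s; apply: contraR al0; rewrite negb_or => /andP[f1 en].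
  have f1' : f = 1%N by have := ltn_ord l; move: f1; clear; lia.
  have E3 x : x \in O -> co n.+1 x phi2 = (a l * iota (dig n x) ^+ s_exp l) *: mX.
    move=> Ox; rewrite E2 // (@big_only1 _ _ _ _ l) // => j neq _.
    by rewrite (ord_f1_eq iota f1' l j) eqxx in neq.
  by apply/eqP; apply: (s_excluded_not_allowed f1' e_gt0 en i2 b2 E3).
exists (th1 + (T (level_ind n V) + th3)).
  by rewrite -[th1]scale1r; apply: goodZD => //; rewrite -[T _]scale1r; apply: goodZD.
rewrite !opprD !addrA -/phi1 -/phi2 => m x; rewrite leq_eqVlt => /orP[/eqP <-|lt] Ox.
  rewrite linearB /= E2 // /th3 linear_sum /= scaler_suml; apply/eqP; rewrite subr_eq0; apply/eqP.
  apply: eq_bigr => l _; have [E _ _] := at_level_s iota w r_bounds n (s_exp l).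
  by rewrite linearZ /= E // scalerA.
have [b _] := b2; have [_ _ _ b' _] := g3.
by rewrite linearB /= b // b' // subrr.
Qed.

(** Here [T_below2] forces the preimage of (g - 1) phi to be 0, so [phi] is truly invariant; a
    vector at a root that is fixed by unipotents is a multiple of x^r. *)
Lemma span_base phi : Inv phi -> below2 1 phi -> P phi.
Proof.
move=> iphi bphi; have fixed m : m \in @pro_p_iwahori p e f F -> act (m^-1)%g phi = phi.
  move=> Pm; have [psi Epsi] := iphi m Pm; have [Im _ _] := pro_p_red Pm.
  suff psi0 : psi = 0 by apply/eqP; rewrite -subr_eq0 Epsi psi0 linear0.
  apply: below2_0; apply: (T_below2 r_bounds T_hecke); rewrite -Epsi addrC -scaleN1r.
  by apply: below2ZD => //; apply: below2_act.
have level0 th : (forall m, m \in @pro_p_iwahori p e f F -> act (m^-1)%g th = th) ->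
    forall x, x \in O -> co 0 x th = evX (co 0 0 th) *: mX.
  move=> fix_th x Ox; have O0 : 0 \in O := rpred0 _.
  have per y : y \in O -> co 0 y th = co 0 0 th.
    by move=> Oy; rewrite -[y]add0r -co_act_u // fix_th //; apply: u_pro_p.
  rewrite per //; apply: (evx_inj (iota := iota) r_bounds) => t.
  rewrite (evx_tr (co_level 0 th) O0) /tr per ?rpredD ?unifM_int ?teich_int //.
  rewrite /evx linearZ /= (uact_x iota w r_bounds) !ffunE eqxx.
  exact: esym (mulr1 _).
have fixed' m : m \in @pro_p_iwahori p e f F -> act (m^-1)%g (act beta phi) = act beta phi.
  move=> Pm; have [Im _ _] := pro_p_red Pm.
  have [m' [_ Pm' _ [_ ->]]] := @act_beta_iwahori _ _ _ F C iota r w _ Im.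
  by rewrite fixed // Pm'.
have [P0 P1] := P_base; have [B1 B2 B3] := at_level_base iota w r_bounds.
set c := evX (co 0 0 phi); set c' := evX (co 0 0 (act beta phi)).
pose D := phi - (c *: base + c' *: act beta base).
have lin n x (u u1 u2 : Ind) (a b : C) : co n x (u - (a *: u1 + b *: u2))
    = co n x u - (a *: co n x u1 + b *: co n x u2) by rewrite linearB linearP linearZ.
have betaD (u b : Ind) : act beta (u - (c *: b + c' *: act beta b))
    = act beta u - (c' *: b + c *: act beta b).
  by rewrite [LHS]linearB linearP linearZ /= act_betaK [X in _ = _ - X]addrC.
have [b b'] := bphi.
have D0 : D = 0.
  apply: coords_inj => n x Ox; rewrite ?betaD lin B3 // scaler0 addr0.
    case: n => [|n]; first by rewrite level0 // B1 // subrr.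
    by rewrite b // B2 // scaler0 subrr.
  case: n => [|n]; first by rewrite level0 // B1 // subrr.
  by rewrite b' // B2 // scaler0 subrr.
have -> : phi = c *: base + (c' *: act beta base + T 0).
  by rewrite linear0 addr0; apply/eqP; rewrite -subr_eq0; apply/eqP.
by apply: PZD => //; apply: PZD.
Qed.

(** The two sides are lowered in turn. Correcting the second one disturbs the first only at level 0,
    so the gain on the first is not lost. *)
Lemma span_inv phi : Inv phi -> P phi.
Proof.
move=> iphi; have [N bN] := below2_exists phi.
have {bN} : below2 N.+1 phi by apply: below2_leq bN.
elim: N phi iphi => [|n IH] phi iphi bphi; first exact: span_base.
have sub th th' : good n th -> Inv th' -> below2 n.+2 th' ->
    Inv (th' - th) /\ below2 n.+2 (th' - th).
  move=> [_ _ i b1 b2] i' b'; rewrite addrC -scaleN1r; split; first exact: inv_modZD.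
  by apply: below2ZD => //; split=> //; apply: below_leq b2.
have [th g1 b1] := half_step iphi bphi.
have [i1 bb1] := sub _ _ g1 iphi bphi.
have [th' g2 b2] := half_step (inv_mod_beta T_hecke i1) (below2_beta bb1).
have [i2 bb2] := sub _ _ g2 (inv_mod_beta T_hecke i1) (below2_beta bb1).
have [p1 _ _ _ _] := g1; have [_ p2 _ _ b2'] := g2.
pose phi2 := phi - th - act beta th'.
have Ebeta : act beta phi2 = act beta (phi - th) - th' by rewrite linearB /= act_betaK.
have Pphi2 : P phi2.
  apply: IH; first by rewrite -[phi2]act_betaK Ebeta; apply: (inv_mod_beta T_hecke).
  split; last by rewrite Ebeta.
  rewrite /phi2 addrC -scaleN1r; apply: belowZD => //.
  exact: below_leq b2'.
have -> : phi = 1 *: phi2 + (1 *: act beta th' + th).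
  by rewrite !scale1r addrA subrK subrK.
by do 2!apply: PZD => //.
Qed.
End Span.

End Spanning.

(** * Independence and conclusion *)

Section Family.
Variables (p e f : nat) (F : padicField p e f).
Variables (C : closedFieldType) (iota : {rmorphism pf_residue F -> C}).
Variables (r : 'I_f -> nat) (w : nat).
Hypothesis r_bounds : forall j, (2 < r j < p - 3)%N.
Variable T : {linear ind iota r w -> ind iota r w}.
Hypothesis T_hecke : is_hecke T.
Local Notation v := (@pf_val p e f F).
Local Notation O := (val_ge v 0).
Local Notation teich := (@pf_teich p e f F).
Local Notation varpi := (pf_unif F).
Local Notation k := (pf_residue F).
Local Notation W := (weight C r).
Local Notation mX := (monomial C (index_x r)).
Local Notation evX u := ((u : W) (index_x r) : C).
Local Notation Ind := (ind iota r w).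
Local Notation beta := (gl2_beta F).
Local Notation co := (@co p e f F C iota r w).
Local Notation coef := (@coef p f k C iota).
Local Notation in_box := (@in_box p f r).
Implicit Types (phi psi : Ind) (g h m : GL2 F) (V : F -> W) (x y : F) (u : W) (n N : nat).
Implicit Types (G : F -> C) (d : digits p f).

Local Notation tens := (@tens p e f F C iota r w).
Local Notation at_level := (@at_level p e f F C iota r w).
Let pp := pf_prime F.

Local Notation s_exp := (@s_exp p f r).
Local Notation elt_s := (elt_s iota r w).
Local Notation elt_t := (elt_t iota r w).
Local Notation base := (tens 1%g mX : Ind).
Local Notation r_succ := (r_succ r_bounds).

Implicit Types (o : option (nat * bool * 'I_f)) (b : bool).

(* The boolean is true for a t, false for an s; the integer is the level minus
   one. In [fam], a second boolean tells the side of the tree. *)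
Definition fam0 o : Ind := match o with
  | None => base
  | Some (n, true, l) => elt_t n.+1 l
  | Some (n, false, l) => elt_s n.+1 (s_exp l)
  end.
Definition lev o : nat := if o is Some (n, _, _) then n.+1 else 0.
Definition act_side b phi := if b then act beta phi else phi.
Definition fam (j : bool * option (nat * bool * 'I_f)) : Ind := act_side j.1 (fam0 j.2).

Lemma fam0_at_level o : exists V, at_level (lev o) (fam0 o) V.
Proof.
case: o => [[[n []] l]|] /=; eexists; [exact: at_level_t | exact: at_level_s | exact: at_level_base].
Qed.

(* With [fam0_s], coordinates dual to the t's and to the s's of level n+1. *)
Lemma fam0_xy n l o : (co n.+1 0 (fam0 o) (index_xy r l) : C) = (o == Some (n, true, l))%:R.
Proof.
have [V [_ E _]] := fam0_at_level o.
have [levE|neq] := eqVneq n.+1 (lev o); last first.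
  rewrite E ?rpred0 // ffunE; case: eqP => // Eo; by rewrite Eo /= eqxx in neq.
case: o levE {V E} => [[[_ []] l']|//] /= [<-].
  have [E _ _] := at_level_t iota w r_bounds n.+1 l'; rewrite E ?rpred0 //.
  rewrite !ffunE (negPf (index_xy_neq r_bounds l)).
  have -> : (index_xy r l == index_xy r l') = (l == l').
    apply/eqP/eqP => [/ffunP/(_ l)/(congr1 val)|-> //]; rewrite /= !(index_xyE r_bounds) eqxx.
    by case: eqP.
  rewrite (_ : (_ == _ :> option _) = (l == l')); first by rewrite /GRing.scale /= mulr0 add0r.
  by apply/eqP/eqP => [[->]|->].
have [E _ _] := at_level_s iota w r_bounds n (s_exp l'); rewrite E ?rpred0 //.
rewrite !ffunE (negPf (index_xy_neq r_bounds l)).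
rewrite (_ : (_ == _ :> option _) = false); first exact: mulr0.
by apply/eqP.
Qed.

Lemma fam0_s n l o : coef (tr (fun x => evX (co n.+1 x (fam0 o))) n 0) (single F l (r_succ l))
  = (-1) ^+ (r l).+1 * (o == Some (n, false, l))%:R.
Proof.
have out : ~~ in_box (single F l (r_succ l)) by rewrite in_box_single -ltnNge /=.
have Ot (t : k) : 0 + varpi ^+ n * teich (- t) \in O.
  by rewrite rpredD ?rpred0 ?unifM_int ?teich_int.
have [V [_ E _]] := fam0_at_level o.
have [levE|neq] := eqVneq n.+1 (lev o); last first.
  rewrite (_ : tr _ n 0 = fun=> 0); last by apply/funext => t; rewrite /tr E // ffunE.
  rewrite coef0f; case: eqP => [Eo|]; last by rewrite mulr0.
  by rewrite Eo /= eqxx in neq.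
case: o levE {V E} => [[[_ []] l']|//] /= [<-].
  have [E _ _] := at_level_t iota w r_bounds n.+1 l'.
  rewrite (_ : tr _ n 0 = fun=> 0).
    rewrite coef0f (_ : (_ == _ :> option _) = false) ?mulr0 //; exact/eqP.
  (* At the points pi^n [-t] the digit of rank n+1 is 0, so t_(n+1) has no x^r component there. *)
  apply/funext => t; rewrite /tr E // dig_addS ?rpred0 ?teich_int // dig1_teich !dig0.
  rewrite !add0r /carry teich0 !add0r subrr mul0r red0 rmorph0 expr0n !ffunE eqxx.
  rewrite [_ == index_xy r l']eq_sym (negPf (index_xy_neq r_bounds l')).
  rewrite expn_eq0 eqn0Ngt (prime_gt0 pp) oppr0 /GRing.scale /= mul0r; exact: addr0.
have [E _ _] := at_level_s iota w r_bounds n (s_exp l').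
rewrite (_ : tr _ n 0 = tr (fun x => iota (dig n x) ^+ s_exp l') n 0); last first.
  apply/funext => t; rewrite /tr E // !ffunE eqxx; exact: mulr1.
rewrite tr_s_exp_out ?rpred0 //.
have [<-|neq] := eqVneq l' l; first by rewrite !eqxx.
rewrite (_ : (_ == _ :> option _) = false) ?mulr0; last by apply/eqP => -[/eqP]; apply/negP.
case: eqP => [/single_eq[//|/eqP]|]; last by rewrite mulr0.
by rewrite (negPf neq).
Qed.

Lemma act_side_T b psi : act_side b (T psi) = T (act_side b psi).
Proof. by case: b; rewrite //= (T_act T_hecke). Qed.

Lemma co_fam n x b (j : bool * option (nat * bool * 'I_f)) : x \in O ->
  co n x (act_side b (fam j)) = (j.1 == b)%:R *: co n x (fam0 j.2).
Proof.
case: j => b' o Ox; have [V [_ _ E]] := fam0_at_level o.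
by case: b b' => [] []; rewrite /fam /= ?act_betaK ?scale1r ?scale0r ?E.
Qed.

Lemma co_fam_sum n x b s (c : bool * option (nat * bool * 'I_f) -> C) : x \in O ->
  co n x (act_side b (\sum_(j <- s) c j *: fam j))
  = \sum_(j <- s) (c j * (j.1 == b)%:R) *: co n x (fam0 j.2).
Proof.
move=> Ox.
have -> : act_side b (\sum_(j <- s) c j *: fam j) = \sum_(j <- s) c j *: act_side b (fam j).
  by case: b => //=; rewrite linear_sum /=; apply: eq_bigr => j _; rewrite linearZ.
by rewrite linear_sum /=; apply: eq_bigr => j _; rewrite linearZ /= co_fam // scalerA.
Qed.

Lemma pick_coeff b o (s : seq (bool * option (nat * bool * 'I_f)))
    (c : bool * option (nat * bool * 'I_f) -> C) : uniq s ->
  (b, o) \in s ->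
  \sum_(j <- s) c j * (j.1 == b)%:R * (j.2 == o)%:R = c (b, o).
Proof.
move=> us so; rewrite (bigD1_seq _ so us) /= !eqxx !mulr1 big1 ?addr0 // => -[b' o'] /= neq.
case: eqP => [Eb|]; last by rewrite mulr0 mul0r.
case: eqP => [Eo|]; last by rewrite mulr0.
by rewrite Eb Eo eqxx in neq.
Qed.

Section Independence.
Variables (s : seq (bool * option (nat * bool * 'I_f))).
Variable c : bool * option (nat * bool * 'I_f) -> C.
Hypothesis s_uniq : uniq s.
Variable psi : Ind.
Hypothesis relation : \sum_(j <- s) c j *: fam j = T psi.

(** At its top level [T psi] has no component on x_l^(r_l - 1) y_l, and its x^r component is a
    function from sigma, without exponent outside the box: this kills the coefficients of the t's
    and of the s's. The left side then vanishes at level n+1, and with it [psi] at level n. *)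
Lemma indep_step b n : below n.+1 (act_side b psi) ->
  (forall o, lev o = n.+1 -> (b, o) \in s -> c (b, o) = 0) /\ below n (act_side b psi).
Proof.
move=> bpsi.
have E x : x \in O -> \sum_(j <- s) (c j * (j.1 == b)%:R) *: co n.+1 x (fam0 j.2)
    = evX (co n x (act_side b psi)) *: mX.
  move=> Ox; rewrite -co_fam_sum // relation act_side_T (co_TS r_bounds T_hecke) //.
  exact: below_leq bpsi.
have c0 o : lev o = n.+1 -> (b, o) \in s -> c (b, o) = 0.
  case: o => [[[_ []] l]|//] /= [->] so.
    have := congr1 (fun u : W => (u (index_xy r l) : C)) (E 0 (rpred0 _)).
    rewrite /= sum_ffunE; under eq_bigr do rewrite ffunE /GRing.scale /= fam0_xy.
    rewrite !ffunE (negPf (index_xy_neq r_bounds l)) pick_coeff // => ->.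
    exact: mulr0.
  have out : ~~ in_box (single F l (r_succ l)) by rewrite in_box_single -ltnNge /=.
  have Etr : evx iota (co n 0 (act_side b psi)) = fun t => \sum_(j <- s)
      (c j * (j.1 == b)%:R) * tr (fun x => evX (co n.+1 x (fam0 j.2))) n 0 t.
    apply/funext => t; rewrite (evx_tr (co_level n _) (rpred0 _)) /tr.
    have Ot : 0 + varpi ^+ n * teich (- t) \in O by rewrite rpredD ?rpred0 ?unifM_int ?teich_int.
    have := congr1 (fun u : W => (u (index_x r) : C)) (E _ Ot).
    rewrite /= sum_ffunE !ffunE eqxx => /esym; rewrite [X in X = _](mulr1 _) => ->.
    by apply: eq_bigr => j _; rewrite ffunE.
  have := coef_evx_out iota r_bounds (co n 0 (act_side b psi)) out.
  rewrite Etr coef_sumf; under eq_bigr do rewrite coefZ fam0_s mulrCA.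
  rewrite -big_distrr /= pick_coeff // => /eqP.
  by rewrite mulf_eq0 signr_eq0 => /eqP.
split=> // m x; rewrite leq_eqVlt => /orP[/eqP <-|]; last exact: bpsi.
move: x; apply: (evX_co_inj r_bounds) => x Ox; apply: (@scale_mX_eq0 f C r).
rewrite -E // big_seq big1 // => -[b' o] so /=.
have [Eb|_] := eqVneq b' b; last by rewrite mulr0 scale0r.
have [levE|neq] := eqVneq n.+1 (lev o); last first.
  by have [V [_ -> //]] := fam0_at_level o; rewrite scaler0.
by rewrite Eb in so *; rewrite c0 // mul0r scale0r.
Qed.
Lemma indep_psi : psi = 0.
Proof.
have [N] := below2_exists psi; elim: N => [|N IH]; first exact: below2_0.
case=> b b'; apply: IH; split; first by have [] := @indep_step false N b.
by have [] := @indep_step true N b'.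
Qed.

(** Now that [psi] is 0, [indep_step] applies at every level; the root is read off directly. *)
Lemma indep j : j \in s -> c j = 0.
Proof.
case: j => b o so; have psi0 := indep_psi.
have b0 N : below N (act_side b psi).
  move=> m x _ _; rewrite psi0; case: (b) => /=; by rewrite !linear0.
have := @indep_step b _ (b0 _); case: o so => [[[n t] l]|] so.
  by case/(_ n) => c0 _; apply: c0.
move=> _; have := @co_fam_sum 0 0 b s c (rpred0 _).
rewrite relation psi0 linear0.
rewrite (_ : co 0 0 (act_side b 0) = 0); last by case: (b) => /=; rewrite !linear0.
move/(congr1 (fun u : W => (u (index_x r) : C))); rewrite /= sum_ffunE ffunE => /esym.
rewrite (eq_bigr (fun j => c j * (j.1 == b)%:R * (j.2 == None)%:R)) ?pick_coeff //.
case=> b' o' _ /=; rewrite ffunE.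
have [V [_ E _]] := fam0_at_level o'.
case: o' E => [[[n t] l]|] E; first by rewrite E ?rpred0 // ffunE.
have [E0 _ _] := at_level_base iota w r_bounds; rewrite E0 ?rpred0 //.
by rewrite ffunE eqxx.
Qed.
End Independence.

End Family.

Local Open Scope classical_set_scope.
Local Open Scope ring_scope.

(** * Passage to the cokernel and the four cases *)

Section Eigenbasis.
Variables (p e f : nat) (F : padicField p e f).
Variables (C : closedFieldType) (iota : {rmorphism pf_residue F -> C}).
Variables (r : 'I_f -> nat) (w : nat).
Hypothesis r_bounds : forall j, (2 < r j < p - 3)%N.
Variable T : {linear ind iota r w -> ind iota r w}.
Hypothesis T_hecke : is_hecke T.
Local Notation W := (weight C r).
Local Notation mY := (monomial C (index_y r)).
Local Notation Ind := (ind iota r w).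
Local Notation beta := (gl2_beta F).
Implicit Types (phi psi : Ind) (g h m : GL2 F) (V : F -> W) (x y : F) (u : W) (n N : nat).
Implicit Types (G : F -> C) (d : digits p f).

Local Notation tens := (@tens p e f F C iota r w).

Local Notation Inv := (inv_mod T).
Local Notation s_exp := (@s_exp p f r).
Local Notation elt_s := (elt_s iota r w).
Local Notation elt_t := (elt_t iota r w).
Local Notation fam := (@fam p e f F C iota r w).
Local Notation fam0 := (@fam0 p e f F C iota r w).
Local Notation act_side := (@act_side p e f F C iota r w).
Local Notation J := (bool * option (nat * bool * 'I_f))%type.
Local Notation pi := (coker_pi T).
Implicit Types (j : J) (b : bool) (q : coker T).

Lemma coker_pi0 : pi 0 = 0.
Proof.
have := coker_piZ T 0 0; rewrite scale0r => ->.
exact: (scale0r (pi 0)).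
Qed.

Lemma coker_pi_eq0 phi : pi phi = 0 -> exists psi, phi = T psi.
Proof.
by rewrite -coker_pi0 => /eqP; rewrite coker_piE subr0 => /asboolP.
Qed.

Lemma coker_pi_T psi : pi (T psi) = 0.
Proof.
by rewrite -coker_pi0; apply/eqP; rewrite coker_piE subr0; apply/asboolP; exists psi.
Qed.

Lemma coker_pi_ZD a phi psi : pi (a *: phi + psi) = a *: pi phi + pi psi.
Proof. by rewrite coker_piD coker_piZ. Qed.

Lemma coker_pi_sum (I : Type) (s : seq I) (c : I -> C) (g : I -> Ind) :
  pi (\sum_(i <- s) c i *: g i) = \sum_(i <- s) c i *: pi (g i).
Proof.
elim: s => [|i s IH]; first by rewrite !big_nil coker_pi0.
by rewrite !big_cons coker_pi_ZD IH.
Qed.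

Definition in_family j : bool := match j.2 with
  | None => true
  | Some (_, true, _) => (1 < e)%N
  | Some (n, false, _) => s_allowed e f n
  end.

(** The basis has alpha (x) y^r where [fam] has beta (x) x^r; by [tens_alpha_y] they differ by this
    sign. *)
Definition scal j : C := if j is (true, None) then sgn C w else 1.
Definition elt j : Ind := if j is (true, None) then tens (gl2_alpha F) mY else fam j.

Lemma scal_neq0 j : scal j != 0.
Proof. by case: j => [[] [o|]] /=; rewrite ?oner_eq0 ?signr_eq0. Qed.

Lemma eltE j : elt j = scal j *: fam j.
Proof.
case: j => [[] [o|]] /=; rewrite ?scale1r // tens_alpha_y.
by rewrite !linearZ.
Qed.

Lemma indep_coker (s : seq J) (c : J -> C) : uniq s ->
  \sum_(j <- s) c j *: pi (elt j) = 0 -> forall j, j \in s -> c j = 0.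
Proof.
move=> us E j js.
have [psi Epsi] : exists psi, \sum_(j <- s) (c j * scal j) *: fam j = T psi.
  apply: coker_pi_eq0; rewrite coker_pi_sum -[RHS]E; apply: eq_bigr => i _.
  by rewrite eltE coker_piZ -scalerA.
have /eqP := indep r_bounds T_hecke us Epsi js.
by rewrite mulf_eq0 (negPf (scal_neq0 j)) orbF => /eqP.
Qed.

Lemma pi_elt_neq0 j : pi (elt j) != 0.
Proof.
apply/eqP => E; have /= := @indep_coker [:: j] (fun=> 1) isT.
rewrite big_seq1 scale1r => /(_ E j (mem_head _ _))/eqP; by rewrite oner_eq0.
Qed.

Lemma pi_elt_inj : injective (pi \o elt).
Proof.
move=> j j' /= E; apply/eqP/negPn/negP => neq.
have us : uniq [:: j; j'] by rewrite /= inE neq.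
have /= := @indep_coker _ (fun i => if i == j then 1 else -1) us.
rewrite big_cons big_seq1 eqxx eq_sym (negPf neq) E scaleN1r scale1r subrr.
move=> /(_ erefl j (mem_head _ _)); rewrite eqxx => /eqP; by rewrite oner_eq0.
Qed.

Lemma inv_fam j : in_family j -> Inv (fam j).
Proof.
have inv0 o : in_family (false, o) -> Inv (fam0 o).
  case: o => [[[n []] l]|] /= H; [exact: inv_mod_t | exact: inv_mod_s |].
  move=> m Pm; have [Im _ _] := pro_p_red Pm; exists 0.
  by rewrite linear0 (eig_base iota w r_bounds Im) dchar_pro_p // invr1 scale1r subrr.
case: j => [[] o] /inv0 i; last exact: i.
exact: (inv_mod_beta T_hecke i).
Qed.

Lemma eig_fam j m : in_family j -> m \in @iwahori p e f F ->
  exists a psi, act (m^-1)%g (fam j) = a *: fam j + T psi.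
Proof.
have eig0 o m' : in_family (false, o) -> m' \in @iwahori p e f F ->
    exists a psi, act (m'^-1)%g (fam0 o) = a *: fam0 o + T psi.
  case: o => [[[n []] l]|] /= H Im'.
  - by have [psi ->] := eig_t r_bounds T_hecke n l Im' H; do 2!eexists.
  - have ok' : (1 < f)%N \/ (1 < e)%N /\ (0 < n)%N by case/orP: H => [|/andP]; [left | right].
    by have [psi ->] := eig_s r_bounds T_hecke l Im' ok'; do 2!eexists.
  - by rewrite (eig_base iota w r_bounds Im'); eexists; exists 0; rewrite linear0 addr0.
case: j => [[] o] H Im; last exact: eig0.
have [m' [Im' _ _ [_ E]]] := @act_beta_iwahori _ _ _ F C iota r w m Im.
have [a [psi E']] := eig0 o m' H Im'; exists a, (act beta psi).
by rewrite /fam /= E E' linearP /= (T_act T_hecke).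
Qed.

(** Indices may repeat in [s], so that sums are concatenations; repetitions are removed in
    [family_eigenbasis]. *)
Definition in_span phi := exists2 s : seq (C * J), all (fun z => in_family z.2) s
  & pi phi = \sum_(z <- s) z.1 *: pi (elt z.2).

Lemma in_spanZD a phi psi : in_span phi -> in_span psi -> in_span (a *: phi + psi).
Proof.
move=> [s1 ok1 E1] [s2 ok2 E2]; exists ([seq (a * z.1, z.2) | z <- s1] ++ s2).
  by rewrite all_cat all_map ok2 andbT; apply: sub_all ok1.
rewrite coker_pi_ZD big_cat big_map /= E1 E2 scaler_sumr; congr (_ + _).
by apply: eq_bigr => x _; rewrite scalerA.
Qed.

Lemma in_span_T psi : in_span (T psi).
Proof. by exists [::]; rewrite ?big_nil ?coker_pi_T. Qed.

Lemma in_span_fam j : in_family j -> in_span (fam j).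
Proof.
move=> okj; exists [:: ((scal j)^-1, j)]; first by rewrite /= okj.
by rewrite big_seq1 /= eltE coker_piZ scalerA mulVf ?scal_neq0 // scale1r.
Qed.

Lemma in_span_inv phi : (0 < e)%N -> Inv phi -> in_span phi.
Proof.
move=> e0; apply: (span_inv r_bounds T_hecke in_spanZD in_span_T) => //.
- by move=> n l e1; split; [apply: (@in_span_fam (false, Some (n, true, l)))
    | apply: (@in_span_fam (true, Some (n, true, l)))].
- by move=> n l okn; split; [apply: (@in_span_fam (false, Some (n, false, l)))
    | apply: (@in_span_fam (true, Some (n, false, l)))].
by split; [apply: (@in_span_fam (false, None)) | apply: (@in_span_fam (true, None))].
Qed.

Lemma pro_p_invE q : pro_p_invariants q <-> Inv (coker_repr q).
Proof.
split=> [inv_q m /pro_p_inv Pm|i g Pg].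
  have := inv_q _ Pm; rewrite -[q]coker_reprK (coker_act_pi T_hecke).
  move/eqP; rewrite coker_piE coker_reprK => /asboolP[psi E]; exists psi.
  exact: E.
rewrite -[q]coker_reprK (coker_act_pi T_hecke); apply/eqP; rewrite coker_piE.
apply/asboolP; have [psi E] := i _ (pro_p_inv Pg); exists psi.
by rewrite -E invgK.
Qed.

Definition family : set Ind := [set elt j | j in [set j | in_family j]].

Lemma family_eigenbasis : (0 < e)%N -> images_form_eigenbasis T family.
Proof.
move=> e0; split.
- move=> phi psi; rewrite !inE => -[j _ <-] [j' _ <-] E.
  by rewrite (pi_elt_inj E).
- split.
  + move=> _ [_ [j okj <-] <-] g Pg; rewrite (coker_act_pi T_hecke).
    apply/eqP; rewrite coker_piE; apply/asboolP.
    have [psi E] := inv_fam okj (pro_p_inv Pg); exists (scal j *: psi).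
    by rewrite eltE linearZ /= -scalerBr linearZ -E invgK.
  + move=> s c us sub Es.
    (* Each vector of the relation is traced back to an index, since independence is known for
       indexed families. *)
    have /choice[h hE] : forall b : coker T, exists j, b \in s -> pi (elt j) = b.
      move=> b; have [/sub[_ [j _ <-] <-]|_] := boolP (b \in s); first by exists j.
      by exists (false, None).
    have us' : uniq (map h s).
      rewrite map_inj_in_uniq // => b b' sb sb' Eh.
      by rewrite -(hE b sb) -(hE b' sb') Eh.
    have E' : \sum_(j <- map h s) c (pi (elt j)) *: pi (elt j) = 0.
      by rewrite big_map -[RHS]Es; apply: eq_big_seq => b sb; rewrite hE.
    move=> b sb; have := indep_coker us' E' (map_f h sb).
    by rewrite hE.
  move=> q /pro_p_invE /(in_span_inv e0)[s oks Es].
  pose h (x : C * J) := pi (elt x.2).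
  (* Terms with the same image are gathered, their coefficients being added. *)
  exists (undup (map h s)), (fun q' => \sum_(z <- s | h z == q') z.1).
  split; first exact: undup_uniq.
    move=> b /=; rewrite mem_undup => /mapP[x sx ->]; exists (elt x.2) => //.
    by exists x.2 => //=; apply: (allP oks).
  rewrite -[LHS]coker_reprK Es.
  under [RHS]eq_bigr do rewrite scaler_suml.
  rewrite [RHS](exchange_big_dep predT) //=; apply: eq_big_seq => x sx.
  rewrite (big_rem (h x)) /= ?mem_undup ?map_f // eqxx big_seq_cond big1 ?addr0 // => b.
  rewrite (rem_filter _ (undup_uniq _)) mem_filter /= => /andP[/andP[neq _]].
  by rewrite eq_sym (negPf neq).
move=> _ [j okj <-]; split; first exact: pi_elt_neq0.
move=> g Ig; have [a [psi E]] := eig_fam okj (iwahori_inv Ig); exists a.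
rewrite (coker_act_pi T_hecke) -[RHS](coker_piZ T); apply/eqP; rewrite coker_piE; apply/asboolP.
exists (scal j *: psi); move: E; rewrite invgK eltE !linearZ /= => ->.
by rewrite !scalerN scalerDr !scalerA mulrC addrAC subrr add0r.
Qed.

Lemma set_SE n0 (x : Ind) : set_S n0 x <->
  exists b n l, (n0 <= n)%N /\ x = act_side b (elt_s n (s_exp l)).
Proof.
split=> [[l _ [] [n le_n <-]]|[[] [n [l [le_n ->]]]]].
- by exists false, n, l.
- by exists true, n, l.
- by exists l => //; right; exists n.
by exists l => //; left; exists n.
Qed.

Lemma set_TE n0 (x : Ind) : set_T n0 x <->
  exists b n l, (n0 <= n)%N /\ x = act_side b (elt_t n l).
Proof.
split=> [[l _ [] [n le_n <-]]|[[] [n [l [le_n ->]]]]].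
- by exists false, n, l.
- by exists true, n, l.
- by exists l => //; right; exists n.
by exists l => //; left; exists n.
Qed.

Lemma set_baseE (x : Ind) : set_base x <-> exists b, x = elt (b, None).
Proof.
split=> [[->|->]|[[] ->]]; [by exists false | by exists true | by right | by left].
Qed.

Lemma familyE (x : Ind) : family x <->
  [\/ set_base x,
      exists b n l, s_allowed e f n /\ x = act_side b (elt_s n.+1 (s_exp l)) |
      exists b n l, (1 < e)%N /\ x = act_side b (elt_t n.+1 l)].
Proof.
split=> [[[b [[[n []] l]|]] /= okj <-]|].
- by apply: Or33; exists b, n, l; case: (b).
- by apply: Or32; exists b, n, l; case: (b).
- by apply/Or31/set_baseE; exists b.
case=> [/set_baseE[b ->]|[b [n [l [okn ->]]]]|[b [n [l [e1 ->]]]]].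
- by exists (b, None).
- by exists (b, Some (n, false, l)) => //; case: b.
by exists (b, Some (n, true, l)) => //; case: b.
Qed.

End Eigenbasis.

Theorem theorem3p9 (p e f : nat) (p_prime : prime p) (p_odd : odd p)
    (F : padicField p e f)
    (* C is an algebraic closure of F_p, with an embedding of F_q *)
    (C : closedFieldType) (j : {rmorphism 'F_p -> C})
    (C_alg : forall x : C, algebraicOver j x)
    (iota : {rmorphism pf_residue F -> C})
    (r : 'I_f -> nat) (r_bounds : forall l, (2 < r l < p - 3)%N)
    (w : nat) (w_bound : (w <= p ^ f - 2)%N)
    (T : {linear ind iota r w -> ind iota r w}) (T_hecke : is_hecke T) :
  [/\ e = 1%N -> f = 1%N ->
        images_form_eigenbasis T set_base,
      (1 < e)%N -> f = 1%N ->
        images_form_eigenbasis T (set_S 2 `|` set_base `|` set_T 1),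
      e = 1%N -> (1 < f)%N ->
        images_form_eigenbasis T (set_S 1 `|` set_base) &
      (1 < e)%N -> (1 < f)%N ->
        images_form_eigenbasis T (set_S 1 `|` set_base `|` set_T 1)].
Proof.
have one_ok n : e = 1%N -> s_allowed e f n = (1 < f)%N by rewrite /s_allowed => ->; rewrite orbF.
(* The four sets are all [family]; e and f only decide which s and t it contains. *)
have basis (B : set (ind iota r w)) : (0 < e)%N -> (forall x, B x <-> family x) ->
    images_form_eigenbasis T B.
  move=> e0 EB; rewrite (_ : B = @family p e f F C iota r w); first exact: family_eigenbasis.
  by apply/funext => x; apply/propext.
split=> he hf; apply: basis => [|x]; rewrite ?he ?(ltnW he) // familyE ?set_SE.
- split=> [|[//|[b [n [l [+ _]]]]|[b [n [l [+ _]]]]]]; first exact: Or31.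
    by rewrite one_ok // => f1; rewrite hf in f1.
  by move=> e1; rewrite he in e1.
- split=> [[[/set_SE[b [[|n] [l [// n0 ->]]]]|]|/set_TE[b [[|n] [l [// _ ->]]]]]
          |[|[b [n [l [+ ->]]]]|[b [n [l [_ ->]]]]]].
  + by apply: Or32; exists b, n, l; rewrite /s_allowed he (n0 : (0 < n)%N) orbT.
  + exact: Or31.
  + by apply: Or33; exists b, n, l.
  + by left; right.
  + case/orP=> [f1|/andP[_ n0]]; first by rewrite hf in f1.
    by left; left; apply/set_SE; exists b, n.+1, l.
  by right; apply/set_TE; exists b, n.+1, l.
- split=> [[/set_SE[b [[|n] [l [// n0 ->]]]]|]|[|[b [n [l [+ ->]]]]|[b [n [l [+ _]]]]]].
  + by apply: Or32; exists b, n, l; rewrite /s_allowed hf.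
  + exact: Or31.
  + by right.
  + by move=> _; left; apply/set_SE; exists b, n.+1, l.
  by move=> e1; rewrite he in e1.
split=> [[[/set_SE[b [[|n] [l [// n0 ->]]]]|]|/set_TE[b [[|n] [l [// _ ->]]]]]
          |[|[b [n [l [+ ->]]]]|[b [n [l [_ ->]]]]]].
+ by apply: Or32; exists b, n, l; rewrite /s_allowed hf.
+ exact: Or31.
+ by apply: Or33; exists b, n, l.
+ by left; right.
+ by move=> _; left; left; apply/set_SE; exists b, n.+1, l.
by right; apply/set_TE; exists b, n.+1, l.
Qed.
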